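(* Suppose $p \geq 1$ is computable and $p \neq 2$, let $n\ge 1$, and let $\mathbf{d}$ be a c.e. Turing degree. Then there is a computable presentation $(\ell^p_n \oplus L^p[0,1])^\#$ of $\ell^p_n \oplus L^p[0,1]$ such that every degree that computes an isometric isomorphism of (the standard presentation of) $\ell^p_n \oplus L^p[0,1]$ onto $(\ell^p_n \oplus L^p[0,1])^\#$ also computes $\mathbf{d}$.
   Context: $\ell^p_n\oplus L^p[0,1]$ is the $L^p$-sum with norm $\|(u,f)\|=(\|u\|^p+\|f\|^p)^{1/p}$; scalars are complex. A presentation of a Banach space $\mathcal{B}$ is a pair $(\mathcal{B},R)$ with $R:\mathbb{N}\to\mathcal{B}$ having dense linear span; rational vectors are $\sum_{j\le M}\alpha_jR(j)$, $\alpha_j\in\mathbb{Q}(i)$; it is computable if the norm is computable on rational vectors. The standard presentation of $\ell^p_n\oplus L^p[0,1]$ is given by the vectors $(e_j,\mathbf{0})$, $j<n$, and $(\mathbf{0},\chi_I)$ for dyadic subintervals $I$ of $[0,1]$. A map $T$ between presentations is $X$-computable if an $X$-oracle algorithm, given any sequence of rational vectors $(r_k)$ with $\|r_k-f\|<2^{-k}$, outputs such a sequence for $T(f)$. *)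

(* Defs.v *)
From HB Require Import structures.
From mathcomp Require Import all_boot all_order all_algebra.
From mathcomp Require Import all_classical all_reals all_analysis.
From mathcomp Require Import measurable_realfun complex.

Set Implicit Arguments.
Unset Strict Implicit.
Unset Printing Implicit Defensive.

Import Order.TTheory GRing.Theory Num.Theory.
Import numFieldNormedType.Exports.

Local Open Scope classical_set_scope.

(** Mu-recursive programs with an extra basic function [OAsk], the oracle.
    Programs carry no arity: missing arguments are read as 0. *)
Inductive oprog : Type :=
  | OZero
  | OSucc
  | OProj of nat
  | OAsk
  | OComp of oprog & seq oprog
  | ORec of oprog & oprog
  | OMin of oprog.

(** [oeval o e v y]: program [e] with oracle [o] halts on input [v] with
    output [y].  [OMin e] on [v] returns the least [n] with [e (n :: v) = 0],
    provided that [e (m :: v)] halts for all [m < n]. *)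
Inductive oeval (o : nat -> nat) : oprog -> seq nat -> nat -> Prop :=
  | oeval_zero v : oeval o OZero v 0
  | oeval_succ v : oeval o OSucc v (nth 0 v 0).+1
  | oeval_proj i v : oeval o (OProj i) v (nth 0 v i)
  | oeval_ask v : oeval o OAsk v (o (nth 0 v 0))
  | oeval_comp e es v w y :
      oevals o es v w -> oeval o e w y -> oeval o (OComp e es) v y
  | oeval_rec0 e1 e2 v y :
      oeval o e1 v y -> oeval o (ORec e1 e2) (0 :: v) y
  | oeval_recS e1 e2 n v r y :
      oeval o (ORec e1 e2) (n :: v) r -> oeval o e2 [:: n, r & v] y ->
      oeval o (ORec e1 e2) (n.+1 :: v) y
  | oeval_min e v n (r : nat -> nat) :
      (forall m, m < n -> oeval o e (m :: v) (r m).+1) ->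
      oeval o e (n :: v) 0 -> oeval o (OMin e) v n
with oevals (o : nat -> nat) : seq oprog -> seq nat -> seq nat -> Prop :=
  | oevals_nil v : oevals o [::] v [::]
  | oevals_cons e es v y w :
      oeval o e v y -> oevals o es v w -> oevals o (e :: es) v (y :: w).

Definition no_oracle : nat -> nat := fun=> 0.

Definition char_fun (A : set nat) : nat -> nat := fun k => `[< A k >].

Definition oracle_join (f g : nat -> nat) : nat -> nat :=
  fun k => if odd k then g k./2 else f k./2.

Definition Turing_le (A B : set nat) : Prop :=
  exists e, forall k, oeval (char_fun B) e [:: k] (char_fun A k).

Definition Turing_equiv (A B : set nat) : Prop :=
  Turing_le A B /\ Turing_le B A.

Definition ce_set (A : set nat) : Prop :=
  exists e, forall k, A k <-> exists y, oeval no_oracle e [:: k] y.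

Record Turing_degree : Type := TuringDegree {
  degree_set :> set nat -> Prop;
  degreeP : exists A, degree_set = [set B | Turing_equiv A B]
}.

Definition ce_degree (d : Turing_degree) : Prop := exists2 A, d A & ce_set A.

Definition degree_le (d x : Turing_degree) : Prop :=
  forall A X, d A -> x X -> Turing_le A X.

Local Open Scope ring_scope.

(** Rational data are coded by natural numbers through the bijection
    [CodeSeq.decode] between [nat] and [seq nat].  The decoding maps below are
    onto but not one-to-one; [:: a; b; c] codes [(a - b) / (c + 1)]. *)

Definition rat_of_code (c : nat) : rat :=
  let s := CodeSeq.decode c in
  ((nth 0%N s 0)%:R - (nth 0%N s 1)%:R) / (nth 0%N s 2).+1%:R.

Definition crat_of_code (R : realType) (c : nat) : R[i] :=
  let s := CodeSeq.decode c in
  Complex (ratr (rat_of_code (nth 0%N s 0))) (ratr (rat_of_code (nth 0%N s 1))).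

Definition computable_real (R : realType) (x : R) : Prop :=
  exists e, forall k, exists2 q,
    oeval no_oracle e [:: k] q & `|ratr (rat_of_code q) - x| < 2^-1 ^+ k.

(** Below, [V] and [W] carry the norms [N] and [M], and [r] and [s] are the
    distinguished sequences of presentations of [V] and [W]. *)
Section Presentations.
Variables (R : realType).
Implicit Types (V W : lmodType R[i]).

Definition is_presentation V (N : V -> R) (r : nat -> V) : Prop :=
  forall (x : V) (eps : R), 0 < eps ->
    exists s : seq R[i], N (x - \sum_(j < size s) nth 0 s j *: r j) < eps.

Definition rational_vector V (r : nat -> V) (c : nat) : V :=
  let s := CodeSeq.decode c in
  \sum_(j < size s) crat_of_code R (nth 0%N s j) *: r j.

Definition computable_presentation V (N : V -> R) (r : nat -> V) : Prop :=
  is_presentation N r /\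
  exists e, forall c k, exists2 q,
    oeval no_oracle e [:: c; k] q &
    `|ratr (rat_of_code q) - N (rational_vector r c)| < 2^-1 ^+ k.

Definition is_name V (N : V -> R) (r : nat -> V) (x : V) (f : nat -> nat) :
    Prop :=
  forall k, N (rational_vector r (f k) - x) < 2^-1 ^+ k.

(** The program sees the graph of [X] on even queries and the given name of
    the argument on odd queries. *)
Definition computable_map (X : set nat) V (N : V -> R) (r : nat -> V)
    W (M : W -> R) (s : nat -> W) (T : V -> W) : Prop :=
  exists e, forall x f, is_name N r x f ->
    exists2 g, is_name M s (T x) g &
      forall k, oeval (oracle_join (char_fun X) f) e [:: k] (g k).

Definition isometric_isomorphism V (N : V -> R) W (M : W -> R) (T : V -> W) :
    Prop :=
  [/\ linear T, forall x, M (T x) = N x & forall y, exists x, T x = y].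

Definition degree_computes_isometric_isomorphism (x : Turing_degree)
    V (N : V -> R) (r : nat -> V) W (M : W -> R) (s : nat -> W) : Prop :=
  exists T : V -> W, isometric_isomorphism N M T /\
    exists2 X, x X & computable_map X N r M s T.

End Presentations.

Section LpUnit.
Variable R : realType.

Lemma measurable_unit_itv :
  measurable (`[0, 1]%classic : set (measurableTypeR R)).
Proof. exact: measurable_itv. Qed.

(** Lebesgue measure on [0,1], viewed as a measure on the line that vanishes
    outside [0,1]: functions are defined on the line, and their values outside
    [0,1] are irrelevant. *)
Definition unit_measure : {measure set (measurableTypeR R) -> \bar R} :=
  mrestr (@lebesgue_measure R) measurable_unit_itv.

Definition Cmeasurable (f : measurableTypeR R -> R[i]) : Prop :=
  measurable_fun [set: measurableTypeR R] (fun x => complex.Re (f x) : R) /\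
  measurable_fun [set: measurableTypeR R] (fun x => complex.Im (f x) : R).

Definition CLnorm (p : R) (f : measurableTypeR R -> R[i]) : \bar R :=
  Lnorm unit_measure p%:E (fun x => (Normc.normc (f x))%:E).

Definition LpC (p : R) (p1 : 1 <= p) : {pred measurableTypeR R -> R[i]} :=
  mem [set f | Cmeasurable f /\ (CLnorm p f < +oo)%E].

Lemma measurable_normc f : Cmeasurable f ->
  measurable_fun [set: measurableTypeR R] (fun x => Normc.normc (f x) : R).
Proof.
move=> [mr mi].
rewrite (_ : (fun x => _) =
  (fun x => Num.sqrt (complex.Re (f x) ^+ 2 + complex.Im (f x) ^+ 2))).
  have ms : measurable_fun [set: measurableTypeR R] (@Num.sqrt R).
    apply: continuous_measurable_fun; exact: sqrt_continuous.
  apply: (measurableT_comp ms).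
  by apply: measurable_funD; apply: measurable_funX.
by apply/funext => x; case: (f x).
Qed.

Lemma CLnorm_lty_le p f (g : measurableTypeR R -> R) : 0 <= p ->
  Cmeasurable f -> measurable_fun [set: measurableTypeR R] g ->
  (forall x, Normc.normc (f x) <= g x) ->
  finite_norm unit_measure p%:E g -> (CLnorm p f < +oo)%E.
Proof.
move=> p0 mf mg fg; apply: le_lt_trans.
have f0 x : 0 <= Normc.normc (f x) by case: (f x) => a b; exact: sqrtr_ge0.
have mp (h : measurableTypeR R -> R) :
    measurable_fun [set: measurableTypeR R] h ->
    measurable_fun [set: measurableTypeR R] (fun x => (`|(h x)%:E| `^ p)%E).
  move=> mh; apply: (measurableT_comp (measurable_poweR _)).
  by apply: measurableT_comp => //; exact/measurable_EFinP.
rewrite /CLnorm unlock; apply: gt0_ler_poweR.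
- by rewrite invr_ge0.
- by rewrite in_itv/= leey andbT integral_ge0// => x _; exact: poweR_ge0.
- by rewrite in_itv/= leey andbT integral_ge0// => x _; exact: poweR_ge0.
apply: ge0_le_integral => //.
- by move=> x _; exact: poweR_ge0.
- by apply: mp; exact: measurable_normc.
- exact: mp.
move=> x _; apply: gt0_ler_poweR => //.
- by rewrite in_itv/= leey andbT.
- by rewrite in_itv/= leey andbT.
by rewrite /= lee_fin !ger0_norm// (le_trans (f0 x)).
Qed.

Lemma LpC_submod_closed p (p1 : 1 <= p) : submod_closed (LpC p1).
Proof.
split.
  rewrite inE /=; split; first by split; exact: measurable_cst.
  rewrite /CLnorm (_ : (fun x => _) = cst 0%E); last first.
    by apply/funext => x; congr EFin; exact: Normc.normc0.
  by rewrite Lnorm0// eqe gt_eqF// (lt_le_trans _ p1).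
move=> a f g; rewrite !inE /= => -[mf lf] [mg lg].
have mafg : Cmeasurable (a *: f + g).
  case: mf mg => [mfr mfi] [mgr mgi]; split.
    rewrite (_ : (fun x => _) = (fun x =>
      complex.Re a * complex.Re (f x) - complex.Im a * complex.Im (f x)
      + complex.Re (g x))); last first.
      apply/funext => x /=; rewrite /GRing.add /GRing.scale /=.
      by case: a (f x) (g x) => [a b] [c e] [h i].
    apply: measurable_funD => //; apply: measurable_funB;
      exact: measurable_funM.
  rewrite (_ : (fun x => _) = (fun x =>
    complex.Re a * complex.Im (f x) + complex.Im a * complex.Re (f x)
    + complex.Im (g x))); last first.
    apply/funext => x /=; rewrite /GRing.add /GRing.scale /=.
    by case: a (f x) (g x) => [a b] [c e] [h i].
  apply: measurable_funD => //; apply: measurable_funD;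
    exact: measurable_funM.
split => //.
have pe1 : (1%:E <= p%:E)%E by rewrite lee_fin.
pose nf x : R := Normc.normc (f x); pose ng x : R := Normc.normc (g x).
have Lf : (nf : measurableTypeR R -> R) \in Lfun unit_measure p%:E.
  by rewrite !inE; apply/andP; split; rewrite inE//; exact: measurable_normc.
have Lg : (ng : measurableTypeR R -> R) \in Lfun unit_measure p%:E.
  by rewrite !inE; apply/andP; split; rewrite inE//; exact: measurable_normc.
have [_ cl] := Lfun_submod_closed unit_measure pe1.
have := cl (Normc.normc a) _ _ Lf Lg.
rewrite inE => /andP[/[!inE] /= mh lh].
apply: (CLnorm_lty_le _ mafg mh _ lh) => [|x]; first exact: le_trans p1.
by apply: (le_trans (le_normcD _ _)); rewrite Normc.normcM.
Qed.

HB.instance Definition _ p (p1 : 1 <= p) :=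
  GRing.isSubmodClosed.Build _ _ (LpC p1) (LpC_submod_closed p1).

Record LpCfun (p : R) (p1 : 1 <= p) := MkLpCfun {
  LpCfun_val :> measurableTypeR R -> R[i];
  LpCfunP : LpCfun_val \in LpC p1
}.

HB.instance Definition _ p (p1 : 1 <= p) := [isSub for @LpCfun_val p p1].
HB.instance Definition _ p (p1 : 1 <= p) := [Choice of LpCfun p1 by <:].
HB.instance Definition _ p (p1 : 1 <= p) :=
  [SubChoice_isSubLmodule of LpCfun p1 by <:].

Section LpSpace.
Variables (p : R) (p1 : 1 <= p).

Definition LpC_ae_eq (f g : LpCfun p1) : bool :=
  `[< {ae unit_measure, forall x, f x = g x} >].

Let LpC_ae_eq_refl : reflexive LpC_ae_eq.
Proof. by move=> f; apply/asboolP; exact: aeW. Qed.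

Let LpC_ae_eq_sym : symmetric LpC_ae_eq.
Proof.
by move=> f g; apply/idP/idP => /asboolP fg; apply/asboolP; near=> x;
  symmetry; near: x.
Unshelve. all: by end_near. Qed.

Let LpC_ae_eq_trans : transitive LpC_ae_eq.
Proof.
move=> g f h /asboolP fg /asboolP gh; apply/asboolP.
by apply: filterS2 fg gh => x -> ->.
Qed.

Canonical LpC_ae_eq_canonical :=
  EquivRel LpC_ae_eq LpC_ae_eq_refl LpC_ae_eq_sym LpC_ae_eq_trans.

Local Open Scope quotient_scope.

Definition LpSpace : Type := {eq_quot LpC_ae_eq}.
HB.instance Definition _ := Choice.on LpSpace.
HB.instance Definition _ := EqQuotient.on LpSpace.

Definition Lp_class (f : LpCfun p1) : LpSpace := \pi_LpSpace f.

Lemma Lp_classP f g :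
  Lp_class f = Lp_class g <-> {ae unit_measure, forall x, f x = g x}.
Proof.
by split=> [/eqquotP/asboolP //|fg]; apply/eqquotP/asboolP.
Qed.

Lemma repr_Lp_class f : {ae unit_measure, forall x, repr (Lp_class f) x = f x}.
Proof. by apply/Lp_classP; rewrite /Lp_class reprK. Qed.

Lemma Lp_classK (x : LpSpace) : Lp_class (repr x) = x.
Proof. exact: reprK. Qed.

Definition Lp_zero : LpSpace := Lp_class 0.
Definition Lp_opp (x : LpSpace) : LpSpace := Lp_class (- repr x).
Definition Lp_add (x y : LpSpace) : LpSpace := Lp_class (repr x + repr y).
Definition Lp_scale (a : R[i]) (x : LpSpace) : LpSpace :=
  Lp_class (a *: repr x).

Lemma Lp_oppE f : Lp_opp (Lp_class f) = Lp_class (- f).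
Proof.
by apply/Lp_classP; apply: filterS (repr_Lp_class f) => x /= e;
  congr (- _).
Qed.

Lemma Lp_addE f g : Lp_add (Lp_class f) (Lp_class g) = Lp_class (f + g).
Proof.
by apply/Lp_classP; apply: filterS2 (repr_Lp_class f) (repr_Lp_class g)
  => x /= ef eg; congr (_ + _).
Qed.

Lemma Lp_scaleE a f : Lp_scale a (Lp_class f) = Lp_class (a *: f).
Proof.
by apply/Lp_classP; apply: filterS (repr_Lp_class f) => x /= e;
  congr (a *: _).
Qed.

Fact Lp_addA : associative Lp_add.
Proof.
move=> x y z; rewrite -(Lp_classK x) -(Lp_classK y) -(Lp_classK z).
by rewrite !Lp_addE addrA.
Qed.

Fact Lp_addC : commutative Lp_add.
Proof. by move=> x y; rewrite /Lp_add addrC. Qed.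

Fact Lp_add0 : left_id Lp_zero Lp_add.
Proof. by move=> x; rewrite -(Lp_classK x) Lp_addE add0r. Qed.

Fact Lp_addN : left_inverse Lp_zero Lp_opp Lp_add.
Proof. by move=> x; rewrite -(Lp_classK x) Lp_oppE Lp_addE addNr. Qed.

HB.instance Definition _ :=
  GRing.isZmodule.Build LpSpace Lp_addA Lp_addC Lp_add0 Lp_addN.

Fact Lp_scaleA a b x : Lp_scale a (Lp_scale b x) = Lp_scale (a * b) x.
Proof. by rewrite -(Lp_classK x) !Lp_scaleE scalerA. Qed.

Fact Lp_scale1 : left_id 1 Lp_scale.
Proof. by move=> x; rewrite -(Lp_classK x) Lp_scaleE scale1r. Qed.

Fact Lp_scaleDr : right_distributive Lp_scale +%R.
Proof.
move=> a x y; rewrite -(Lp_classK x) -(Lp_classK y).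
by rewrite /GRing.add /= !(Lp_scaleE, Lp_addE) scalerDr.
Qed.

Fact Lp_scaleDl x : {morph Lp_scale^~ x : a b / a + b}.
Proof.
move=> a b; rewrite -(Lp_classK x) [in RHS]/GRing.add /=.
by rewrite !(Lp_scaleE, Lp_addE) scalerDl.
Qed.

HB.instance Definition _ := GRing.Zmodule_isLmodule.Build R[i] LpSpace
  Lp_scaleA Lp_scale1 Lp_scaleDr Lp_scaleDl.

Definition Lp_norm (x : LpSpace) : R := fine (CLnorm p (repr x)).

Lemma Lp_norm_class f : Lp_norm (Lp_class f) = fine (CLnorm p f).
Proof.
rewrite /Lp_norm /CLnorm unlock; congr (fine (poweR _ _)).
have m (h : LpCfun p1) : measurable_fun [set: measurableTypeR R]
    (fun x => (`|(Normc.normc (h x))%:E| `^ p)%E).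
  apply: (measurableT_comp (measurable_poweR _)).
  apply: measurableT_comp => //; apply/measurable_EFinP.
  by apply: measurable_normc; have := LpCfunP h; rewrite inE => -[].
apply: ge0_ae_eq_integral => //.
- by move=> x _; exact: poweR_ge0.
- by move=> x _; exact: poweR_ge0.
by apply: filterS (repr_Lp_class f) => x -> _.
Qed.

End LpSpace.
End LpUnit.

Section LpSum.
Variables (R : realType) (n : nat) (p : R) (p1 : 1 <= p).

Definition lp_norm (u : 'rV[R[i]]_n) : R :=
  (\sum_(j < n) Normc.normc (u 0 j) `^ p) `^ p^-1.

Definition LpSum : lmodType R[i] := ('rV[R[i]]_n * LpSpace p1)%type.

Definition LpSum_norm (v : LpSum) : R :=
  (lp_norm v.1 `^ p + Lp_norm v.2 `^ p) `^ p^-1.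

Fact indicator_LpC (a b : R) :
  (fun x : measurableTypeR R => (\1_(`[a, b]%classic) x)%:C%C) \in LpC p1.
Proof.
rewrite inE /=.
have mS : measurable (`[a, b]%classic : set (measurableTypeR R)).
  exact: measurable_itv.
have mi : Cmeasurable (fun x : measurableTypeR R =>
    (\1_(`[a, b]%classic) x)%:C%C).
  by split; [exact: measurable_indic | exact: measurable_cst].
split => //.
apply: (@CLnorm_lty_le R p _ (cst 1)) => //; first exact: le_trans p1.
  move=> x; rewrite /= expr0n addr0 sqrtr_sqr ger0_norm ?indicE//.
  by case: (x \in _).
rewrite /finite_norm (_ : _ \o _ = cst 1%E)// Lnorm_cst1 /=.
by rewrite /mrestr setTI lebesgue_measure_itv/= lte_fin ltr01 sube0 poweR_EFin
  ltry.
Qed.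

Definition indicator (a b : R) : LpSpace p1 :=
  Lp_class (MkLpCfun (indicator_LpC a b)).

(** The dyadic intervals [[j / 2^m, (j+1) / 2^m]], [j < 2^m], are enumerated
    without repetition by the positive integers [k = 2^m + j]. *)
Definition dyadic_indicator (k : nat) : LpSpace p1 :=
  let m := trunc_log 2 k in
  let j := (k - 2 ^ m)%N in
  indicator (j%:R / 2 ^+ m) (j.+1%:R / 2 ^+ m).

Definition standard_presentation (k : nat) : LpSum :=
  match insub k : option 'I_n with
  | Some j => (delta_mx 0 j, 0)
  | None => (0, dyadic_indicator (k - n).+1)
  end.

End LpSum.

(* Main.v *)
(** Let [A] be a c.e. set in [d], and let [gamma] in [(0, 1)] be the limit of an
    increasing computable sequence [gam s] of dyadic rationals which moves by at
    least [2^-(k+2)] when [k] enters [A].  Spread a unit of mass over [[0, gamma)]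
    and one atom of mass [1 - gamma] placed after it; the resulting [L^p] space,
    together with the [n - 1] remaining atoms, is a copy of the given space.  Take
    as distinguished vectors the indicators of the tails starting at dyadic numbers
    certified to be below [gamma], besides the remaining atoms.  A combination of
    tails has the same norm as the corresponding step function on [[0, 1]], so
    [gamma] does not enter the norm and the presentation is computable.

    Since [p <> 2], the equality case of Clarkson's inequality expresses
    disjointness of supports by norms, so an isometric isomorphism sends some
    standard atom to a unimodular multiple of the special atom.  A rational vector
    close to that multiple must have a nearly unimodular coefficient on all points
    beyond the tails which it mentions, hence these tails reach close to [gamma].
    The index of an approximation thus bounds the stage at which [A] has settled
    below [k]. *)

Require Import Defs.
From mathcomp Require Import all_boot all_order all_algebra.
From mathcomp Require Import all_classical all_reals all_analysis.
From mathcomp Require Import measurable_realfun complex.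
From mathcomp Require finmap.
From mathcomp Require Import ring lra.

Set Implicit Arguments.
Unset Strict Implicit.
Unset Printing Implicit Defensive.

Import Order.TTheory GRing.Theory Num.Theory.
Import numFieldNormedType.Exports.

(** * Recursive functions *)

(* Only lower bounds of gamma can be computed, yet the norm must be computable. Hence no
   distinguished vector may tell the special atom from the piece of the interval just below gamma:
   every tail carries both with one and the same coefficient, so their masses are measured together,
   as if they formed a single interval ending at 1. The special atom still belongs to the closed
   span, as the limit of tails whose starting points increase to gamma. Approximating it by rational
   vectors is thus possible but as hard as locating gamma, and an isometry from the standard
   presentation is forced to do it, because standard atoms have constant names. Which standard atom
   is involved depends on the isometry; it is one of finitely many, so this choice is built into the
   program and costs no oracle.

   Estimates use the p-th power of the norm, which adds over disjoint pieces; a crude factor 2^p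
   stands in for the triangle inequality. *)
Scheme oeval_mut := Minimality for oeval Sort Prop
  with oevals_mut := Minimality for oevals Sort Prop.

(** A query is cut down to its single argument before [q] is called, because programs carry no arity
    and [q] is only specified on one-element inputs. *)
Fixpoint osubst (q e : oprog) : oprog :=
  match e with
  | OAsk => OComp q [:: OProj 0]
  | OComp e es => OComp (osubst q e) (map (osubst q) es)
  | ORec e1 e2 => ORec (osubst q e1) (osubst q e2)
  | OMin e => OMin (osubst q e)
  | _ => e
  end.

Lemma oeval_osubst (o o' : nat -> nat) q :
  (forall k, oeval o' q [:: k] (o k)) ->
  forall e v y, oeval o e v y -> oeval o' (osubst q e) v y.
Proof.
move=> oq; apply: (@oeval_mut o
  (fun e v y => oeval o' (osubst q e) v y)
  (fun es v w => oevals o' (map (osubst q) es) v w)) => /=.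
- by move=> v; exact: oeval_zero.
- by move=> v; exact: oeval_succ.
- by move=> i v; exact: oeval_proj.
- move=> v; apply: oeval_comp (oq _).
  by apply: oevals_cons; [exact: oeval_proj | exact: oevals_nil].
- by move=> e es v w y _ IHes _ IHe; exact: oeval_comp IHes IHe.
- by move=> e1 e2 v y _ IH; exact: oeval_rec0.
- by move=> e1 e2 n v r y _ IH1 _ IH2; exact: oeval_recS IH1 IH2.
- by move=> e v n r _ IH1 _ IH2; exact: oeval_min IH1 IH2.
- by move=> v; exact: oevals_nil.
- by move=> e es v y w _ IH1 _ IH2; exact: oevals_cons IH1 IH2.
Qed.

(** * Environments and closure properties of recursive functions *)

(** An environment is a tuple of variables flattened to an input list of fixed length. In [E * nat]
    the new variable comes first in the list, where [ORec] and [OMin] put their counters. *)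
Class env (E : Type) :=
  Env { enc : E -> seq nat; arity : nat; size_enc : forall x, size (enc x) = arity }.

Arguments enc {E _} x.
Arguments arity E {_}.

#[global] Instance env_unit : env unit.
Proof. by exists (fun=> [::]) 0. Defined.

#[global] Instance env_prod E {eE : env E} : env (E * nat).
Proof. exists (fun x => x.2 :: enc x.1) (arity E).+1 => x /=.
by rewrite size_enc. Defined.

#[global] Instance env_tuple m : env (m.-tuple nat).
Proof. by exists (@tval m nat) m => x; exact: size_tuple. Defined.

Definition recursive o E {eE : env E} (f : E -> nat) :=
  exists e, forall x, oeval o e (enc x) (f x).

Definition rec1 o (f : nat -> nat) := recursive o (fun x : unit * nat => f x.2).
Definition rec2 o (f : nat -> nat -> nat) :=
  recursive o (fun x : unit * nat * nat => f x.2 x.1.2).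
Definition rec3 o (f : nat -> nat -> nat -> nat) :=
  recursive o (fun x : unit * nat * nat * nat => f x.2 x.1.2 x.1.1.2).

Section Recursive.
Variable o : nat -> nat.

Lemma recursive_ext E {eE : env E} (f g : E -> nat) :
  (forall x, f x = g x) -> recursive o f -> recursive o g.
Proof. by move=> fg [e h]; exists e => x; rewrite -fg. Qed.

Lemma oevals_recursive E {eE : env E} (fs : seq (E -> nat)) :
  (forall i, i < size fs -> recursive o (nth (fun=> 0) fs i)) ->
  exists es, forall x, oevals o es (enc x) [seq f x | f <- fs].
Proof.
elim: fs => [|f fs IH] h; first by exists [::] => x; exact: oevals_nil.
have [e he] := h 0 erefl.
have [i|es hes] := IH; first exact: (h i.+1).
by exists (e :: es) => x; apply: oevals_cons.
Qed.

(** The general change of variables: a map between environments is admissible as soon as each entry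
    of its encoded value is recursive. *)
Lemma recursive_subst E E' {eE : env E} {eE' : env E'} (f : E' -> nat) (h : E -> E') :
  recursive o f -> (forall i, i < arity E' ->
    recursive o (fun x => nth 0 (enc (h x)) i)) ->
  recursive o (fun x => f (h x)).
Proof.
move=> [e he] hh.
pose fs := [seq (fun x => nth 0 (@enc _ eE' (h x)) i) | i <- iota 0 (@arity _ eE')].
have [|es hes] := @oevals_recursive _ _ fs.
  move=> i; rewrite size_map size_iota => ilt.
  by rewrite (nth_map 0) ?size_iota// nth_iota//; exact: hh.
exists (OComp e es) => x; apply: oeval_comp (he _).
have := hes x; congr oevals; apply: (@eq_from_nth _ 0).
  by rewrite !size_map size_iota size_enc.
move=> i; rewrite size_map => ilt; rewrite (nth_map (fun=> 0))// /fs.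
move: ilt; rewrite size_map size_iota => ilt.
by rewrite (nth_map 0) ?size_iota// nth_iota.
Qed.

Lemma recursive_var E {eE : env E} i : recursive o (fun x => nth 0 (enc x) i).
Proof. by exists (OProj i) => x; exact: oeval_proj. Qed.

Lemma recursive_var0 E {eE : env E} : recursive o (fun x : E * nat => x.2).
Proof. exact: recursive_var 0. Qed.
Lemma recursive_var1 E {eE : env E} : recursive o (fun x : E * nat * nat => x.1.2).
Proof. exact: recursive_var 1. Qed.
Lemma recursive_var2 E {eE : env E} :
  recursive o (fun x : E * nat * nat * nat => x.1.1.2).
Proof. exact: recursive_var 2. Qed.
Lemma recursive_var3 E {eE : env E} :
  recursive o (fun x : E * nat * nat * nat * nat => x.1.1.1.2).
Proof. exact: recursive_var 3. Qed.
Lemma recursive_var4 E {eE : env E} :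
  recursive o (fun x : E * nat * nat * nat * nat * nat => x.1.1.1.1.2).
Proof. exact: recursive_var 4. Qed.

Lemma recursive_weaken E {eE : env E} (f : E -> nat) :
  recursive o f -> recursive o (fun x : E * nat => f x.1).
Proof.
move=> h; apply: (recursive_subst (h := fst) h) => i _.
exact: (recursive_var i.+1).
Qed.

Lemma recursive_app1 g E {eE : env E} (a : E -> nat) :
  rec1 o g -> recursive o a -> recursive o (fun x => g (a x)).
Proof.
move=> hg ha.
by apply: (recursive_subst (h := fun x => (tt, a x)) hg) => -[|].
Qed.

Lemma recursive_app2 g E {eE : env E} (a b : E -> nat) :
  rec2 o g -> recursive o a -> recursive o b -> recursive o (fun x => g (a x) (b x)).
Proof.
move=> hg ha hb.
by apply: (recursive_subst (h := fun x => (tt, b x, a x)) hg) => -[|[|]].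
Qed.

Lemma recursive_app3 g E {eE : env E} (a b c : E -> nat) :
  rec3 o g -> recursive o a -> recursive o b -> recursive o c ->
  recursive o (fun x => g (a x) (b x) (c x)).
Proof.
move=> hg ha hb hc.
by apply: (recursive_subst (h := fun x => (tt, c x, b x, a x)) hg) => -[|[|[|]]].
Qed.

Lemma recursive_succ E {eE : env E} (a : E -> nat) :
  recursive o a -> recursive o (fun x => (a x).+1).
Proof.
by apply: (recursive_app1 (g := succn)); exists OSucc => x; exact: oeval_succ.
Qed.

Lemma recursive_const E {eE : env E} n : recursive o (fun _ : E => n).
Proof.
elim: n => [|n IH]; first by exists OZero => x; exact: oeval_zero.
exact: recursive_succ.
Qed.

(** The environment [(x, r, n)] is encoded as [n :: r :: enc x], which is the input of the step
    program in [oeval_recS]: counter [x.2], accumulated value [x.1.2]. *)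
Lemma recursive_iteri E {eE : env E} (b a : E -> nat) (h : E -> nat -> nat -> nat) :
  recursive o a -> recursive o b ->
  recursive o (fun x : E * nat * nat => h x.1.1 x.2 x.1.2) ->
  recursive o (fun x => iteri (a x) (h x) (b x)).
Proof.
move=> ha [e1 he1] [e2 he2].
have hr : recursive o (fun x : E * nat => iteri x.2 (h x.1) (b x.1)).
  exists (ORec e1 e2) => -[x n] /=; elim: n => [|n IH] /=.
    exact: oeval_rec0.
  by apply: (oeval_recS IH); exact: (he2 (x, _, n)).
apply: (recursive_subst (h := fun x => (x, a x)) hr) => -[_|i _] //.
exact: (recursive_var i).
Qed.

Lemma recursive_min E {eE : env E} (f : E -> nat -> nat) :
  recursive o (fun x : E * nat => f x.1 x.2) -> (forall x, exists n, f x n = 0) ->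
  exists2 g, recursive o g & forall x, f x (g x) = 0.
Proof.
move=> [e he] f0.
have f0' x : exists n, f x n == 0 by have [n fn] := f0 x; exists n; rewrite fn.
exists (fun x => ex_minn (f0' x)).
  exists (OMin e) => x; case: ex_minnP => n /eqP fn nmin.
  apply: (@oeval_min _ _ _ _ (fun m => (f x m).-1)).
    move=> m mn; rewrite prednK.
      exact: (he (x, m)).
    by rewrite lt0n; apply: contraTN mn => /nmin; rewrite -leqNgt.
  by have := he (x, n); rewrite /= fn.
by move=> x; case: ex_minnP => n /eqP.
Qed.

Lemma recursive_pred E {eE : env E} (a : E -> nat) :
  recursive o a -> recursive o (fun x => (a x).-1).
Proof.
apply: (recursive_app1 (g := predn)).
apply: (@recursive_ext _ _ (fun x => iteri x.2 (fun n _ => n) 0)).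
  by move=> [x []].
apply: recursive_iteri; [exact: recursive_var0|exact: recursive_const|].
exact: recursive_var0.
Qed.

Lemma recursive_add E {eE : env E} (a b : E -> nat) :
  recursive o a -> recursive o b -> recursive o (fun x => a x + b x).
Proof.
move=> ha hb.
apply: (@recursive_ext _ _ (fun x => iteri (a x) (fun _ r => r.+1) (b x))).
  by move=> x; elim: (a x) => // n /= ->.
apply: recursive_iteri => //; apply: recursive_succ; exact: recursive_var1.
Qed.

Lemma recursive_subn E {eE : env E} (a b : E -> nat) :
  recursive o a -> recursive o b -> recursive o (fun x => a x - b x).
Proof.
move=> ha hb.
apply: (@recursive_ext _ _ (fun x => iteri (b x) (fun _ r => r.-1) (a x))).
  by move=> x; elim: (b x) => [|n /= ->]; rewrite ?subn0 ?subnS.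
apply: recursive_iteri => //; apply: recursive_pred; exact: recursive_var1.
Qed.

Lemma recursive_mul E {eE : env E} (a b : E -> nat) :
  recursive o a -> recursive o b -> recursive o (fun x => a x * b x).
Proof.
move=> ha hb.
apply: (@recursive_ext _ _ (fun x => iteri (a x) (fun _ r => b x + r) 0)).
  by move=> x; elim: (a x) => // n /= ->; rewrite mulSn.
apply: recursive_iteri => //; first exact: recursive_const.
apply: recursive_add; last exact: recursive_var1.
exact: (recursive_weaken (recursive_weaken hb)).
Qed.

Lemma recursive_exp E {eE : env E} (a b : E -> nat) :
  recursive o a -> recursive o b -> recursive o (fun x => a x ^ b x).
Proof.
move=> ha hb.
apply: (@recursive_ext _ _ (fun x => iteri (b x) (fun _ r => a x * r) 1)).
  by move=> x; elim: (b x) => // n /= ->; rewrite expnS.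
apply: recursive_iteri => //; first exact: recursive_const.
apply: recursive_mul; last exact: recursive_var1.
exact: (recursive_weaken (recursive_weaken ha)).
Qed.

Lemma recursive_leq E {eE : env E} (a b : E -> nat) :
  recursive o a -> recursive o b -> recursive o (fun x => a x <= b x).
Proof.
move=> ha hb; apply: (@recursive_ext _ _ (fun x => 1 - (a x - b x))).
  by move=> x; rewrite -subn_eq0; case: (a x - b x) => // n; rewrite subSS.
by apply: recursive_subn; [exact: recursive_const|exact: recursive_subn].
Qed.

Lemma recursive_and E {eE : env E} (a b : E -> bool) :
  recursive o (fun x => a x) -> recursive o (fun x => b x) ->
  recursive o (fun x => a x && b x).
Proof.
move=> ha hb; apply: recursive_ext (recursive_mul ha hb) => x.
by rewrite mulnb.
Qed.

Lemma recursive_not E {eE : env E} (a : E -> bool) :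
  recursive o (fun x => a x) -> recursive o (fun x => ~~ a x).
Proof.
move=> ha; apply: recursive_ext (recursive_subn (recursive_const 1) ha) => x.
by case: (a x).
Qed.

Lemma recursive_or E {eE : env E} (a b : E -> bool) :
  recursive o (fun x => a x) -> recursive o (fun x => b x) ->
  recursive o (fun x => a x || b x).
Proof.
move=> ha hb; apply: recursive_ext (recursive_not (recursive_and
  (recursive_not ha) (recursive_not hb))) => x.
by rewrite -negb_or negbK.
Qed.

Lemma recursive_eq E {eE : env E} (a b : E -> nat) :
  recursive o a -> recursive o b -> recursive o (fun x => a x == b x).
Proof.
move=> ha hb; apply: (@recursive_ext _ _ (fun x => (a x <= b x) && (b x <= a x))).
  by move=> x; rewrite -eqn_leq.
by apply: recursive_and; exact: recursive_leq.
Qed.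

Lemma recursive_if E {eE : env E} (c : E -> bool) (a b : E -> nat) :
  recursive o (fun x => c x) -> recursive o a -> recursive o b ->
  recursive o (fun x => if c x then a x else b x).
Proof.
move=> hc ha hb.
apply: (@recursive_ext _ _ (fun x => c x * a x + ~~ c x * b x)).
  by move=> x; case: (c x); rewrite ?mul1n ?mul0n ?addn0 ?add0n.
by apply: recursive_add; apply: recursive_mul => //; exact: recursive_not.
Qed.

Lemma recursive_sum E {eE : env E} (n : E -> nat) (f : E -> nat -> nat) :
  recursive o n -> recursive o (fun x : E * nat => f x.1 x.2) ->
  recursive o (fun x => \sum_(0 <= i < n x) f x i).
Proof.
move=> hn hf.
apply: (@recursive_ext _ _ (fun x => iteri (n x) (fun i r => r + f x i) 0)).
  move=> x; elim: (n x) => [|m IH] /=; first by rewrite big_geq.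
  by rewrite big_nat_recr//= IH.
apply: recursive_iteri => //; first exact: recursive_const.
apply: recursive_add; first exact: recursive_var1.
apply: (recursive_subst (h := fun x : E * nat * nat => (x.1.1, x.2)) hf) => -[_|i _].
  exact: recursive_var0.
exact: (recursive_var i.+2).
Qed.

Lemma recursive_prod E {eE : env E} (n : E -> nat) (f : E -> nat -> nat) :
  recursive o n -> recursive o (fun x : E * nat => f x.1 x.2) ->
  recursive o (fun x => \prod_(0 <= i < n x) f x i).
Proof.
move=> hn hf.
apply: (@recursive_ext _ _ (fun x => iteri (n x) (fun i r => r * f x i) 1)).
  move=> x; elim: (n x) => [|m IH] /=; first by rewrite big_geq.
  by rewrite big_nat_recr//= IH.
apply: recursive_iteri => //; first exact: recursive_const.
apply: recursive_mul; first exact: recursive_var1.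
apply: (recursive_subst (h := fun x : E * nat * nat => (x.1.1, x.2)) hf) => -[_|i _].
  exact: recursive_var0.
exact: (recursive_var i.+2).
Qed.

Lemma recursive_div E {eE : env E} (a b : E -> nat) :
  recursive o a -> recursive o b -> recursive o (fun x => a x %/ b x).
Proof.
move=> ha hb.
(* The quotient counts the positive multiples of [b x] that do not exceed [a x]. *)
apply: (@recursive_ext _ _
  (fun x => if b x == 0 then 0 else \sum_(0 <= i < a x) (i.+1 * b x <= a x))).
  move=> x; case: eqP => [->|/eqP]; first by rewrite divn0.
  rewrite -lt0n => b0; under eq_bigr do rewrite -leq_divRL//.
  set q := a x %/ b x; have qa : q <= a x by exact: leq_div.
  rewrite (big_cat_nat (n := q))//=.
  rewrite big_nat (eq_bigr (fun=> 1)); last by move=> i /andP[_ ->].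
  rewrite -big_nat sum_nat_const_nat subn0 muln1 big_nat big1 ?addn0//.
  by move=> i /andP[qi _]; rewrite ltnNge qi.
apply: recursive_if; first exact: recursive_eq hb (recursive_const 0).
  exact: recursive_const.
apply: recursive_sum => //; apply: recursive_leq; last exact: recursive_weaken.
apply: recursive_mul; first by apply: recursive_succ; exact: recursive_var0.
exact: (recursive_weaken (f := fun x => b x)).
Qed.

End Recursive.

Ltac rec_step := first
  [ assumption
  | simple apply recursive_const
  | simple apply recursive_var0 | simple apply recursive_var1
  | simple apply recursive_var2 | simple apply recursive_var3
  | simple apply recursive_var4
  | simple apply recursive_sum | simple apply recursive_prod
  | simple apply recursive_if
  | simple apply recursive_leq | simple apply recursive_eq
  | simple apply recursive_and | simple apply recursive_or | simple apply recursive_not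
  | simple apply recursive_div | simple apply recursive_exp
  | simple apply recursive_mul | simple apply recursive_add
  | simple apply recursive_subn
  | simple apply recursive_succ | simple apply recursive_pred
  | (simple apply recursive_app3; [assumption|..])
  | (simple apply recursive_app2; [assumption|..])
  | (simple apply recursive_app1; [assumption|..]) ].
Ltac rec := cbv beta; repeat (rec_step; cbn [fst snd]).

(** A program may query even [no_oracle]; answering these queries by a program for 0 makes it
    independent of the oracle. *)
Lemma rec2_oracle o f : rec2 no_oracle f -> rec2 o f.
Proof.
move=> [e he]; exists (osubst OZero e) => x.
by apply: (oeval_osubst _ (he x)) => k; exact: oeval_zero.
Qed.

Lemma Turing_leP A B : Turing_le A B <-> rec1 (char_fun B) (char_fun A).
Proof.
split=> -[e h]; exists e; first by move=> [[] k]; exact: h.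
by move=> k; exact: (h (tt, k)).
Qed.

Lemma Turing_le_trans A B C : Turing_le A B -> Turing_le B C -> Turing_le A C.
Proof.
move=> [e he] [q hq]; exists (osubst q e) => k.
exact: oeval_osubst hq _ _ _ (he k).
Qed.

(** * Bounded evaluation *)

(** The arguments of [OComp] form a list of programs, so its case needs an induction hypothesis for
    every member of that list. *)
Lemma oprog_nested_ind (P : oprog -> Prop) :
  P OZero -> P OSucc -> (forall i, P (OProj i)) -> P OAsk ->
  (forall e es, P e -> foldr (fun e' Q => P e' /\ Q) True es -> P (OComp e es)) ->
  (forall e1 e2, P e1 -> P e2 -> P (ORec e1 e2)) ->
  (forall e, P e -> P (OMin e)) ->
  forall e, P e.
Proof.
move=> h0 h1 h2 h3 h4 h5 h6; fix IH 1.
case=> [||i||e es|e1 e2|e].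
- exact: h0.
- exact: h1.
- exact: h2.
- exact: h3.
- apply: h4; first exact: IH.
  by elim: es => [|e' es IHes]; [exact: I | split; [exact: IH|]].
- by apply: h5; exact: IH.
- by apply: h6; exact: IH.
Qed.

(** The value is shifted by one, [0] meaning that no value has been found with
    searches bounded by [s]. *)
Fixpoint beval (s : nat) (e : oprog) (v : seq nat) : nat :=
  match e with
  | OZero => 1
  | OSucc => (nth 0 v 0).+2
  | OProj i => (nth 0 v i).+1
  | OAsk => 1
  | OComp e es =>
      let w := map (fun e' => beval s e' v) es in
      if 0 \in w then 0 else beval s e (map predn w)
  | ORec e1 e2 =>
      if v is n :: v' then
        iteri n (fun k r => if r == 0 then 0 else beval s e2 [:: k, r.-1 & v'])
          (beval s e1 v')
      else 0
  | OMin e => \sum_(0 <= n < s) n.+1 *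
      ((beval s e (n :: v) == 1) * \prod_(0 <= m < n) (1 < beval s e (m :: v)))
  end.

Lemma prod_nat_bool n (b : nat -> bool) :
  \prod_(0 <= m < n) (b m : nat) = [forall m : 'I_n, b m].
Proof.
case: forallP => [h|h].
  by rewrite big_mkord big1// => i _; rewrite h.
have [i /negbTE bi] : exists i : 'I_n, ~~ b i.
  apply: contra_notP h => h i; apply: contra_notT h => bi; by exists i.
by rewrite big_mkord (bigD1 i)//= bi mul0n.
Qed.

Lemma beval_sound e s v y : beval s e v = y.+1 -> oeval no_oracle e v y.
Proof.
elim/oprog_nested_ind: e v y => /=.
- by move=> v y [<-]; exact: oeval_zero.
- by move=> v y [<-]; exact: oeval_succ.
- by move=> i v y [<-]; exact: oeval_proj.
- by move=> v y [<-]; exact: oeval_ask.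
- move=> e es IHe IHes v y; case: ifPn => // h0 /IHe; apply: oeval_comp.
  elim: es IHes h0 => [|e' es IH] /=; first by move=> _ _; exact: oevals_nil.
  move=> [he' hes]; rewrite inE negb_or eq_sym -lt0n => /andP[h1 h2].
  apply: oevals_cons; last exact: IH.
  by apply: he'; rewrite prednK.
- move=> e1 e2 IH1 IH2 [|n v'] y //.
  elim: n y => [|n IH] y /=; first by move=> /IH1; exact: oeval_rec0.
  case: eqP => // /eqP; rewrite -lt0n => h /IH2; apply: oeval_recS.
  by apply: IH; rewrite prednK.
- move=> e IH v y h.
  (* At most one summand of the search is nonzero: its index is the first zero of [e], all earlier
     values being defined and positive, that is, having shifted value above 1. *)
  have [[[n ns] /= hn /forallP /= hm]|h0] := pselect
      (exists2 n : 'I_s, beval s e (nat_of_ord n :: v) == 1 &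
      [forall m : 'I_n, 1 < beval s e (nat_of_ord m :: v)]); last first.
    move: h; rewrite big_mkord big1// => i _; rewrite prod_nat_bool.
    case: eqP => [/eqP e1|_]; last by rewrite mul0n muln0.
    case: (boolP [forall _, _]) => [e2|].
      by exfalso; apply: h0; exists i.
    by rewrite muln0 ?muln0.
  have e1 : beval s e (n :: v) = 1 by exact/eqP.
  move: h; rewrite big_mkord (bigD1 (Ordinal ns))//= hn mul1n prod_nat_bool.
  have -> : [forall m : 'I_n, 1 < beval s e (nat_of_ord m :: v)] by apply/forallP.
  rewrite muln1 big1 ?addn0 => [[<-]|i /eqP ni]; last first.
    rewrite prod_nat_bool; case: (ltngtP i n) => [ilt|nlt|en].
    + have := hm (Ordinal ilt) => /=; by case: eqP => [->|_ _]; rewrite ?mul0n ?muln0.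
    + case: forallP => [/(_ (Ordinal nlt))|_]; last by rewrite !muln0.
      by rewrite /= e1.
    + by exfalso; apply: ni; exact: val_inj.
  apply: (@oeval_min _ _ _ _ (fun m => (beval s e (m :: v)).-2)).
    by move=> m mn; apply: IH; have := hm (Ordinal mn) => /=; case: (beval _ _ _) => [|[]].
  exact: IH.
Qed.

Lemma eventually_forall_lt (P : nat -> nat -> Prop) n :
  (forall m, m < n -> exists s0, forall s, s0 <= s -> P m s) ->
  exists s0, forall m s, m < n -> s0 <= s -> P m s.
Proof.
elim: n => [|n IH] h; first by exists 0.
have [|s1 h1] := IH; first by move=> m /ltnW; rewrite -ltnS => /h.
have [s2 h2] := h n (ltnSn n).
exists (maxn s1 s2) => m s; rewrite ltnS leq_eqVlt geq_max => /orP[/eqP->|mn] /andP[? ?].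
  exact: h2.
exact: h1.
Qed.

(** The claim is made for all large [s], not just for some [s], so that finitely many subevaluations
    can share one bound. *)
Lemma beval_complete e v y : oeval no_oracle e v y ->
  exists s0, forall s, s0 <= s -> beval s e v = y.+1.
Proof.
move: e v y; apply: (@oeval_mut no_oracle
  (fun e v y => exists s0, forall s, s0 <= s -> beval s e v = y.+1)
  (fun es v w => exists s0, forall s, s0 <= s ->
     map (fun e' => beval s e' v) es = map succn w)) => /=.
- by move=> v; exists 0.
- by move=> v; exists 0.
- by move=> i v; exists 0.
- by move=> v; exists 0.
- move=> e es v w y _ [s1 h1] _ [s2 h2]; exists (maxn s1 s2) => s.
  rewrite geq_max => /andP[a b]; rewrite h1// (mapK succnK).
  by rewrite h2//; case: ifP => // /mapP[].
- by move=> e1 e2 v y _ [s h]; exists s.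
- move=> e1 e2 n v r y _ [s1 h1] _ [s2 h2]; exists (maxn s1 s2) => s.
  by rewrite geq_max => /andP[a b]; rewrite h1//= h2.
- move=> e v n r _ /eventually_forall_lt[s1 h1] _ [s2 h2].
  exists (maxn n.+1 (maxn s1 s2)) => s; rewrite !geq_max => /and3P[ns a b].
  rewrite big_mkord (bigD1 (Ordinal ns))//= h2//= mul1n prod_nat_bool.
  have -> : [forall m : 'I_n, 1 < beval s e (nat_of_ord m :: v)].
    by apply/forallP => m; rewrite h1.
  rewrite muln1 big1 ?addn0// => i /eqP ni.
  rewrite prod_nat_bool; case: (ltngtP i n) => [ilt|nlt|en].
  + by rewrite h1// mul0n muln0.
  + case: forallP => [/(_ (Ordinal nlt))|_]; last by rewrite !muln0.
    by rewrite /= h2.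
  + by exfalso; apply: ni; exact: val_inj.
- by move=> v; exists 0.
- move=> e es v y w _ [s1 h1] _ [s2 h2]; exists (maxn s1 s2) => s.
  by rewrite geq_max => /andP[a b]; rewrite h1// h2.
Qed.

(** The program is fixed, so no universal machine is involved: induction on [e] builds the
    evaluator. The input length [m] is general because composition and recursion change it. *)
Lemma recursive_beval o e m :
  recursive o (fun x : m.-tuple nat * nat => beval x.2 e x.1).
Proof.
have hs : recursive o (fun x : m.-tuple nat * nat => x.2) by exact: recursive_var0.
elim/oprog_nested_ind: e m {hs} => [m|m|i m|m|e es IHe IHes m|e1 e2 IH1 IH2 m|e IH m] /=.
- exact: recursive_const.
- by do 2 apply: recursive_succ; exact: (recursive_var o 1).
- by apply: recursive_succ; exact: (recursive_var o i.+1).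
- exact: recursive_const.
- apply: recursive_if.
  + elim: es IHes => [|e' es IH] /= h; first exact: (recursive_const o 0).
    apply: (@recursive_ext _ _ _ (fun x : m.-tuple nat * nat =>
      ~~ (~~ (beval x.2 e' x.1 == 0) &&
          ~~ (0 \in [seq beval x.2 e'0 x.1 | e'0 <- es])))).
      by move=> x; rewrite inE eq_sym -negb_or negbK.
    apply: recursive_not; apply: recursive_and; apply: recursive_not.
      by apply: recursive_eq; [exact: h.1|exact: recursive_const].
    by apply: IH; exact: h.2.
  + exact: recursive_const.
  + have := IHe (size es).
    move/(recursive_subst (h := fun x : m.-tuple nat * nat =>
      (map_tuple (fun e' => (beval x.2 e' x.1).-1) (in_tuple es), x.2))).
    move=> h; apply: (recursive_ext _ (h _)) => /=.
      by move=> x; congr (beval _ _ _); rewrite -map_comp.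
    move=> [_|i] /=; first exact: recursive_var0.
    rewrite ltnS => ilt.
    apply: (@recursive_ext _ _ _ (fun x : m.-tuple nat * nat =>
      (beval x.2 (nth OZero es i) x.1).-1)).
      by move=> x; rewrite (nth_map OZero).
    apply: recursive_pred.
    elim: es i IHes ilt {IHe h} => // e' es IH [|i] /= [h1 h2] ilt //.
    exact: IH.
- case: m => [|m].
    by apply: recursive_ext (recursive_const o 0) => x; rewrite tuple0.
  apply: (@recursive_ext _ _ _ (fun x : m.+1.-tuple nat * nat =>
    iteri (nth 0 x.1 0) (fun k r =>
       if r == 0 then 0 else beval x.2 e2 [:: k, r.-1 & behead x.1])
       (beval x.2 e1 (behead x.1)))).
    by move=> [[[|n v] hv] s].
  apply: recursive_iteri.
  + exact: (recursive_var o 1).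
  + have := IH1 m; move/(recursive_subst (h := fun x : m.+1.-tuple nat * nat =>
      ([tuple of behead x.1], x.2))); apply => -[_|i _] /=.
      exact: recursive_var0.
    apply: recursive_ext (recursive_var o i.+2) => x /=.
    by rewrite nth_behead.
  + apply: recursive_if.
    * by apply: recursive_eq; [exact: recursive_var1|exact: recursive_const].
    * exact: recursive_const.
    have := IH2 m.+2.
    move/(recursive_subst (h := fun x : m.+1.-tuple nat * nat * nat * nat =>
      ([tuple of [:: x.2, x.1.2.-1 & behead x.1.1.1]], x.1.1.2))); apply => -[_|] /=.
      exact: recursive_var2.
    case=> [_|]; first exact: recursive_var0.
    case=> [_|i _]; first by apply: recursive_pred; exact: recursive_var1.
    apply: recursive_ext (recursive_var o i.+4) => x /=.
    by rewrite nth_behead.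
- have h : recursive o (fun x : m.-tuple nat * nat * nat => beval x.1.2 e (x.2 :: x.1.1)).
    have := IH m.+1; move/(recursive_subst (h := fun x : m.-tuple nat * nat * nat =>
      ([tuple of x.2 :: x.1.1], x.1.2))); apply => -[_|] /=.
      exact: recursive_var1.
    case=> [_|i _]; first exact: recursive_var0.
    exact: (recursive_var o i.+2).
  apply: recursive_sum; first exact: recursive_var0.
  apply: recursive_mul; first by apply: recursive_succ; exact: recursive_var0.
  apply: recursive_mul.
    by apply: recursive_eq => //; exact: recursive_const.
  apply: recursive_prod; first exact: recursive_var0.
  apply: recursive_leq; first exact: recursive_const.
  move: h; move/(recursive_subst (h := fun x : m.-tuple nat * nat * nat * nat =>
      (x.1.1, x.2))); apply => -[_|i _] /=; first exact: recursive_var0.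
  exact: (recursive_var o i.+2).
Qed.

(** Stage [s] asks whether a bounded evaluation has succeeded at some [t < s]; summing over [t]
    makes the stages monotone by construction. *)
Lemma ce_set_stages A : ce_set A ->
  exists E : nat -> nat -> bool, [/\ rec2 no_oracle (fun k s => E k s),
    (forall k s t, s <= t -> E k s -> E k t) & forall k, A k <-> exists s, E k s].
Proof.
move=> [e he].
exists (fun k s => 0 < \sum_(0 <= t < s) beval t e [:: k]); split.
- apply: recursive_leq; first exact: recursive_const.
  apply: recursive_sum; first exact: recursive_var1.
  have := recursive_beval no_oracle e 1.
  move/(recursive_subst (h := fun x : unit * nat * nat * nat =>
      ([tuple x.1.2], x.2))); apply => -[_|] /=; first exact: recursive_var0.
  by case=> // _; exact: recursive_var1.
- move=> k s t st /leq_trans; apply.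
  by rewrite [leqRHS](big_cat_nat (n := s))//= leq_addr.
move=> k; rewrite he; split=> [[y /beval_complete[s h]]|[s]].
  by exists s.+1; rewrite big_nat_recr//= h// addnS.
rewrite lt0n sum_nat_seq_neq0 => /hasP[t _ /=].
rewrite -lt0n; case E : (beval t e [:: k]) => [|y] // _.
by exists y; exact: beval_sound E.
Qed.

(** * Codes of sequences *)

(** [CodeSeq.code] sends [n :: s] to [2 ^ n * (CodeSeq.code s).*2.+1], so the head is the 2-adic
    valuation of the code, obtained by counting the powers of 2 that divide it. The code itself
    bounds every search, including the one for the length. *)
Definition chead c := \sum_(0 <= i < c) (c %/ 2 ^ i.+1 * 2 ^ i.+1 == c).
Definition ctail c := c %/ 2 ^ (chead c).+1.
Definition cdrop c i := iteri i (fun _ => ctail) c.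
Definition cnth c i := chead (cdrop c i).
Definition csize c := \sum_(0 <= i < c) (0 < cdrop c i).
Definition ccons n c := 2 ^ n * c.*2.+1.

Lemma sum_nat_ltn n q : q <= n -> \sum_(0 <= i < n) (i < q : nat) = q.
Proof.
move=> qn; rewrite (big_cat_nat (n := q))//=.
rewrite big_nat (eq_bigr (fun=> 1)); last by move=> i /andP[_ ->].
rewrite -big_nat sum_nat_const_nat subn0 muln1 big_nat big1 ?addn0//.
by move=> i /andP[qi _]; rewrite ltnNge qi.
Qed.

Lemma chead_ccons n c : chead (ccons n c) = n.
Proof.
rewrite /chead -[RHS](@sum_nat_ltn (ccons n c) n); last first.
  by rewrite /ccons (leq_trans (ltnW (ltn_expl n (ltnSn 1))))// leq_pmulr.
apply: eq_bigr => i _; congr nat_of_bool.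
rewrite -dvdn_eq /ccons Gauss_dvdl; last by rewrite coprimeXl// coprime2n /= odd_double.
by rewrite dvdn_Pexp2l.
Qed.

Lemma ctail_ccons n c : ctail (ccons n c) = c.
Proof.
rewrite /ctail chead_ccons /ccons expnSr divnMl ?expn_gt0//.
by rewrite -addn1 -muln2 divnMDl// addn0.
Qed.

Lemma cdrop_code s i : cdrop (CodeSeq.code s) i = CodeSeq.code (drop i s).
Proof.
elim: i => [|i IH]; first by rewrite drop0.
rewrite /cdrop /= -/(cdrop _ _) IH -add1n -drop_drop.
case: (drop i s) => [|x t]; first by rewrite /= /ctail div0n.
by rewrite /= drop0; exact: (ctail_ccons x (CodeSeq.code t)).
Qed.

Lemma cnthE c i : cnth c i = nth 0 (CodeSeq.decode c) i.
Proof.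
rewrite -{1}[c]CodeSeq.decodeK /cnth cdrop_code; set s := CodeSeq.decode c.
rewrite -[i in RHS]addn0 -nth_drop; case: (drop i s) => [|x t] /=.
  by rewrite /chead big_geq.
exact: chead_ccons.
Qed.

Lemma size_decode c : size (CodeSeq.decode c) <= c.
Proof.
rewrite -{2}[c]CodeSeq.decodeK; elim: (CodeSeq.decode c) => //= x t IH.
apply: (@leq_trans (CodeSeq.code t).*2.+1); last by rewrite leq_pmull// expn_gt0.
by rewrite ltnS (leq_trans IH)// -addnn leq_addr.
Qed.

Lemma csizeE c : csize c = size (CodeSeq.decode c).
Proof.
rewrite -[RHS](sum_nat_ltn (size_decode c)) /csize; apply: eq_bigr => i _.
rewrite -{1}[c]CodeSeq.decodeK cdrop_code; congr nat_of_bool.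
rewrite -[RHS]subn_gt0 -size_drop; case: (drop _ _) => //= x t.
by rewrite muln_gt0 expn_gt0.
Qed.

Section CodeRecursive.
Variable o : nat -> nat.

Lemma rec1_chead : rec1 o chead. Proof. by rewrite /rec1 /chead; rec. Qed.
Lemma rec1_ctail : rec1 o ctail.
Proof. have := rec1_chead => h; rewrite /rec1 /ctail; rec. Qed.
Lemma rec2_cdrop : rec2 o cdrop.
Proof.
have := rec1_ctail => h; rewrite /rec2 /cdrop.
by apply: recursive_iteri; rec.
Qed.
Lemma rec2_cnth : rec2 o cnth.
Proof. have := rec1_chead => h1; have := rec2_cdrop => h; rewrite /rec2 /cnth; rec. Qed.
Lemma rec1_csize : rec1 o csize.
Proof. have := rec2_cdrop => h; rewrite /rec1 /csize; rec. Qed.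
Lemma rec2_ccons : rec2 o ccons.
Proof.
apply: (@recursive_ext _ _ _ (fun x : unit * nat * nat => 2 ^ x.2 * (x.1.2 * 2).+1)).
  by move=> x; rewrite muln2.
rec.
Qed.

End CodeRecursive.

Lemma code3 a b c : ccons a (ccons b (ccons c 0)) = CodeSeq.code [:: a; b; c].
Proof. by []. Qed.

(** * Integer arithmetic for coded rational combinations *)

(** Here [j] is the index of a coefficient, [t] selects its real (0) or imaginary (1) part, and [u]
    the positive (0) or negative (1) term of a numerator [a - b]. All fractions are brought to the
    common denominator [cden c]; [cnormsq c w] is then [cden c ^ 2] times the squared modulus of the
    sum of the coefficients selected by [w]. Subtraction is truncated, so [(a - b) + (b - a)] is the
    absolute difference. *)
Definition qcode c j t := cnth (cnth c j) t.
Definition qden c j t := (cnth (qcode c j t) 2).+1.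
Definition cden c := \prod_(0 <= j < csize c) \prod_(0 <= t < 2) qden c j t.
Definition cnum c (w : nat -> bool) t u :=
  \sum_(0 <= j < csize c) w j * (cnth (qcode c j t) u * (cden c %/ qden c j t)).
Definition cnormsq c (w : nat -> bool) :=
  \sum_(0 <= t < 2)
    ((cnum c w t 0 - cnum c w t 1) + (cnum c w t 1 - cnum c w t 0)) ^ 2.

Section CodeNorm.
Variable o : nat -> nat.

Lemma rec3_qcode : rec3 o qcode.
Proof. have h := rec2_cnth o; rewrite /rec3 /qcode; rec. Qed.
Lemma rec3_qden : rec3 o qden.
Proof.
have h := rec2_cnth o; have h' := rec3_qcode; rewrite /rec3 /qden; rec.
Qed.
Lemma rec1_cden : rec1 o cden.
Proof.
have h := rec1_csize o; have h' := rec3_qden; rewrite /rec1 /cden; rec.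
Qed.

Lemma recursive_cnum E {eE : env E} (c : E -> nat) (w : E -> nat -> bool) (t u : E -> nat) :
  recursive o c -> recursive o t -> recursive o u ->
  recursive o (fun x : E * nat => w x.1 x.2) ->
  recursive o (fun x => cnum (c x) (w x) (t x) (u x)).
Proof.
move=> hc ht hu hw; have h := rec1_csize o; have h' := rec3_qden.
have h1 := rec1_cden; have h2 := rec2_cnth o; have h3 := rec3_qcode.
have hc' := recursive_weaken hc; have ht' := recursive_weaken ht.
have hu' := recursive_weaken hu.
by rewrite /cnum; rec.
Qed.

Lemma recursive_cnormsq E {eE : env E} (c : E -> nat) (w : E -> nat -> bool) :
  recursive o c -> recursive o (fun x : E * nat => w x.1 x.2) ->
  recursive o (fun x => cnormsq (c x) (w x)).
Proof.
move=> hc hw.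
have hn u : recursive o (fun x : E * nat => cnum (c x.1) (w x.1) x.2 u).
  apply: recursive_cnum.
  - exact: recursive_weaken.
  - exact: recursive_var0.
  - exact: recursive_const.
  move: hw; move/(recursive_subst (h := fun x : E * nat * nat => (x.1.1, x.2))); apply.
  case=> [_|i _]; first exact: recursive_var0.
  exact: (recursive_var _ i.+2).
have h0 := hn 0; have h1 := hn 1.
by rewrite /cnormsq; rec.
Qed.

End CodeNorm.

Local Open Scope ring_scope.

(** * Computable families of reals *)

Section ComputableFamily.
Variable R : realType.
Implicit Types (y : R).

(** A share [w / (u + v)] lies in [0, 1] and is therefore at most its own r-th power; the shares of
    [u] and [v] add up to 1. *)
Lemma powR_subadd (u v r : R) : 0 <= u -> 0 <= v -> 0 <= r -> r <= 1 ->
  (u + v) `^ r <= u `^ r + v `^ r.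
Proof.
move=> u0 v0 r0 r1.
have [->|s0] := eqVneq (u + v) 0.
  have [->|r1'] := eqVneq r 0; first by rewrite !powRr0 lerDl ler01.
  by rewrite powR0// addr_ge0 ?powR_ge0.
have sp : 0 < u + v by rewrite lt_def s0 addr_ge0.
have key w : 0 <= w -> w <= u + v -> w / (u + v) * (u + v) `^ r <= w `^ r.
  rewrite le_eqVlt => /orP[/eqP <- _|w0 wuv]; first by rewrite !mul0r powR_ge0.
  rewrite -[in leRHS](@divfK _ (u + v) s0 w) powRM ?divr_ge0 ?(ltW w0) ?(ltW sp)//.
  rewrite ler_wpM2r ?powR_ge0//.
  rewrite -[leLHS]powRr1 ?divr_ge0 ?(ltW w0) ?(ltW sp)//.
  by rewrite ger_powR// divr_gt0//= ler_pdivrMr// mul1r.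
rewrite -[leLHS]mul1r -[X in X * _](divff s0) mulrDl mulrDl.
by apply: lerD; apply: key => //; rewrite ?lerDl ?lerDr.
Qed.

Lemma expr2V_mul (k : nat) : 2 ^+ k * 2^-1 ^+ k = 1 :> R.
Proof. by rewrite -exprMn divff ?expr1n. Qed.

Lemma exists_expr2V_lt (d : R) : 0 < d -> exists m, 2^-1 ^+ m < d.
Proof.
move=> d0; exists (Num.truncn d^-1).+1.
rewrite exprVn -ltf_pV2 ?posrE ?invr_gt0 ?exprn_gt0// invrK.
by rewrite (lt_trans (truncnS_gt _))// -natrX ltr_nat ltn_expl.
Qed.

(** The quotient is the integer nearest to [N * 2 ^ k / D]. Rounding uses up one half of the error
    allowance, the given approximation the other half. *)
Lemma round_ratio (N D k : nat) y : (0 < D)%N -> `|N%:R / D%:R - y| < 2^-1 ^+ k.+1 ->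
  `|((2 * N * 2 ^ k + D) %/ (2 * D))%:R / 2 ^+ k - y| < 2^-1 ^+ k.
Proof.
move=> D0; rewrite exprS -exprVn; have e1 := expr2V_mul k.
set e : R := 2^-1 ^+ k in e1 *; set q := (_ %/ _)%N; set t := _ / _ => ty.
have e0 : 0 < e by rewrite exprn_gt0.
have D0' : 0 < D%:R :> R by rewrite ltr0n.
have tD : t * D%:R = N%:R by rewrite divfK ?gt_eqF.
have h1 : (q * (2 * D) <= 2 * N * 2 ^ k + D)%N by exact: leq_trunc_div.
have h2 : (2 * N * 2 ^ k + D < q.+1 * (2 * D))%N by rewrite ltn_ceil// muln_gt0.
move: h1 h2; rewrite -(ler_nat R) -(ltr_nat R) !(natrD, natrM, natrX) -natr1 -tD.
set E : R := 2 ^+ k in e1 *; move=> h1 h2.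
have {}h1 : q%:R <= t * E + 1 / 2.
  rewrite -(ler_pM2r D0'); lra.
have {}h2 : t * E < q%:R + 1 / 2.
  rewrite -(ltr_pM2r D0'); lra.
have {}h1 : q%:R * e <= (t * E + 1 / 2) * e by rewrite ler_pM2r.
have {}h2 : t * E * e < (q%:R + 1 / 2) * e by rewrite ltr_pM2r.
have e2 : t * E * e = t by rewrite -mulrA e1 mulr1.
move: ty; rewrite !ltr_distl => /andP[t1 t2].
by apply/andP; split; lra.
Qed.

(** Dyadic approximations with natural numerators, which confines the notion to nonnegative reals;
    only norms, their powers and exponents have to be approximated. *)
Definition computable_family E {eE : env E} (F : E -> R) :=
  exists2 f : E -> nat -> nat, recursive no_oracle (fun x : E * nat => f x.1 x.2) &
    forall x k, `|(f x k)%:R / 2 ^+ k - F x| < 2^-1 ^+ k.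

Lemma computable_family_ext E {eE : env E} (F G : E -> R) :
  (forall x, F x = G x) -> computable_family F -> computable_family G.
Proof. by move=> FG [f hf h]; exists f => // x k; rewrite -FG. Qed.

Lemma computable_family_ratio E {eE : env E} (F : E -> R) (N D : E -> nat -> nat) :
  recursive no_oracle (fun x : E * nat => N x.1 x.2) ->
  recursive no_oracle (fun x : E * nat => D x.1 x.2) ->
  (forall x k, (0 < D x k)%N) ->
  (forall x k, `|(N x k)%:R / (D x k)%:R - F x| < 2^-1 ^+ k) ->
  computable_family F.
Proof.
move=> hN hD D0 h.
exists (fun x k => ((2 * N x k.+1 * 2 ^ k + D x k.+1) %/ (2 * D x k.+1))%N).
  have hs (g : E -> nat -> nat) : recursive no_oracle (fun x : E * nat => g x.1 x.2) ->
      recursive no_oracle (fun x : E * nat => g x.1 x.2.+1).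
    move/(recursive_subst (h := fun x : E * nat => (x.1, x.2.+1))); apply.
    move=> [_|i _] /=; first by apply: recursive_succ; exact: recursive_var0.
    exact: (recursive_var _ i.+1).
  have hN' := hs _ hN; have hD' := hs _ hD; rec.
by move=> x k; apply: round_ratio.
Qed.

Lemma computable_family_sum E {eE : env E} (n : E -> nat) (F : E -> nat -> R) :
  recursive no_oracle n -> computable_family (fun x : E * nat => F x.1 x.2) ->
  computable_family (fun x => \sum_(0 <= i < n x) F x i).
Proof.
move=> hn [f hf Ff].
(* Accuracy index [k + n x] suffices: [n x] errors of size 2^-(k + n x) add up to less than 2^-k, as
   [n x < 2 ^ n x]. *)
apply: (@computable_family_ratio _ _ _
  (fun x k => \sum_(0 <= i < n x) f (x, i) (k + n x))%N (fun x k => 2 ^ (k + n x))%N).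
- have hn' := recursive_weaken hn.
  apply: recursive_sum => //.
  move: hf; move/(recursive_subst (h := fun x : E * nat * nat =>
    ((x.1.1, x.2), x.1.2 + n x.1.1)%N)); apply.
  case=> [_|] /=.
    apply: recursive_add; first exact: recursive_var1.
    exact: (recursive_weaken hn').
  case=> [_|i _]; first exact: recursive_var0.
  exact: (recursive_var _ i.+2).
- have hn' := recursive_weaken hn; rec.
- by move=> x k; rewrite expn_gt0.
move=> x k; set m := n x.
rewrite natr_sum mulr_suml -sumrB.
apply: (le_lt_trans (ler_norm_sum _ _ _)).
apply: (@le_lt_trans _ _ (\sum_(0 <= i < m) 2^-1 ^+ (k + m))).
  by apply: ler_sum => i _; rewrite natrX; exact/ltW/(Ff (x, i)).
rewrite sumr_const_nat subn0 exprD -mulrnAr -[ltRHS]mulr1 ltr_pM2l ?exprn_gt0//.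
rewrite exprVn -mulr_natl -ltr_pdivlMr ?invr_gt0 ?exprn_gt0// invrK mul1r.
by rewrite -natrX ltr_nat ltn_expl.
Qed.

Lemma computable_family_add E {eE : env E} (F G : E -> R) :
  computable_family F -> computable_family G -> computable_family (fun x => F x + G x).
Proof.
move=> hF hG.
apply: (@computable_family_ext _ _ (fun x => \sum_(0 <= i < 2) (if i is 0%N then F x else G x))).
  by move=> x; rewrite big_nat_recl// big_nat1.
apply: computable_family_sum; first exact: recursive_const.
case: hF hG => [f hf Ff] [g hg Gg].
exists (fun x k => if x.2 == 0%N then f x.1 k else g x.1 k).
  apply: recursive_if.
  - by apply: recursive_eq; [exact: recursive_var1|exact: recursive_const].
  - move: hf; move/(recursive_subst (h := fun x : E * nat * nat => (x.1.1, x.2))); apply.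
    case=> [_|i _]; first exact: recursive_var0.
    exact: (recursive_var _ i.+2).
  - move: hg; move/(recursive_subst (h := fun x : E * nat * nat => (x.1.1, x.2))); apply.
    case=> [_|i _]; first exact: recursive_var0.
    exact: (recursive_var _ i.+2).
by move=> [x [|i]] k /=.
Qed.

Lemma computable_family_div E {eE : env E} (F : E -> R) (D : E -> nat) :
  computable_family F -> recursive no_oracle D -> (forall x, (0 < D x)%N) ->
  computable_family (fun x => F x / (D x)%:R).
Proof.
move=> [f hf Ff] hD D0.
apply: (@computable_family_ratio _ _ _ (fun x k => f x k) (fun x k => 2 ^ k * D x)%N) => //.
- have hn' := recursive_weaken hD; rec.
- by move=> x k; rewrite muln_gt0 expn_gt0 D0.
move=> x k; rewrite natrM natrX invfM mulrA -mulrBl normrM.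
apply: (@le_lt_trans _ _ `|(f x k)%:R / 2 ^+ k - F x|); last exact: Ff.
by rewrite ler_piMr// ger0_norm ?invr_ge0// invf_le1 ?ler1n ?ltr0n.
Qed.

End ComputableFamily.

(** * Real powers of computable reals *)

Section PowerFamily.
Variable R : realType.
Implicit Types (X y : R).

Lemma powR_ratioX X (A B : nat) : 0 <= X -> (0 < B)%N ->
  X `^ (A%:R / B%:R) ^+ B = X ^+ A.
Proof.
move=> X0 B0; rewrite -powR_mulrn ?powR_ge0// -powRrM divfK ?powR_mulrn//.
by rewrite pnatr_eq0 -lt0n.
Qed.

Lemma lt_powR_ratio u X (A B : nat) : 0 <= u -> 0 <= X -> (0 < B)%N ->
  (u < X `^ (A%:R / B%:R)) = (u ^+ B < X ^+ A).
Proof.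
move=> u0 X0 B0; rewrite -(powR_ratioX A X0 B0) ltr_pXn2r// ?nnegrE ?powR_ge0//.
Qed.

Lemma powR_ratio_lt u X (A B : nat) : 0 <= u -> 0 <= X -> (0 < B)%N ->
  (X `^ (A%:R / B%:R) < u) = (X ^+ A < u ^+ B).
Proof.
move=> u0 X0 B0; rewrite -(powR_ratioX A X0 B0) ltr_pXn2r// ?nnegrE ?powR_ge0//.
Qed.

(** A power is monotone in its exponent, decreasing for bases up to 1 and increasing above; bounds
    at both ends of an exponent interval hold inside it without knowing which case occurs. *)
Lemma powR_exponent_between X lo y hi (l u : R) : 0 <= X -> 0 < y -> lo < y -> y < hi ->
  l < X `^ lo -> l < X `^ hi -> X `^ lo < u -> X `^ hi < u -> l < X `^ y < u.
Proof.
move=> X0 y0 ly yh l1 l2 u1 u2; move: X0; rewrite le_eqVlt => /orP[/eqP X0|X0].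
  have h0 : hi != 0 by rewrite gt_eqF// (lt_trans y0).
  by move: l2 u2; rewrite -X0 !powR0 ?(gt_eqF y0)// => -> ->.
have [X1|X1] := leP X 1.
  have h : {homo powR X : x y /~ y <= x} by apply: ger_powR; rewrite X0.
  by rewrite (lt_le_trans l2) ?(le_lt_trans _ u1)// h// ltW.
have h : {homo powR X : x y / x <= y} by apply: ler_powR; rewrite ltW.
by rewrite (lt_le_trans l1) ?(le_lt_trans _ u2)// h// ltW.
Qed.

Lemma powR_continuous_exponent X y (eta : R) : 0 <= X -> 0 < y -> 0 < eta ->
  exists2 d, 0 < d & forall e, `|e - y| < d -> `|X `^ e - X `^ y| < eta.
Proof.
rewrite le_eqVlt => /orP[/eqP <-|X0] y0 eta0.
  exists y => // e; rewrite ltr_distl subrr => /andP[e0 _].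
  by rewrite !powR0 ?gt_eqF// subrr normr0.
have := @continuous_expR R (y * ln X).
move/cvgrPdist_lt => /(_ _ eta0) /nbhs_ballP[r /= r0 h].
exists (r / (`|ln X| + 1)); first by rewrite divr_gt0// ltr_wpDl.
move=> e; rewrite ltr_pdivlMr ?ltr_wpDl// => he.
rewrite /powR (gt_eqF X0) distrC; apply: h => /=; rewrite /ball /=.
rewrite -mulrBl normrM distrC; apply: le_lt_trans he.
by rewrite ler_wpM2l// lerDl.
Qed.

(** The code [n] proposes a precision [m] for the exponent and a numerator [z]. The test asks that
    [(z - 1) / 2 ^ k] and [(z + 1) / 2 ^ k] enclose the powers of [N / D] with the exponents next to
    [a m / 2 ^ m] on either side. Raising to the power [B = 2 ^ m] turns this into comparisons of
    integers. For [z = 0] the added 1 makes the lower bound automatic, as it should be for a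
    negative number. *)
Definition pow_check (N D : nat) (a : nat -> nat) (k n : nat) : bool :=
  let B := (2 ^ cnth n 0)%N in let K := (2 ^ k)%N in let z := cnth n 1 in
  let test A := ((z.-1 ^ B * D ^ A < K ^ B * N ^ A + (z == 0))
     && (K ^ B * N ^ A < z.+1 ^ B * D ^ A))%N in
  test (a (cnth n 0)).-1 && test (a (cnth n 0)).+1.

Lemma pow_testP (N D A B k z : nat) : (0 < D)%N -> (0 < B)%N ->
  ((z.-1 ^ B * D ^ A < (2 ^ k) ^ B * N ^ A + (z == 0))
     && ((2 ^ k) ^ B * N ^ A < z.+1 ^ B * D ^ A))%N =
  ((z%:R - 1) / 2 ^+ k < (N%:R / D%:R : R) `^ (A%:R / B%:R) < (z%:R + 1) / 2 ^+ k).
Proof.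
move=> D0 B0; have D0' : 0 < D%:R :> R by rewrite ltr0n.
have K0 : 0 < 2 ^+ k :> R by rewrite exprn_gt0.
have X0 : 0 <= N%:R / D%:R :> R by rewrite divr_ge0.
congr andb.
  case: z => [|z] /=.
    rewrite exp0n// mul0n addn1 ltn0Sn; apply/esym.
    by rewrite (lt_le_trans _ (powR_ge0 _ _))// sub0r mulNr oppr_lt0 divr_gt0.
  rewrite addn0 -natr1 addrK lt_powR_ratio ?divr_ge0 ?(ltW K0)//.
  rewrite !expr_div_n ltr_pdivrMr ?exprn_gt0// mulrAC ltr_pdivlMr ?exprn_gt0//.
  by rewrite -!natrX -!natrM ltr_nat [in RHS]mulnC [in RHS](mulnC (N ^ A)%N) mulnC.
rewrite natr1 powR_ratio_lt ?divr_ge0 ?(ltW K0)//.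
rewrite !expr_div_n ltr_pdivrMr ?exprn_gt0// mulrAC ltr_pdivlMr ?exprn_gt0//.
by rewrite -!natrX -!natrM ltr_nat (mulnC (N ^ A)%N).
Qed.

(** The value is found by unbounded search for a code passing [pow_check]. Monotonicity in the
    exponent makes any such code correct; continuity in the exponent makes one exist, since the
    truncation of the scaled power satisfies both bounds strictly. *)
Lemma computable_family_powR E {eE : env E} (N D : E -> nat) y :
  0 < y -> computable_family (fun _ : unit => y) ->
  recursive no_oracle N -> recursive no_oracle D -> (forall x, (0 < D x)%N) ->
  computable_family (fun x => ((N x)%:R / (D x)%:R) `^ y).
Proof.
move=> y0 [a' ha ay] hN hD D0; pose a := a' tt.
have {}ha : rec1 no_oracle a.
  by apply: recursive_ext ha => -[[] k].
have {}ay k : `|(a k)%:R / 2 ^+ k - y| < 2^-1 ^+ k by exact: ay.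
pose F x k n : nat := ~~ pow_check (N x) (D x) a k n.
have B0 n : (0 < 2 ^ n)%N by rewrite expn_gt0.
have ee k : (2 ^ k)%N%:R^-1 = 2^-1 ^+ k :> R by rewrite natrX exprVn.
have ae k : y - 2^-1 ^+ k < (a k)%:R * 2^-1 ^+ k < y + 2^-1 ^+ k.
  by rewrite -ltr_distl -[X in _ * X - _]ee natrX.
(* If [a k = 0], the lower exponent is 0, which is still below [y] because [y] is positive. *)
have lohi k : (a k).-1%:R / (2 ^ k)%N%:R < y /\ y < (a k).+1%:R / (2 ^ k)%N%:R.
  rewrite ee; have /andP[h1 h2] := ae k.
  split; last by rewrite -[(a k).+1%:R]natr1 mulrDl mul1r; lra.
  case: (a k) h2 => [|m] /=; first by rewrite mul0r.
  by rewrite -[m.+1%:R]natr1 mulrDl mul1r; lra.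
have [g hg Fg] : exists2 g : E * nat -> nat, recursive no_oracle g &
    forall x, F x.1 x.2 (g x) = 0%N.
  apply: (@recursive_min _ _ _ (fun x n => F x.1 x.2 n)).
    have hc := rec2_cnth no_oracle.
    have hN2 := recursive_weaken (recursive_weaken hN).
    have hD2 := recursive_weaken (recursive_weaken hD).
    by rewrite /F /pow_check; rec.
  move=> [x k]; rewrite /F /=.
  set X : R := (N x)%:R / (D x)%:R.
  have X0 : 0 <= X by rewrite divr_ge0.
  have K0 : 0 < 2 ^+ k :> R by rewrite exprn_gt0.
  set t := X `^ y * 2 ^+ k.
  have t0 : 0 <= t by rewrite mulr_ge0 ?powR_ge0// ltW.
  set z := Num.trunc t.
  have /andP[zt tz] : z%:R <= t < z.+1%:R by exact: truncn_itv.
  have l1 : (z%:R - 1) / 2 ^+ k < X `^ y by rewrite ltr_pdivrMr// -/t; lra.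
  have u1 : X `^ y < (z%:R + 1) / 2 ^+ k by rewrite ltr_pdivlMr// -/t; lra.
  pose eta := Num.min (X `^ y - (z%:R - 1) / 2 ^+ k) ((z%:R + 1) / 2 ^+ k - X `^ y).
  have eta0 : 0 < eta by rewrite lt_min !subr_gt0 l1.
  have [d d0 hd] := powR_continuous_exponent X0 y0 eta0.
  (* Both tested exponents lie within two units 2^-m of [y], hence the bound [d / 2]. *)
  have [m hm] := exists_expr2V_lt (divr_gt0 d0 (ltr0n R 2)).
  exists (CodeSeq.code [:: m; z]); rewrite /pow_check !cnthE CodeSeq.codeK /=.
  apply/eqP; rewrite eqb0 negbK !pow_testP// -/X.
  have hX e : `|e - y| < d -> (z%:R - 1) / 2 ^+ k < X `^ e < (z%:R + 1) / 2 ^+ k.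
    move=> /hd; rewrite lt_min ltr_distl !ltr_distl => /andP[/andP[h1 _] /andP[_ h2]].
    by apply/andP; split; lra.
  rewrite !ee; have /andP[h1 h2] := ae m.
  rewrite !hX//.
    rewrite ltr_distl -[(a m).+1%:R]natr1 mulrDl mul1r; apply/andP; split; lra.
  case: (a m) h1 h2 => [|am] /= h1 h2.
    by rewrite mul0r; rewrite mul0r in h1 h2; rewrite ltr_distl; apply/andP; split; lra.
  move: h1 h2; rewrite -[am.+1%:R]natr1 mulrDl mul1r => h1 h2.
  rewrite ltr_distl; apply/andP; split; lra.
exists (fun x k => cnth (g (x, k)) 1).
  have hc := rec2_cnth no_oracle.
  apply: (@recursive_ext _ _ _ (fun x => cnth (g x) 1)); first by case.
  rec.
move=> x k; have := Fg (x, k); rewrite /F /pow_check /=.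
move/eqP; rewrite eqb0 negbK !pow_testP//.
set z := cnth _ 1; set m := cnth _ 0 => /andP[/andP[h1 h2] /andP[h3 h4]].
have X0 : 0 <= (N x)%:R / (D x)%:R :> R by rewrite divr_ge0.
have [lo hi] := lohi m.
have /andP[h5 h6] := powR_exponent_between X0 y0 lo hi h1 h3 h2 h4.
rewrite distrC ltr_distl; move: h5 h6.
by rewrite mulrBl mulrDl mul1r exprVn => -> ->.
Qed.

(** By subadditivity, [|X^y - F^y| <= |X - F|^y]. With [M >= 1 / y], an error 2^-(M (k + 1)) in the
    base becomes at most 2^-(k + 1) in the power; the other half of the allowance pays for the power
    of the rational approximation. *)
Lemma computable_family_powR1 E {eE : env E} (F : E -> R) y :
  0 < y -> y <= 1 -> computable_family (fun _ : unit => y) ->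
  (forall x, 0 <= F x) -> computable_family F -> computable_family (fun x => F x `^ y).
Proof.
move=> y0 y1 hy F0 [f hf Ff].
pose M := (Num.trunc y^-1).+1.
have My : 1 <= M%:R * y.
  rewrite -ler_pdivrMr// mul1r ltW//.
  exact: truncnS_gt.
pose j k := (M * k.+1)%N.
have [g hg Gg] : computable_family (fun x : E * nat =>
    ((f x.1 (j x.2))%:R / (2 ^ (j x.2))%N%:R) `^ y).
  apply: computable_family_powR => //.
  - move: hf; move/(recursive_subst (h := fun x : E * nat => (x.1, j x.2))); apply.
    case=> [_|i _] /=; first by rewrite /j; rec.
    exact: (recursive_var _ i.+1).
  - by rewrite /j; rec.
  - by move=> x; rewrite expn_gt0.
apply: (@computable_family_ratio _ _ _ _ (fun x k => g (x, k) k.+1) (fun x k => 2 ^ k.+1)%N).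
- move: hg; move/(recursive_subst (h := fun x : E * nat => ((x.1, x.2), x.2.+1))); apply.
  case=> [_|[_|i _]] /=; [by rec|by rec|].
  exact: (recursive_var _ i.+1).
- by rec.
- by move=> x k; rewrite expn_gt0.
move=> x k; have := Gg (x, k) k.+1; rewrite /= !natrX.
set X := _ / 2 ^+ j k; set u := _ / _ => h1.
have X0 : 0 <= X by rewrite divr_ge0// exprn_ge0.
have XF : `|X - F x| < 2^-1 ^+ j k by exact: Ff.
have hs (v w : R) : 0 <= v -> v <= w -> w `^ y - v `^ y <= (w - v) `^ y.
  move=> v0 vw; rewrite lerBlDr -{1}[w](subrK v).
  by rewrite powR_subadd ?subr_ge0// ltW.
have h2 : `|X `^ y - F x `^ y| <= `|X - F x| `^ y.
  have [h|/ltW h] := leP X (F x).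
    rewrite distrC ger0_norm ?subr_ge0 ?ge0_ler_powR ?nnegrE// ?(ltW y0)//.
    by rewrite distrC ger0_norm ?subr_ge0// hs.
  rewrite ger0_norm ?subr_ge0 ?ge0_ler_powR ?nnegrE// ?(ltW y0)//.
  by rewrite ger0_norm ?subr_ge0// hs.
have h3 : `|X - F x| `^ y <= 2^-1 ^+ k.+1.
  apply: (@le_trans _ _ ((2^-1 ^+ j k) `^ y)).
    by rewrite ge0_ler_powR ?nnegrE ?(ltW y0)// ?exprn_ge0// ltW.
  rewrite -!powR_mulrn// -powRrM ger_powR ?invr_gt0 ?ltr0n ?invf_le1 ?ler1n//=.
  by rewrite /j natrM mulrAC -[leLHS]mul1r ler_wpM2r.
rewrite -[u](subrK (X `^ y)) -addrA.
apply: (le_lt_trans (ler_normD _ _)).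
have e2 : 2^-1 ^+ k = 2^-1 ^+ k.+1 + 2^-1 ^+ k.+1 :> R.
  by rewrite exprS; lra.
rewrite e2; apply: ltr_leD => //; exact: le_trans h3.
Qed.

Lemma computable_real_family (y : R) : 0 <= y -> computable_real y ->
  computable_family (fun _ : unit => y).
Proof.
move=> y0 [e he].
have /choice[q hq] : forall k, exists q, oeval no_oracle e [:: k] q /\
    `|ratr (rat_of_code q) - y| < 2^-1 ^+ k.
  by move=> k; have [q] := he k; exists q.
have hq1 : rec1 no_oracle q by exists e => -[[] k]; have [] := hq k.
have hc := rec2_cnth no_oracle.
(* Truncated subtraction replaces a negative approximation by 0, which is closer to [y >= 0]. *)
apply: (@computable_family_ratio _ _ _ _
  (fun _ k => cnth (q k) 0 - cnth (q k) 1)%N (fun _ k => (cnth (q k) 2).+1)) => //.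
- by rec.
- by rec.
move=> _ k; have [_] := hq k; rewrite /rat_of_code -!cnthE.
set A := cnth _ 0; set B := cnth _ 1; set C := cnth _ 2.
rewrite rmorphM/= fmorphV/= rmorphB/= !ratr_nat.
have [AB|BA] := leqP B A; first by rewrite natrB.
apply: le_lt_trans.
have -> : (A - B)%N = 0%N by apply/eqP; rewrite subn_eq0 ltnW.
rewrite mul0r sub0r normrN ger0_norm// distrC (le_trans _ (ler_norm _))//.
by rewrite lerDl oppr_ge0 mulr_le0_ge0 ?subr_le0 ?ler_nat ?(ltnW BA)// invr_ge0.
Qed.

(** Two extra bits are enough: as [y >= 1], the approximation is at least 1/2, so the product
    [z * y] exceeds 1/4 and inversion magnifies the error by less than 4. *)
Lemma computable_family_inv (y : R) : 1 <= y ->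
  computable_family (fun _ : unit => y) -> computable_family (fun _ : unit => y^-1).
Proof.
move=> y1 [f hf fy].
have f0 k : (0 < f tt k.+2)%N.
  rewrite lt0n; apply/eqP => f0; have := fy tt k.+2; rewrite f0 mul0r sub0r normrN.
  rewrite ger0_norm ?(le_trans _ y1)// => /(le_lt_trans y1); rewrite ltNge.
  by rewrite exprn_ile1// invf_le1 ?ler1n ?ltr0n.
apply: (@computable_family_ratio _ _ _ _ (fun _ k => 2 ^ k.+2)%N (fun x k => f x k.+2)).
- by rec.
- move: hf; move/(recursive_subst (h := fun x : unit * nat => (x.1, x.2.+2))); apply.
  by case=> [_|i _] /=; [rec|exact: (recursive_var _ i.+1)].
- by case.
move=> [] k; have := fy tt k.+2; set a := f _ _.
have a0 : 0 < a%:R :> R by rewrite ltr0n f0.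
rewrite natrX; set z := _ / _ => hz.
have -> : 2 ^+ k.+2 / a%:R = z^-1 by rewrite /z invfM invrK mulrC.
have z0 : 0 < z by rewrite divr_gt0// exprn_gt0.
have y0 : 0 < y by exact: lt_le_trans y1.
have e4 : 2^-1 ^+ k = 4 * 2^-1 ^+ k.+2 :> R.
  by rewrite !exprS; lra.
have zy : 1 / 2 <= z.
  move: hz; rewrite ltr_distl => /andP[h _].
  have : 2^-1 ^+ k.+2 <= 2^-1 :> R.
    by rewrite exprS ler_piMr ?invr_ge0// exprn_ile1// invf_le1 ?ler1n ?ltr0n.
  lra.
have -> : z^-1 - y^-1 = (y - z) / (z * y).
  by field; rewrite !gt_eqF.
rewrite normrM distrC e4 [ltRHS]mulrC; apply: ltr_pM => //.
rewrite ger0_norm ?invr_ge0 ?mulr_ge0 ?(ltW z0) ?(ltW y0)//.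
rewrite invf_plt ?posrE ?mulr_gt0//.
apply: (@lt_le_trans _ _ (1 / 2)); first lra.
by rewrite (le_trans zy)// ler_peMr// ltW.
Qed.

End PowerFamily.

(** * Rational combinations with complex coefficients *)

Section CodeNormReal.
Variable R : realType.

Lemma ratr_rat_of_code q :
  ratr (rat_of_code q) = ((cnth q 0)%:R - (cnth q 1)%:R) / (cnth q 2).+1%:R :> R.
Proof.
by rewrite /rat_of_code -!cnthE rmorphM/= fmorphV/= rmorphB/= !ratr_nat.
Qed.

(** The value of a combination at a place where precisely the generators selected by [w] are
    present. *)
Definition csum c (w : nat -> bool) : R[i] :=
  \sum_(0 <= j < csize c | w j) crat_of_code R (cnth c j).

Lemma Re_sum I (r : seq I) (P : pred I) (F : I -> R[i]) :
  complex.Re (\sum_(i <- r | P i) F i) = \sum_(i <- r | P i) complex.Re (F i).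
Proof. exact: raddf_sum. Qed.

Lemma Im_sum I (r : seq I) (P : pred I) (F : I -> R[i]) :
  complex.Im (\sum_(i <- r | P i) F i) = \sum_(i <- r | P i) complex.Im (F i).
Proof. exact: raddf_sum. Qed.

Lemma cden_gt0 c : (0 < cden c)%N.
Proof. by rewrite /cden; apply: prodn_gt0 => j; apply: prodn_gt0. Qed.

Lemma qden_dvd c j t : (j < csize c)%N -> (t < 2)%N -> (qden c j t %| cden c)%N.
Proof.
move=> jc t2; rewrite /cden big_mkord (bigD1 (Ordinal jc))//=.
by rewrite dvdn_mulr// big_mkord (bigD1 (Ordinal t2))//= dvdn_mulr.
Qed.

Lemma csum_part c (w : nat -> bool) t : (t < 2)%N ->
  \sum_(0 <= j < csize c | w j) ratr (rat_of_code (qcode c j t)) =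
  ((cnum c w t 0)%:R - (cnum c w t 1)%:R) / (cden c)%:R :> R.
Proof.
move=> t2; rewrite /cnum !natr_sum -sumrB mulr_suml big_mkcond.
rewrite !big_nat; apply: eq_bigr => j /andP[_ jc].
case: (w j); last by rewrite !mul0n subrr mul0r.
rewrite !mul1n !natrM -mulrBl ratr_rat_of_code -mulrA; congr (_ * _).
have D0 : (cden c)%:R != 0 :> R by rewrite pnatr_eq0 -lt0n cden_gt0.
apply: (mulIf D0); rewrite divfK// mulrC -[in LHS](divnK (qden_dvd jc t2)) natrM.
by rewrite mulfK// pnatr_eq0.
Qed.

Lemma natr_distn_sq (a b : nat) :
  (((a - b) + (b - a)) ^ 2)%N%:R = (a%:R - b%:R) ^+ 2 :> R.
Proof.
rewrite natrX; have [ab|/ltnW ba] := leqP a b.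
  have -> : (a - b)%N = 0%N by apply/eqP; rewrite subn_eq0.
  by rewrite add0n natrB// -sqrrN opprB.
have -> : (b - a)%N = 0%N by apply/eqP; rewrite subn_eq0.
by rewrite addn0 natrB.
Qed.

(** The squared modulus is rational, so halving the exponent avoids the square root. *)
Lemma normc_csum c w q :
  Normc.normc (csum c w) `^ q = ((cnormsq c w)%:R / (cden c ^ 2)%N%:R) `^ (q / 2).
Proof.
have D0 : 0 < (cden c)%:R :> R by rewrite ltr0n cden_gt0.
have -> (z : R[i]) : Normc.normc z `^ q =
    (complex.Re z ^+ 2 + complex.Im z ^+ 2) `^ (q / 2).
  case: z => a b /=; rewrite -powR12_sqrt ?addr_ge0 ?sqr_ge0//.
  by rewrite -powRrM mulrC.
congr (_ `^ _); rewrite /csum Re_sum Im_sum.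
have := csum_part c w (isT : 0 < 2)%N; have := csum_part c w (isT : 1 < 2)%N.
rewrite /qcode /crat_of_code /=; under eq_bigr do rewrite cnthE; move=> h1.
under eq_bigr do rewrite cnthE; move=> h0.
rewrite h0 h1 /cnormsq big_nat_recl// big_nat1 natrD !natr_distn_sq natrX.
by rewrite !expr_div_n mulrDl.
Qed.

Lemma computable_family_normc_csum E {eE : env E} (c : E -> nat) (w : E -> nat -> bool)
    (q : R) :
  0 < q -> computable_family (fun _ : unit => q) ->
  recursive no_oracle c -> recursive no_oracle (fun x : E * nat => w x.1 x.2) ->
  computable_family (fun x => Normc.normc (csum (c x) (w x)) `^ q).
Proof.
move=> q0 hq hc hw.
apply: (@computable_family_ext _ _ _ (fun x =>
  ((cnormsq (c x) (w x))%:R / (cden (c x) ^ 2)%N%:R) `^ (q / 2))).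
  by move=> x; rewrite normc_csum.
apply: computable_family_powR.
- by rewrite divr_gt0.
- apply: (computable_family_div hq) => //; exact: recursive_const.
- exact: recursive_cnormsq.
- have h := rec1_cden no_oracle; rec.
- by move=> x; rewrite expn_gt0 cden_gt0.
Qed.

End CodeNormReal.

Local Open Scope classical_set_scope.
Local Open Scope ring_scope.

(** * The p-th power of the norm *)

Section LpModular.
Variables (R : realType) (p : R) (p1 : 1 <= p).
Local Notation mu := (unit_measure R).

Lemma p_gt0 : 0 < p. Proof. exact: lt_le_trans p1. Qed.

Lemma normc_ge0 (z : R[i]) : 0 <= Normc.normc z.
Proof. by case: z => a b; exact: sqrtr_ge0. Qed.

Lemma LpCfun_Cmeasurable (f : LpCfun p1) : Cmeasurable f.
Proof. by have := LpCfunP f; rewrite inE => -[]. Qed.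

Lemma measurable_normc_powR (f : measurableTypeR R -> R[i]) : Cmeasurable f ->
  measurable_fun [set: measurableTypeR R] (fun x => Normc.normc (f x) `^ p).
Proof.
move=> mf; apply: (measurableT_comp (measurable_powR _)).
exact: measurable_normc.
Qed.

Lemma CLnorm_poweR (f : measurableTypeR R -> R[i]) :
  ((CLnorm p f) `^ p = \int[mu]_x (Normc.normc (f x) `^ p)%:E)%E.
Proof.
have pn0 : p != 0 by rewrite gt_eqF// p_gt0.
rewrite poweR_Lnorm//; apply: eq_integral => x _ /=.
by rewrite ger0_norm ?normc_ge0.
Qed.

Lemma integral_normc_lty (f : LpCfun p1) :
  (\int[mu]_x (Normc.normc (f x) `^ p)%:E < +oo)%E.
Proof.
rewrite -CLnorm_poweR; have := LpCfunP f; rewrite inE => -[_].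
by move=> h; apply: poweR_lty.
Qed.

(** The integral of [|f|^p]. It replaces the norm because it is additive over disjoint supports. *)
Definition Lp_modular (x : LpSpace p1) : R := Lp_norm x `^ p.

Lemma Lp_modular_class (f : LpCfun p1) :
  Lp_modular (Lp_class f) = fine (\int[mu]_x (Normc.normc (f x) `^ p)%:E)%E.
Proof.
rewrite /Lp_modular Lp_norm_class -CLnorm_poweR.
have : (CLnorm p f < +oo)%E by have := LpCfunP f; rewrite inE => -[].
have : (0 <= CLnorm p f)%E by exact: Lnorm_ge0.
by case: (CLnorm p f) => [r||].
Qed.

Lemma Lp_modular_ge0 x : 0 <= Lp_modular x.
Proof. exact: powR_ge0. Qed.

Lemma Lp_classD (f g : LpCfun p1) : Lp_class (f + g) = Lp_class f + Lp_class g.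
Proof. by rewrite -Lp_addE. Qed.

Lemma Lp_classZ (a : R[i]) (f : LpCfun p1) : Lp_class (a *: f) = a *: Lp_class f.
Proof. by rewrite -Lp_scaleE. Qed.

Lemma Lp_classB (f g : LpCfun p1) : Lp_class (f - g) = Lp_class f - Lp_class g.
Proof. by rewrite Lp_classD -Lp_oppE. Qed.

Lemma Lp_class_sum I (r : seq I) (P : pred I) (F : I -> LpCfun p1) :
  Lp_class (\sum_(i <- r | P i) F i) = \sum_(i <- r | P i) Lp_class (F i).
Proof.
by elim/big_rec2: _ => [|i y x _ <-] //; rewrite Lp_classD.
Qed.

Lemma LpCfunD (f g : LpCfun p1) x : (f + g) x = f x + g x. Proof. by []. Qed.
Lemma LpCfunB (f g : LpCfun p1) x : (f - g) x = f x - g x. Proof. by []. Qed.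
Lemma LpCfunZ a (f : LpCfun p1) x : (a *: f) x = a * f x. Proof. by []. Qed.
Lemma LpCfun0 x : (0 : LpCfun p1) x = 0. Proof. by []. Qed.
Lemma LpCfun_sum I (r : seq I) (P : pred I) (F : I -> LpCfun p1) x :
  (\sum_(i <- r | P i) F i) x = \sum_(i <- r | P i) F i x.
Proof. by elim/big_rec2: _ => [|i y z _ <-]. Qed.

(** The endpoint 1 is discarded so that half-open cells partition the domain exactly. *)
Lemma ae_half_open (P : measurableTypeR R -> Prop) :
  (forall y, 0 <= y < 1 -> P y) -> {ae mu, forall y, P y}.
Proof.
move=> h; exists (~` `[0, 1[%classic); split.
- by apply: measurableC; exact: measurable_itv.
- apply/eqP; rewrite eq_le measure_ge0 andbT /= /unit_measure /= /mrestr.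
  apply: (@le_trans _ _ (lebesgue_measure [set 1])); last by rewrite lebesgue_measure_set1.
  apply: le_measure; rewrite ?inE.
  + by apply: measurableI; [apply: measurableC|]; exact: measurable_itv.
  + exact: measurable_set1.
  + move=> y [/= h1 /=]; move: h1; rewrite !in_itv/= => h1 /andP[y0 y1].
    move: h1; rewrite y0/= => /negP; rewrite -leNgt => h1.
    by apply/eqP; rewrite eq_le y1.
- by move=> y /= h1; move=> /=; rewrite in_itv/= => /h.
Qed.

Lemma eq_Lp_class (f g : LpCfun p1) :
  (forall y, 0 <= y < 1 -> f y = g y) -> Lp_class f = Lp_class g.
Proof. by move=> h; apply/Lp_classP; exact: ae_half_open. Qed.

Lemma unit_measure_itv a b : 0 <= a -> a <= b -> b <= 1 ->
  mu `[a, b[%classic = (b - a)%:E.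
Proof.
move=> a0 ab b1; rewrite /unit_measure /= /mrestr setIidl; last first.
  move=> y /=; rewrite !in_itv/= => /andP[ay yb].
  by rewrite (le_trans a0)// (le_trans (ltW yb)).
rewrite lebesgue_measure_itv/= lte_fin.
case: ltP => // ba; have -> : a = b by apply/eqP; rewrite eq_le ab.
by rewrite subrr.
Qed.

(** Nodes may repeat, giving empty cells; this admits a uniform grid cut off at a point and
    rescaled. *)
Lemma Lp_modular_step (f : LpCfun p1) m (z : nat -> R) (c : nat -> R[i]) :
  z 0%N = 0 -> z m = 1 -> (forall i, z i <= z i.+1) ->
  (forall i y, (i < m)%N -> z i <= y < z i.+1 -> f y = c i) ->
  Lp_modular (Lp_class f) = \sum_(0 <= i < m) Normc.normc (c i) `^ p * (z i.+1 - z i).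
Proof.
move=> z0 z1 zS fc.
have zle i j : (i <= j)%N -> z i <= z j.
  move=> ij; rewrite -(subnKC ij); elim: (j - i)%N => [|k IH]; first by rewrite addn0.
  by rewrite addnS (le_trans IH).
rewrite Lp_modular_class.
pose A i : set (measurableTypeR R) := `[z i, z i.+1[%classic.
have mA i : measurable (A i) by exact: measurable_itv.
have stepE y : 0 <= y < 1 ->
    Normc.normc (f y) `^ p = \sum_(0 <= i < m) Normc.normc (c i) `^ p * \1_(A i) y.
  move=> /andP[y0 y1].
  have [i im /andP[ziy yzi]] : exists2 i, (i < m)%N & z i <= y < z i.+1.
    rewrite -z1 in y1; elim: (m) y1 => [|k IH] yk.
      by move: yk; rewrite z0 ltNge y0.
    have [yk'|ky] := ltP y (z k); last by exists k => //; rewrite ky.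
    by have [i ik h] := IH yk'; exists i => //; rewrite ltnS ltnW.
  rewrite big_mkord (bigD1 (Ordinal im))//= big1 ?addr0.
    have yA : A i y by rewrite /A /= in_itv/= ziy.
    by rewrite indicE mem_set// mulr1 (fc i)// ziy.
  move=> j /eqP ji; rewrite indicE memNset ?mulr0//.
  rewrite /A /= in_itv/= => /andP[zjy yzj].
  case: (ltngtP i j) => [ij|ij|ij].
  - by have := zle _ _ ij; rewrite leNgt (le_lt_trans zjy).
  - by have := zle _ _ ij; rewrite leNgt (le_lt_trans ziy).
  - by apply: ji; exact: val_inj.
rewrite (@ge0_ae_eq_integral _ _ _ mu _ _
   (fun y => (\sum_(0 <= i < m) (Normc.normc (c i) `^ p * \1_(A i) y)%:E)%E)) //.
- rewrite ge0_integral_sum//; last first.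
    by move=> i y _; rewrite lee_fin mulr_ge0// powR_ge0.
    by move=> i; apply/measurable_EFinP; apply: measurable_funM.
  transitivity (fine (\sum_(0 <= i < m) Normc.normc (c i) `^ p * (z i.+1 - z i))%:E) => //.
  rewrite -sumEFin; congr fine.
  rewrite !big_nat; apply: eq_bigr => i /andP[_ im].
  under eq_integral do rewrite EFinM.
  rewrite ge0_integralZl//; last 2 first.
  + by apply/measurable_EFinP; exact: measurable_indic.
  + by rewrite lee_fin powR_ge0.
  rewrite integral_indic// setIT EFinM; congr (_ * _)%E.
  by apply: unit_measure_itv => //; [rewrite -z0 zle|rewrite -z1 zle].
- by apply/measurable_EFinP; exact: measurable_normc_powR (LpCfun_Cmeasurable f).
- apply: emeasurable_sum => i; apply/measurable_EFinP; apply: measurable_funM => //.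
- by move=> y _; rewrite lee_fin powR_ge0.
- by move=> y _; apply: sume_ge0 => i _; rewrite lee_fin mulr_ge0// powR_ge0.
- by apply: ae_half_open => y /stepE -> _; rewrite sumEFin.
Qed.

End LpModular.

(** * Density of the indicators *)

Section LpDense.
Import HBSimple HBNNSimple.
Variables (R : realType) (p : R) (p1 : 1 <= p).
Local Notation mu := (unit_measure R).
Local Notation T := (measurableTypeR R).

Lemma normc_real (a : R) : Normc.normc (a%:C%C) = `|a|.
Proof. by rewrite /= expr0n/= addr0 sqrtr_sqr. Qed.

Lemma unit_measure_fin (A : set T) : measurable A -> (mu A < +oo)%E.
Proof.
move=> mA; apply: (@le_lt_trans _ _ 1%E); last exact: ltry.
rewrite -[leRHS](_ : mu setT = 1%E).
  by apply: le_measure; rewrite ?inE//.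
by rewrite /unit_measure /= /mrestr setTI lebesgue_measure_itv/= lte_fin ltr01 sube0.
Qed.

Lemma LpC_le (f g : T -> R[i]) : Cmeasurable g -> f \in LpC p1 ->
  (forall x, Normc.normc (g x) <= Normc.normc (f x)) -> g \in LpC p1.
Proof.
move=> mg; rewrite !inE /= => -[mf lf] gf; split => //.
apply: (@CLnorm_lty_le R p _ (fun x => Normc.normc (f x))) => //.
- exact: ltW (p_gt0 p1).
- exact: measurable_normc.
Qed.

Lemma cst1_LpC : (cst 1 : T -> R[i]) \in LpC p1.
Proof.
have m1 : Cmeasurable (cst 1 : T -> R[i]) by split; exact: measurable_cst.
rewrite inE /=; split => //.
apply: (@CLnorm_lty_le R p _ (cst 1)) => //; first exact: ltW (p_gt0 p1).
  by move=> x; rewrite /cst Normc.normc1.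
rewrite /finite_norm (_ : _ \o _ = cst 1%E)// Lnorm_cst1 /=.
by rewrite /mrestr setTI lebesgue_measure_itv/= lte_fin ltr01 sube0 poweR_EFin
  ltry.
Qed.

Lemma set_indicator_LpC (A : set T) : measurable A ->
  (fun x : T => (\1_A x)%:C%C) \in LpC p1.
Proof.
move=> mA; apply: (LpC_le _ cst1_LpC).
  by split; [exact: measurable_indic | exact: measurable_cst].
by move=> x; rewrite normc_real Normc.normc1 indicE; case: (_ \in _); rewrite ?normr1 ?normr0.
Qed.

Definition set_indicator (A : set T) (mA : measurable A) : LpCfun p1 :=
  MkLpCfun (set_indicator_LpC mA).

Lemma indicatorE a b : indicator p1 a b =
  Lp_class (set_indicator (measurable_itv (`[a, b]%R : interval R))).
Proof. by apply: eq_Lp_class. Qed.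

Lemma Lp_modular_set_indicator (A : set T) (mA : measurable A) :
  Lp_modular (Lp_class (set_indicator mA)) = fine (mu A).
Proof.
rewrite Lp_modular_class; congr fine.
rewrite (eq_integral (fun x => (\1_A x)%:E)); last first.
  move=> x _; congr (_%:E); rewrite [LpCfun_val _ _]/= normc_real indicE.
  case: (_ \in _); rewrite ?normr1 ?powR1// normr0 powR0// gt_eqF//.
  exact: p_gt0 p1.
by rewrite integral_indic// setIT.
Qed.

(** Density is proved for an abstract set [S] closed under linear operations and limits. It will be
    applied to the functions [f] for which [(0, f)] is in the closed span of the new distinguished
    vectors. *)
Variable S : LpSpace p1 -> Prop.
Hypothesis SD : forall x y, S x -> S y -> S (x + y).
Hypothesis SZ : forall a x, S x -> S (a *: x).
Hypothesis Slim : forall x, (forall eps : R, 0 < eps ->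
  exists2 y, S y & Lp_modular (x - y) < eps) -> S x.
Hypothesis Sind : forall t, 0 <= t <= 1 -> S (indicator p1 t 1).

Let S0 : S 0.
Proof. by rewrite -(scale0r (indicator p1 0 1)); apply/SZ/Sind; rewrite lexx ler01. Qed.

Let SB x y : S x -> S y -> S (x - y).
Proof. by move=> Sx Sy; apply: SD => //; rewrite -scaleN1r; exact: SZ. Qed.

Let Ssum I (r : seq I) (P : pred I) (F : I -> LpSpace p1) :
  (forall i, P i -> S (F i)) -> S (\sum_(i <- r | P i) F i).
Proof. by move=> h; elim/big_ind: _. Qed.

(** Dynkin's induction from the rays [[x, +oo[], which are stable under intersection. On [0, 1) a
    ray is everything, a tail or empty. For a disjoint union, the remainders after finitely many
    sets decrease to the empty set, so their measures tend to 0. *)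
Let Sset (A : set T) (mA : measurable A) : S (Lp_class (set_indicator mA)).
Proof.
pose P A := forall mA : measurable A, S (Lp_class (set_indicator mA)).
have PT : P setT.
  move=> mT; have := @Sind 0; rewrite lexx ler01 => /(_ isT).
  congr S; rewrite indicatorE; apply: eq_Lp_class => y /andP[y0 y1] /=.
  by rewrite !indicE !mem_set//= in_itv/= y0 ltW.
suff : P A by exact.
apply: (@dynkin_induction _ T (@RGenCInfty.G R)) => //.
- exact: RGenCInfty.measurableE.
- move=> _ _ [x ->] [y ->]; exists (Num.max x y).
  apply/seteqP; split => z /=; rewrite !in_itv/= !andbT ge_max; first by move=> [-> ->].
  by move=> /andP[].
- move=> _ [x ->] mx.
  have [x0|x0] := ltP x 0.
    have := PT measurableT; congr S; apply: eq_Lp_class => y /andP[y0 y1] /=.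
    by rewrite !indicE !mem_set//= in_itv/= andbT (le_trans (ltW x0)).
  have [x1|x1] := leP x 1.
    have := @Sind x; rewrite x0 x1 => /(_ isT).
    congr S; rewrite indicatorE; apply: eq_Lp_class => y /andP[y0 y1] /=.
    rewrite !indicE; congr (_%:R%:C%C); congr nat_of_bool.
    by apply/idP/idP; rewrite !inE/= !in_itv/= (ltW y1) !andbT.
  have := S0; congr S; apply: eq_Lp_class => y /andP[y0 y1] /=.
  rewrite indicE memNset//= in_itv/= andbT => /le_lt_trans/(_ y1).
  by rewrite ltNge (ltW x1).
- move=> B mB PB mCB.
  have := SB (PT measurableT) (PB mB); congr S.
  rewrite -Lp_classB; apply: eq_Lp_class => y _.
  rewrite LpCfunB /= !indicE in_setC in_setT.
  by case: (y \in B); rewrite /= ?subr0 ?subrr.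
- move=> F mF tF PF mU.
  pose B n := \big[setU/set0]_(k < n) F k.
  have mB n : measurable (B n) by exact: bigsetU_measurable.
  have PB n : S (Lp_class (set_indicator (mB n))).
    elim: n => [|n IH].
      have := S0; congr S; apply: eq_Lp_class => y _ /=.
      by rewrite /B big_ord0 indicE in_set0.
    have := SD IH (PF n (mF n)); congr S.
    rewrite -Lp_classD; apply: eq_Lp_class => y _.
    rewrite LpCfunD /= /B big_ord_recr/= -/(B n) !indicE in_setU.
    have dis : ~ (y \in B n /\ y \in F n).
      rewrite !inE /B -bigcup_mkord => -[[k /= kn Fk] Fn].
      have /trivIsetP/(_ k n I I) := tF; rewrite (ltn_eqF kn) => /(_ isT) e.
      by have : (F k `&` F n) y by []; rewrite e.
    by case: (y \in B n) dis; case: (y \in F n) => //= dis; rewrite ?addr0 ?add0r//; case: dis.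
  apply: Slim => eps eps0.
  pose D n := (\bigcup_k F k) `\` B n.
  have mD n : measurable (D n) by exact: measurableD.
  have mI : measurable (\bigcap_n D n) by exact: bigcapT_measurable.
  have I0 : \bigcap_n D n = set0.
    apply/seteqP; split => // y /= Dy.
    have [[k _ Fk] _] := Dy 0%N I.
    have [_] := Dy k.+1 I; apply.
    by rewrite /B -bigcup_mkord; exists k => /=.
  have := @nonincreasing_cvg_mu _ _ _ mu D (unit_measure_fin (mD 0%N)) mD mI.
  rewrite I0 measure0 => /(_ _)/fine_cvgP[].
    apply/nonincreasing_seqP => n; apply/subsetPset => y [Uy nB]; split => // By; apply: nB.
    by rewrite /B big_ord_recr/=; left.
  move=> _ /cvgr0Pnorm_lt/(_ eps eps0)[n _ /(_ n (leqnn n)) /= h].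
  exists (Lp_class (set_indicator (mB n))) => //.
  suff -> : Lp_class (set_indicator mU) - Lp_class (set_indicator (mB n)) =
     Lp_class (set_indicator (mD n)).
    by rewrite Lp_modular_set_indicator (le_lt_trans (ler_norm _)).
  rewrite -Lp_classB; apply: eq_Lp_class => y _.
  rewrite LpCfunB /= /D !indicE in_setD.
  have : y \in B n -> y \in \bigcup_k F k.
    by rewrite !inE /B -bigcup_mkord => -[k /= _ Fk]; exists k.
  by case: (y \in B n) => /= [->//|_]; rewrite ?subrr ?subr0 ?andbT.
- by have : (@RGenCInfty.G R).-sigma.-measurable A by rewrite -RGenCInfty.measurableE; exact: mA.
Qed.

(** Simple functions increase to [h]; as [|h - g n| <= h], dominated convergence with the majorant
    [|f|^p] gives convergence of modulars. *)
Let Snonneg (f : LpCfun p1) (h : T -> R) : measurable_fun [set: T] h ->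
  (forall x, 0 <= h x) -> (forall x, f x = (h x)%:C%C) -> S (Lp_class f).
Proof.
move=> mh h0 fh.
have mEh : measurable_fun [set: T] (EFin \o h) by exact/measurable_EFinP.
have h0' t : [set: T] t -> (0 <= (EFin \o h) t)%E by rewrite lee_fin.
have [g [g_nd g_cvg]] := @approximation _ T R setT measurableT (EFin \o h) mEh h0'.
have {}g_cvg (x : T) : g n x @[n --> \oo] --> h x.
  by have /fine_cvgP[_] := g_cvg x I.
have gh n (x : T) : g n x <= h x.
  have -> : h x = limn (fun n => g n x) by apply/esym/cvg_lim.
  apply: (nondecreasing_cvgn_le (u_ := fun n => g n x)).
    by move=> i j /g_nd /lefP.
  by apply/cvg_ex; exists (h x).
have g0 n (x : T) : 0 <= g n x by [].
have GP n : (fun x : T => (g n x)%:C%C) \in LpC p1.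
  apply: (LpC_le _ (LpCfunP f)).
    by split; [exact: measurable_funP | exact: measurable_cst].
  by move=> x; rewrite fh !normc_real !ger0_norm.
pose G n : LpCfun p1 := MkLpCfun (GP n).
have SG n : S (Lp_class (G n)).
  pose s : seq R := finmap.enum_fset (fset_set (range (g n))).
  have mA i : measurable (g n @^-1` [set s`_i]) by [].
  have -> : Lp_class (G n) = \sum_(i < size s)
      ((s`_i)%:C%C *: Lp_class (set_indicator (mA i))).
    rewrite -(eq_bigr _ (fun i _ => Lp_classZ _ _)) -Lp_class_sum.
    apply: eq_Lp_class => y _; rewrite LpCfun_sum /=.
    rewrite (fimfunEord (g n) y) rmorph_sum/=; apply: eq_bigr => i _.
    by rewrite rmorphM.
  by apply: Ssum => i _; apply: SZ; exact: Sset.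
apply: Slim => eps eps0.
pose u n (x : T) : \bar R := (`|h x - g n x| `^ p)%:E.
have mu_ n : measurable_fun [set: T] (u n).
  apply/measurable_EFinP; apply: (measurableT_comp (measurable_powR _)).
  apply: measurableT_comp => //; apply: measurable_funB => //.
have [] := @dominated_convergence _ T R mu setT measurableT u (cst 0%E)
    (fun x => (Normc.normc (f x) `^ p)%:E) mu_ (measurable_cst _) _ _ _.
- apply: aeW => x _; apply/fine_cvgP; split; first by near=> n.
  apply/cvgrPdist_lt => e e0; near=> n.
  rewrite sub0r normrN ger0_norm ?powR_ge0//=.
  have -> : e = (e `^ p^-1) `^ p by rewrite -powRrM mulVf ?gt_eqF ?(p_gt0 p1)// powRr1// ltW.
  apply: gt0_ltr_powR; rewrite ?nnegrE ?powR_ge0 ?(p_gt0 p1)//.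
  by near: n; move/cvgrPdist_lt : (g_cvg x); apply; exact: powR_gt0.
- apply/integrableP; split.
    apply/measurable_EFinP; exact: measurable_normc_powR (LpCfun_Cmeasurable f).
  apply: le_lt_trans (integral_normc_lty f); rewrite le_eqVlt; apply/orP; left.
  by apply/eqP; apply: eq_integral => x _; rewrite gee0_abs// lee_fin powR_ge0.
- apply: aeW => x n _; rewrite lee_fin ger0_norm ?powR_ge0//.
  rewrite fh normc_real ge0_ler_powR ?nnegrE ?(ltW (p_gt0 p1))//.
  rewrite !ger0_norm ?subr_ge0//; first by rewrite gerBl.
move=> _ _; rewrite integral0 => /fine_cvgP[_].
move=> /cvgr0Pnorm_lt/(_ eps eps0)[n _ /(_ n (leqnn n)) /= hn].
exists (Lp_class (G n)) => //; rewrite -Lp_classB Lp_modular_class.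
apply: le_lt_trans hn; apply: le_trans (ler_norm _).
rewrite le_eqVlt; apply/orP; left; apply/eqP; congr fine.
apply: eq_integral => x _; rewrite /u; congr (_ `^ p)%:E.
by rewrite LpCfunB /= fh -rmorphB normc_real.
Unshelve. all: by end_near.
Qed.

Lemma Lp_dense x : S x.
Proof.
rewrite -(Lp_classK x); set f : LpCfun p1 := repr x.
have [mr mi] := LpCfun_Cmeasurable f.
have part (h : T -> R) : measurable_fun [set: T] h -> (forall x, 0 <= h x) ->
    (forall x, h x <= Normc.normc (f x)) ->
    exists2 g : LpCfun p1, (forall x, g x = (h x)%:C%C) & S (Lp_class g).
  move=> mh h0 hf.
  have gP : (fun x : T => (h x)%:C%C) \in LpC p1.
    apply: (LpC_le _ (LpCfunP f)); first by split; [|exact: measurable_cst].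
    by move=> y; rewrite normc_real ger0_norm.
  by exists (MkLpCfun gP) => //; apply: (Snonneg mh).
have Re_le z : `|complex.Re z| <= Normc.normc z :> R.
  case: z => a b /=; rewrite -sqrtr_sqr ler_sqrt ?addr_ge0 ?sqr_ge0//.
  by rewrite lerDl sqr_ge0.
have Im_le z : `|complex.Im z| <= Normc.normc z :> R.
  case: z => a b /=; rewrite -sqrtr_sqr ler_sqrt ?addr_ge0 ?sqr_ge0//.
  by rewrite lerDr sqr_ge0.
have maxP (a b : R) : `|a| <= b -> Num.max a 0 <= b /\ Num.max (- a) 0 <= b.
  by rewrite ler_norml !ge_max => ab; split; lra.
have maxE (a : R) : Num.max a 0 - Num.max (- a) 0 = a.
  by rewrite /Order.max; case: ltP => h1; case: ltP => h2; lra.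
have mmax (h : T -> R) : measurable_fun [set: T] h ->
    measurable_fun [set: T] (fun x => Num.max (h x) 0).
  by move=> mh; apply: measurable_maxr => //; exact: measurable_cst.
have [|||g1 e1 S1] := part (fun x => Num.max (complex.Re (f x)) 0).
- exact: mmax.
- by move=> y; rewrite le_max lexx orbT.
- by move=> y; have [] := maxP _ _ (Re_le (f y)).
have [|||g2 e2 S2] := part (fun x => Num.max (- complex.Re (f x)) 0).
- by apply: mmax; exact: measurableT_comp.
- by move=> y; rewrite le_max lexx orbT.
- by move=> y; have [] := maxP _ _ (Re_le (f y)).
have [|||g3 e3 S3] := part (fun x => Num.max (complex.Im (f x)) 0).
- exact: mmax.
- by move=> y; rewrite le_max lexx orbT.
- by move=> y; have [] := maxP _ _ (Im_le (f y)).
have [|||g4 e4 S4] := part (fun x => Num.max (- complex.Im (f x)) 0).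
- by apply: mmax; exact: measurableT_comp.
- by move=> y; rewrite le_max lexx orbT.
- by move=> y; have [] := maxP _ _ (Im_le (f y)).
have := SD (SB S1 S2) (SZ 'i%C (SB S3 S4)).
rewrite -(Lp_classB g1 g2) -(Lp_classB g3 g4) -Lp_classZ -Lp_classD.
congr S; apply: eq_Lp_class => y _.
rewrite LpCfunD LpCfunZ !LpCfunB e1 e2 e3 e4.
by rewrite -(rmorphB (real_complex R)) -(rmorphB (real_complex R)) !maxE -complexE.
Qed.

End LpDense.

(** * Clarkson's inequality *)

Section Clarkson.
Variable R : realType.
Implicit Types a b s t q : R.

Lemma powR_midpoint_convex a b q : 0 <= a -> 0 <= b -> 1 <= q ->
  2 * ((a + b) / 2) `^ q <= a `^ q + b `^ q.
Proof.
move=> a0 b0 q1.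
have h0 : 0 <= (2^-1 : R) by lra.
have h1 : (2^-1 : R) <= 1 by lra.
have := @convex_powR R q q1 (Itv01 h0 h1) a b.
rewrite !inE/= !in_itv/= !andbT => /(_ a0 b0).
rewrite convRE [X in X `^ _ <= _]convRE/= /unstable.onem.
have -> : 2^-1 * a + (1 - 2^-1) * b = (a + b) / 2 by lra.
lra.
Qed.

(** Convexity of the power with exponent [1 / q], applied to the q-th powers of [a] and [b]. *)
Lemma powR_midpoint_concave a b q : 0 <= a -> 0 <= b -> 0 < q -> q <= 1 ->
  a `^ q + b `^ q <= 2 * ((a + b) / 2) `^ q.
Proof.
move=> a0 b0 q0 q1.
have K x : 0 <= x -> (x `^ q) `^ q^-1 = x.
  by move=> x0; rewrite -powRrM mulfV ?gt_eqF// powRr1.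
have := @powR_midpoint_convex (a `^ q) (b `^ q) q^-1 (powR_ge0 _ _) (powR_ge0 _ _).
rewrite invf_ge1// => /(_ q1); rewrite !K//.
set m := (_ + _) / 2 => h.
have m0 : 0 <= m by rewrite divr_ge0 ?addr_ge0 ?powR_ge0.
have : (m `^ q^-1) `^ q <= ((a + b) / 2) `^ q.
  rewrite ge0_ler_powR ?nnegrE ?powR_ge0 ?(ltW q0)//; last by lra.
  by rewrite divr_ge0// addr_ge0.
by rewrite -powRrM mulVf ?gt_eqF// powRr1// /m; lra.
Qed.

Lemma ltr_powR_exponent x q r : 0 < x -> x < 1 -> q < r -> x `^ r < x `^ q.
Proof.
by move=> x0 x1 qr; rewrite /powR gt_eqF// ltr_expR ltr_nM2r// ln_lt0// x0.
Qed.

(** After division by [s + t] both terms lie strictly between 0 and 1, where raising to the power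
    [q] strictly increases or strictly decreases them according to whether [q < 1]. *)
Lemma powR_add_strict s t q : 0 < s -> 0 < t -> q != 1 ->
  if q < 1 then (s + t) `^ q < s `^ q + t `^ q else s `^ q + t `^ q < (s + t) `^ q.
Proof.
move=> s0 t0 q1; have st0 : 0 < s + t by rewrite addr_gt0.
have E x : 0 < x -> x `^ q = (x / (s + t)) `^ q * (s + t) `^ q.
  by move=> x0; rewrite -powRM ?divr_ge0 ?ltW// divfK// gt_eqF.
have P0 : 0 < (s + t) `^ q by exact: powR_gt0.
have s1 : s / (s + t) < 1 by rewrite ltr_pdivrMr// mul1r; lra.
have t1 : t / (s + t) < 1 by rewrite ltr_pdivrMr// mul1r; lra.
have s0' : 0 < s / (s + t) by rewrite divr_gt0.
have t0' : 0 < t / (s + t) by rewrite divr_gt0.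
have e : s / (s + t) + t / (s + t) = 1 by rewrite -mulrDl divff// gt_eqF.
rewrite (E s)// (E t)// -mulrDl.
case: ltP => [ql|]; last rewrite le_eqVlt eq_sym (negbTE q1) => /= ql.
  rewrite ltr_pMl// -e -[X in X + _ < _]powRr1 ?ltW// -[X in _ + X < _]powRr1 ?ltW//.
  by rewrite ltrD// ltr_powR_exponent.
rewrite gtr_pMl// -e -[X in _ < X + _]powRr1 ?ltW// -[X in _ < _ + X]powRr1 ?ltW//.
by rewrite ltrD// ltr_powR_exponent.
Qed.

Variables (p : R) (p1 : 1 <= p) (p2 : p <> 2).

(** The sign with which the defect of Clarkson's inequality is nonnegative. *)
Definition clarkson_sign : R := if p < 2 then 1 else -1.

Definition clarkson_defect (z w : R[i]) : R :=
  clarkson_sign * (2 * (Normc.normc z `^ p + Normc.normc w `^ p)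
   - (Normc.normc (z + w) `^ p + Normc.normc (z - w) `^ p)).

Lemma normc_powR_sq (z : R[i]) :
  Normc.normc z `^ p = (complex.Re z ^+ 2 + complex.Im z ^+ 2) `^ (p / 2).
Proof.
case: z => a b /=; rewrite -powR12_sqrt ?addr_ge0 ?sqr_ge0//.
by rewrite -powRrM mulrC.
Qed.

(** Put [q = p / 2], [s = |z|^2], [t = |w|^2]. By the parallelogram law [|z + w|^2] and [|z - w|^2]
    have mean [s + t]. Concavity or convexity of the q-th power compares their q-th powers with
    [2 (s + t)^q], and strict sub- or superadditivity compares that with [2 (s^q + t^q)], in the
    same direction. Strictness needs [s, t > 0] and [q <> 1]. *)
Lemma clarkson_defectP z w : 0 <= clarkson_defect z w /\
  (clarkson_defect z w = 0 <-> z = 0 \/ w = 0).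
Proof.
have p0 : 0 < p by exact: lt_le_trans p1.
have n0 : Normc.normc (0 : R[i]) `^ p = 0.
  by rewrite Normc.normc0 powR0// gt_eqF.
have [->|z0] := eqVneq z 0.
  rewrite /clarkson_defect n0 !add0r normcN.
  have -> : 2 * Normc.normc w `^ p - (Normc.normc w `^ p + Normc.normc w `^ p) = 0 by lra.
  by rewrite mulr0; split => //; split => // _; left.
have [->|w0] := eqVneq w 0.
  rewrite /clarkson_defect n0 !addr0 subr0.
  have -> : 2 * Normc.normc z `^ p - (Normc.normc z `^ p + Normc.normc z `^ p) = 0 by lra.
  by rewrite mulr0; split => //; split => // _; right.
suff h : 0 < clarkson_defect z w.
  split; first exact: ltW.
  split; first by move=> e; rewrite e ltxx in h.
  by case=> e; move: z0 w0; rewrite e eqxx.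
have pos (u : R[i]) : u != 0 -> 0 < complex.Re u ^+ 2 + complex.Im u ^+ 2.
  move=> u0; rewrite lt_def addr_ge0 ?sqr_ge0// andbT paddr_eq0 ?sqr_ge0//.
  by rewrite !sqrf_eq0; move: u0; rewrite eq_complex.
rewrite /clarkson_defect !normc_powR_sq.
have := pos _ w0; have := pos _ z0; move: z w {z0 w0} => [a b] [c d] /=.
set s := a ^+ 2 + b ^+ 2; set t := c ^+ 2 + d ^+ 2 => s0 t0.
set A := (a + c) ^+ 2 + (b + d) ^+ 2.
set B := (a - c) ^+ 2 + (b - d) ^+ 2.
have A0 : 0 <= A by rewrite addr_ge0 ?sqr_ge0.
have B0 : 0 <= B by rewrite addr_ge0 ?sqr_ge0.
have ABE : (A + B) / 2 = s + t by rewrite /A /B /s /t; field.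
have q1 : p / 2 != 1 by apply/eqP => e; apply: p2; lra.
have := powR_add_strict s0 t0 q1.
have q2 : (p / 2 < 1) = (p < 2) by rewrite ltr_pdivrMr ?mul1r.
rewrite q2 /clarkson_sign; case: ltP => [pl|pg] h.
  have q0 : 0 < p / 2 by rewrite divr_gt0.
  have := powR_midpoint_concave A0 B0 q0; rewrite ABE => /(_ _); lra.
have q1' : 1 <= p / 2 by lra.
have := powR_midpoint_convex A0 B0 q1'; rewrite ABE; lra.
Qed.

End Clarkson.

(** * Disjointness in Lp *)

Section LpAtoms.
Variables (R : realType) (p : R) (p1 : 1 <= p).
Local Notation mu := (unit_measure R).
Local Notation T := (measurableTypeR R).
Implicit Types (u v : T -> R) (f g : LpCfun p1) (x y : LpSpace p1).

Let p0 : 0 < p := p_gt0 p1.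

Lemma integrable_EFinD u v : mu.-integrable setT (EFin \o u) ->
  mu.-integrable setT (EFin \o v) -> mu.-integrable setT (EFin \o (fun t => u t + v t)).
Proof. by move=> iu iv; have := integrableD measurableT iu iv; apply: eq_integrable. Qed.

Lemma integrable_EFinB u v : mu.-integrable setT (EFin \o u) ->
  mu.-integrable setT (EFin \o v) -> mu.-integrable setT (EFin \o (fun t => u t - v t)).
Proof. by move=> iu iv; have := integrableB measurableT iu iv; apply: eq_integrable. Qed.

Lemma integrable_EFinZ r u : mu.-integrable setT (EFin \o u) ->
  mu.-integrable setT (EFin \o (fun t => r * u t)).
Proof. by move=> iu; have := integrableZl measurableT r iu; apply: eq_integrable. Qed.

Lemma integrable_normc f : mu.-integrable setT (EFin \o (fun t => Normc.normc (f t) `^ p)).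
Proof.
apply/integrableP; split.
  apply/measurable_EFinP; exact: measurable_normc_powR (LpCfun_Cmeasurable f).
apply: le_lt_trans (integral_normc_lty f); rewrite le_eqVlt; apply/orP; left.
by apply/eqP; apply: eq_integral => t _; rewrite gee0_abs// lee_fin powR_ge0.
Qed.

Lemma Lp_modular_Rintegral f :
  Lp_modular (Lp_class f) = \int[mu]_t (Normc.normc (f t) `^ p).
Proof. exact: Lp_modular_class. Qed.

Lemma Rintegral_eq0_ae u : (forall t, 0 <= u t) -> mu.-integrable setT (EFin \o u) ->
  \int[mu]_t u t = 0 -> {ae mu, forall t, u t = 0}.
Proof.
move=> u0 iu ui0.
have [mu_ _] := integrableP _ _ _ iu.
have /(ae_eq_integral_abs mu measurableT mu_) : (\int[mu]_t `|(EFin \o u) t| = 0)%E.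
  rewrite -[RHS](_ : (\int[mu]_t u t)%:E = 0%E); last by rewrite ui0.
  rewrite /Rintegral fineK; last exact: integrable_fin_num.
  by apply: eq_integral => t _; rewrite gee0_abs// lee_fin.
by apply: filterS => t /(_ I) /= [].
Qed.

Lemma ae_Rintegral_eq0 u : {ae mu, forall t, u t = 0} ->
  measurable_fun [set: T] u -> \int[mu]_t u t = 0.
Proof.
move=> u0 mu_; rewrite /Rintegral (ae_eq_integral (cst 0%E)) ?integral0//.
- exact/measurable_EFinP.
- by apply: filterS u0 => t /= -> _.
Qed.

Lemma Lp_modularZ a x : Lp_modular (a *: x) = Normc.normc a `^ p * Lp_modular x.
Proof.
rewrite -(Lp_classK x) -Lp_classZ !Lp_modular_Rintegral -RintegralZl//; last first.
  exact: integrable_normc.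
by apply: eq_Rintegral => t _; rewrite LpCfunZ Normc.normcM powRM ?normc_ge0.
Qed.

Lemma Lp_modular0 : Lp_modular (0 : LpSpace p1) = 0.
Proof. by rewrite -(scale0r 0) Lp_modularZ Normc.normc0 powR0 ?mul0r// gt_eqF. Qed.

Lemma normc_powR_eq0 (z : R[i]) : Normc.normc z `^ p = 0 -> z = 0.
Proof. by move/powR_eq0_eq0/Normc.eq0_normc. Qed.

Lemma Lp_modular_eq0 x : Lp_modular x = 0 -> x = 0.
Proof.
rewrite -(Lp_classK x) Lp_modular_Rintegral => h.
have := Rintegral_eq0_ae (fun t => powR_ge0 _ _) (integrable_normc (repr x)) h.
by move=> ae; apply/Lp_classP; apply: filterS ae => t /normc_powR_eq0.
Qed.

(** Crude: [|z + w|] is at most twice the larger modulus. Only limits are taken with this bound, so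
    the constant does not matter. *)
Lemma normc_powRD_le (z w : R[i]) :
  Normc.normc (z + w) `^ p <= 2 `^ p * (Normc.normc z `^ p + Normc.normc w `^ p).
Proof.
set a := Normc.normc z; set b := Normc.normc w.
have a0 : 0 <= a by exact: normc_ge0.
have b0 : 0 <= b by exact: normc_ge0.
apply: (@le_trans _ _ ((2 * Num.max a b) `^ p)).
  rewrite ge0_ler_powR ?nnegrE ?normc_ge0 ?(ltW p0)//.
    by rewrite mulr_ge0// le_max a0.
  apply: (le_trans (le_normcD _ _)); rewrite -/a -/b.
  by rewrite mulr_natl mulr2n lerD// le_max lexx ?orbT.
rewrite powRM ?le_max ?a0// ler_wpM2l ?powR_ge0//.
by case: (leP a b) => _; [rewrite lerDr|rewrite lerDl]; exact: powR_ge0.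
Qed.

Lemma Lp_modularD_le x y :
  Lp_modular (x + y) <= 2 `^ p * (Lp_modular x + Lp_modular y).
Proof.
rewrite -(Lp_classK x) -(Lp_classK y) -Lp_classD !Lp_modular_Rintegral.
have ix := integrable_normc (repr x); have iy := integrable_normc (repr y).
rewrite -RintegralD// -RintegralZl//; last exact: integrable_EFinD.
apply: le_Rintegral => //; first exact: integrable_normc.
  by apply: integrable_EFinZ; exact: integrable_EFinD.
by move=> t _; rewrite LpCfunD; exact: normc_powRD_le.
Qed.

Definition Lp_disjoint x y :=
  {ae mu, forall t, (repr x : LpCfun p1) t = 0 \/ (repr y : LpCfun p1) t = 0}.

Lemma Lp_disjoint_class f g :
  Lp_disjoint (Lp_class f) (Lp_class g) <-> {ae mu, forall t, f t = 0 \/ g t = 0}.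
Proof.
split=> h.
  by apply: filterS3 h (repr_Lp_class f) (repr_Lp_class g) => t h <- <-.
by apply: filterS3 h (repr_Lp_class f) (repr_Lp_class g) => t h -> ->.
Qed.

Hypothesis p2 : p <> 2.

Definition Lp_defect x y : R := clarkson_sign p *
  (2 * (Lp_modular x + Lp_modular y) - (Lp_modular (x + y) + Lp_modular (x - y))).

(** The defect is the integral of the pointwise Clarkson defect, whose sign is constant; it vanishes
    only if the integrand does almost everywhere. *)
Lemma Lp_defectP x y : 0 <= Lp_defect x y /\ (Lp_defect x y = 0 <-> Lp_disjoint x y).
Proof.
rewrite /Lp_defect -(Lp_classK x) -(Lp_classK y); set f : LpCfun p1 := repr x.
set g : LpCfun p1 := repr y.
rewrite Lp_disjoint_class -Lp_classB -!Lp_classD !Lp_modular_Rintegral.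
have i1 := integrable_normc f; have i2 := integrable_normc g.
have i3 := integrable_normc (f + g); have i4 := integrable_normc (f - g).
pose u t := clarkson_defect p (f t) (g t).
have uE t : clarkson_sign p *
    (2 * (Normc.normc (f t) `^ p + Normc.normc (g t) `^ p) -
     (Normc.normc ((f + g) t) `^ p + Normc.normc ((f - g) t) `^ p)) = u t.
  have e1 : (f + g) t = f t + g t by exact: LpCfunD.
  have e2 : (f - g) t = f t - g t by exact: LpCfunB.
  by rewrite e1 e2.
have iD : mu.-integrable setT (EFin \o u).
  have := integrable_EFinZ (clarkson_sign p) (integrable_EFinB
    (integrable_EFinZ 2 (integrable_EFinD i1 i2)) (integrable_EFinD i3 i4)).
  by apply: eq_integrable => // t _; rewrite /comp uE.
set r := clarkson_sign p * (_ - _).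
have -> : r = \int[mu]_t u t.
  rewrite /r -RintegralD// -RintegralD// -RintegralZl//; last exact: integrable_EFinD.
  rewrite -RintegralB//; last 2 first.
  - by apply: integrable_EFinZ; exact: integrable_EFinD.
  - exact: integrable_EFinD.
  rewrite -RintegralZl//; last first.
    apply: integrable_EFinB; last exact: integrable_EFinD.
    by apply: integrable_EFinZ; exact: integrable_EFinD.
have u0 t : 0 <= u t by have [] := clarkson_defectP p1 p2 (f t) (g t).
split; first exact: Rintegral_ge0.
split=> [/(Rintegral_eq0_ae u0 iD)|ae].
  by apply: filterS => t; have [_ []] := clarkson_defectP p1 p2 (f t) (g t).
apply: ae_Rintegral_eq0.
  by apply: filterS ae => t; have [_ []] := clarkson_defectP p1 p2 (f t) (g t).
by have [+ _] := integrableP _ _ _ iD; move/measurable_EFinP.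
Qed.

(* By bisection, an indecomposable vector would be supported, for every [k], in an
   interval of length [2^-k]. *)
Lemma Lp_split x : x <> 0 ->
  exists y z, [/\ y <> 0, z <> 0, x = y + z & Lp_disjoint y z].
Proof.
move=> x0; apply: contrapT => nsplit; apply: x0.
rewrite -(Lp_classK x); set f : LpCfun p1 := repr x.
pose N : set T := [set t | f t <> 0].
have key (A : set T) : measurable A ->
    mu.-negligible (N `&` A) \/ mu.-negligible (N `\` A).
  move=> mA; apply: contrapT => /not_orP[h1 h2]; apply: nsplit.
  have res (B : set T) : measurable B ->
      exists2 h : LpCfun p1, (forall t, h t = (\1_B t)%:C%C * f t) &
      ~ mu.-negligible (N `&` B) -> Lp_class h <> 0.
    move=> mB.
    have [mr mi] := LpCfun_Cmeasurable f.
    have hP : (fun t : T => (\1_B t)%:C%C * f t) \in LpC p1.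
      apply: (LpC_le _ (LpCfunP f)).
        split.
          rewrite (_ : (fun t => _) = (fun t => \1_B t * complex.Re (f t))).
            by apply: measurable_funM => //; exact: measurable_indic.
          by apply/funext => t; case: (f t) => a b /=; rewrite mul0r subr0.
        rewrite (_ : (fun t => _) = (fun t => \1_B t * complex.Im (f t))).
          by apply: measurable_funM => //; exact: measurable_indic.
        by apply/funext => t; case: (f t) => a b /=; rewrite mul0r addr0.
      move=> t; rewrite Normc.normcM normc_real indicE.
      case: (t \in B); first by rewrite normr1 mul1r.
      by rewrite normr0 mul0r normc_ge0.
    exists (MkLpCfun hP) => // hn /Lp_classP ae; apply: hn.
    apply: negligibleS ae => t /= [Nt Bt] /=; rewrite indicE mem_set// mul1r.
    by apply: contra_not Nt.
  have [h hE h0] := res _ mA.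
  have [k kE k0] := res _ (measurableC mA).
  exists (Lp_class h), (Lp_class k); split.
  - exact: h0.
  - by apply: k0; rewrite -setDE.
  - rewrite -(Lp_classK x) -Lp_classD; apply: eq_Lp_class => t _.
    rewrite LpCfunD hE kE !indicE in_setC.
    by case: (t \in A); rewrite /= ?mul1r ?mul0r ?addr0 ?add0r.
  - apply/Lp_disjoint_class; apply: aeW => t; rewrite hE kE !indicE in_setC.
    by case: (t \in A); rewrite /= ?mul0r; [right|left].
have bisect k : exists a b : R, [/\ 0 <= a, b <= 1, b - a = 2^-1 ^+ k &
    mu.-negligible (N `\` `[a, b[%classic)].
  elim: k => [|k [a [b [a0 b1 ab nab]]]].
    exists 0, 1; split => //; first by rewrite subr0 expr0.
    apply: negligibleS (ae_half_open (P := fun t : T => 0 <= t < 1) (fun _ h => h)).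
    by move=> t [_]; rewrite /= in_itv.
  pose m := (a + b) / 2.
  have e0 : 0 < 2^-1 ^+ k :> R by rewrite exprn_gt0.
  have mE : [/\ a < m, m < b, b - m = 2^-1 ^+ k.+1 & m - a = 2^-1 ^+ k.+1].
    by rewrite exprS /m; split; lra.
  have [am mb bm ma] := mE.
  have [h|h] := key `]-oo, m[%classic (measurable_itv _).
    exists m, b; split => //; first by rewrite (le_trans a0)// ltW.
    apply: negligibleS (negligibleU nab h) => t [Nt /=]; rewrite !in_itv/= => nt.
    have [tm|mt] := ltP t m; first by right; split.
    left; split => // /andP[_ tb]; apply: nt.
    by rewrite mt.
  exists a, m; split => //; first by rewrite (le_trans _ b1)// ltW.
  apply: negligibleS (negligibleU nab h) => t [Nt /=]; rewrite !in_itv/= => nt.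
  have [tm|mt] := ltP t m; last by right; split.
  left; split => // /andP[ta _]; apply: nt.
  by rewrite ta.
have mN : measurable N.
  have := measurable_normc (LpCfun_Cmeasurable f).
  move=> /(_ measurableT [set 0] (measurable_set1 _)); rewrite setTI => /measurableC.
  congr measurable; apply/seteqP; split => t /=.
    by move=> h ft; apply: h; rewrite ft Normc.normc0.
  by move=> h ft; apply: h; exact: Normc.eq0_normc.
apply/Lp_classP.
suff N0 : mu N = 0%E by exists N; split.
have muN : (mu N < +oo)%E by exact: unit_measure_fin.
have : forall k, fine (mu N) <= 2^-1 ^+ k.
  move=> k; have [a [b [a0 b1 ab nab]]] := bisect k.
  have [M [mM M0 sM]] := nab.
  have mI : measurable (`[a, b[%classic : set T) by exact: measurable_itv.
  have ab0 : a <= b by rewrite -subr_ge0 ab exprn_ge0.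
  rewrite -lee_fin fineK ?ge0_fin_numE// -ab -(unit_measure_itv a0 ab0 b1).
  apply: (@le_trans _ _ (mu (M `|` `[a, b[))).
    apply: le_measure; rewrite ?inE//; first exact: measurableU.
    move=> t Nt; have [It|It] := pselect (`[a, b[%classic t); first by right.
    by left; apply: sM.
  by apply: (le_trans (measureU2 _ mM mI)); rewrite [X in (X + _)%E]M0 add0e.
move=> h; apply/eqP; rewrite -[X in X == _]fineK ?ge0_fin_numE// eqe.
rewrite eq_le fine_ge0// andbT leNgt; apply/negP => /exists_expr2V_lt[k].
by rewrite ltNge h.
Qed.

End LpAtoms.

(** * Images of atoms under isometries *)

Section LpSumModular.
Variables (R : realType) (n : nat) (p : R) (p1 : 1 <= p).
Local Notation W := (LpSum n p1).
Implicit Types (v w : W).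

Let p0 : 0 < p := p_gt0 p1.

Definition sum_modular v : R :=
  \sum_(j < n) Normc.normc (v.1 0 j) `^ p + Lp_modular v.2.

Lemma LpSum_eq v w : v.1 = w.1 -> v.2 = w.2 -> v = w.
Proof. by case: v w => [a b] [c d] /= -> ->. Qed.

Lemma sum_modular_ge0 v : 0 <= sum_modular v.
Proof. by rewrite addr_ge0 ?Lp_modular_ge0// sumr_ge0// => j _; exact: powR_ge0. Qed.

Lemma LpSum_normE v : LpSum_norm v = sum_modular v `^ p^-1.
Proof.
rewrite /LpSum_norm /lp_norm -powRrM mulVf ?gt_eqF// powRr1//.
by apply: sumr_ge0 => j _; exact: powR_ge0.
Qed.

Lemma sum_modularE v : sum_modular v = LpSum_norm v `^ p.
Proof.
by rewrite LpSum_normE -powRrM mulVf ?gt_eqF// powRr1// sum_modular_ge0.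
Qed.

Lemma LpSum_norm_lt v eps : 0 < eps -> (LpSum_norm v < eps) = (sum_modular v < eps `^ p).
Proof.
move=> eps0; have N0 : 0 <= LpSum_norm v by exact: powR_ge0.
rewrite sum_modularE; apply/idP/idP => [|h].
  by apply: gt0_ltr_powR; rewrite ?nnegrE// ltW.
rewrite ltNge; apply: contraTN h => h; rewrite -leNgt.
by rewrite ge0_ler_powR ?nnegrE// ltW.
Qed.

Lemma sum_modularZ a v : sum_modular (a *: v) = Normc.normc a `^ p * sum_modular v.
Proof.
rewrite /sum_modular mulrDr mulr_sumr Lp_modularZ; congr (_ + _).
by apply: eq_bigr => j _; rewrite mxE Normc.normcM powRM ?normc_ge0.
Qed.

Lemma sum_modularD_le v w :
  sum_modular (v + w) <= 2 `^ p * (sum_modular v + sum_modular w).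
Proof.
rewrite /sum_modular addrACA -big_split/= mulrDr mulr_sumr lerD ?Lp_modularD_le//.
by apply: ler_sum => j _; rewrite mxE normc_powRD_le.
Qed.

Lemma sum_modular_eq0 v : sum_modular v = 0 -> v = 0.
Proof.
move/eqP; rewrite paddr_eq0 ?Lp_modular_ge0//; last first.
  by apply: sumr_ge0 => j _; exact: powR_ge0.
move=> /andP[/eqP h1 /eqP h2]; apply: LpSum_eq; last first.
  exact: Lp_modular_eq0.
apply/rowP => j; rewrite mxE; apply: (@normc_powR_eq0 R p).
by apply: (psumr_eq0P _ h1) => // i _; exact: powR_ge0.
Qed.

Definition LpSum_disjoint v w :=
  (forall j, v.1 0 j = 0 \/ w.1 0 j = 0) /\ Lp_disjoint v.2 w.2.

Hypothesis p2 : p <> 2.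

(** The total defect is a sum of nonnegative coordinate defects and so vanishes only if all of them
    do. The right-hand side involves norms alone, which is why linear isometries preserve
    disjointness in both directions. *)
Lemma LpSum_disjointP v w : LpSum_disjoint v w <->
  sum_modular (v + w) + sum_modular (v - w) = 2 * (sum_modular v + sum_modular w).
Proof.
have s0 : clarkson_sign p != 0.
  by rewrite /clarkson_sign; case: ifP => _; rewrite ?oppr_eq0 oner_eq0.
pose D := clarkson_sign p * (2 * (sum_modular v + sum_modular w)
  - (sum_modular (v + w) + sum_modular (v - w))).
have DE : D = \sum_(j < n) clarkson_defect p (v.1 0 j) (w.1 0 j) + Lp_defect v.2 w.2.
  rewrite /clarkson_defect -mulr_sumr /Lp_defect -mulrDr; congr (_ * _).
  rewrite sumrB -mulr_sumr !big_split/= /sum_modular.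
  have -> : \sum_(j < n) Normc.normc ((v + w).1 0 j) `^ p =
    \sum_(j < n) Normc.normc (v.1 0 j + w.1 0 j) `^ p.
    by apply: eq_bigr => j _; rewrite mxE.
  have -> : \sum_(j < n) Normc.normc ((v - w).1 0 j) `^ p =
    \sum_(j < n) Normc.normc (v.1 0 j - w.1 0 j) `^ p.
    by apply: eq_bigr => j _; rewrite !mxE.
  by rewrite !mulrDr; lra.
have d0 j : 0 <= clarkson_defect p (v.1 0 j) (w.1 0 j).
  by have [] := clarkson_defectP p1 p2 (v.1 0 j) (w.1 0 j).
have [L0 LP] := Lp_defectP p2 v.2 w.2.
have <- : D = 0 <->
    sum_modular (v + w) + sum_modular (v - w) = 2 * (sum_modular v + sum_modular w).
  rewrite /D; split=> [/eqP|->]; last by rewrite subrr mulr0.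
  by rewrite mulf_eq0 (negbTE s0) subr_eq0 => /eqP.
rewrite DE; split=> [[h1 h2]|/eqP].
  rewrite big1 => [|j _]; first by rewrite add0r; apply/LP.
  by have [_ [_]] := clarkson_defectP p1 p2 (v.1 0 j) (w.1 0 j); apply.
rewrite paddr_eq0 ?sumr_ge0// => /andP[/eqP h1 /eqP /LP h2]; split => // j.
have [_ [+ _]] := clarkson_defectP p1 p2 (v.1 0 j) (w.1 0 j); apply.
by apply: (psumr_eq0P _ h1).
Qed.

Definition LpSum_atom (j : 'I_n) : W := (delta_mx 0 j, 0).

Lemma delta_atom (j k : 'I_n) : (LpSum_atom j).1 0 k = (k == j)%:R.
Proof. by rewrite mxE eqxx. Qed.

Lemma sum_modular_atom j : sum_modular (LpSum_atom j) = 1.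
Proof.
rewrite /sum_modular Lp_modular0 addr0 (bigD1 j)//= big1 => [|i ij].
  by rewrite delta_atom eqxx Normc.normc1 powR1 addr0.
by rewrite delta_atom (negbTE ij) Normc.normc0 powR0// gt_eqF.
Qed.

(** The function parts are disjoint and opposite, hence both zero; in the coordinate [j]
    disjointness leaves only one of the two summands. *)
Lemma atom_indecomposable j v w : LpSum_atom j = v + w -> LpSum_disjoint v w ->
  v = 0 \/ w = 0.
Proof.
move=> e [h1 h2].
have f2 : v.2 + w.2 = 0 by rewrite -[LHS]/((v + w).2) -e.
have [v20 w20] : v.2 = 0 /\ w.2 = 0.
  have wE : w.2 = - v.2 by apply/eqP; rewrite -addr_eq0 addrC f2.
  suff v20 : v.2 = 0 by rewrite wE v20 oppr0.
  rewrite -(Lp_classK v.2); apply/Lp_classP.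
  have := h2; rewrite wE -[X in Lp_disjoint _ (- X)](Lp_classK v.2) -[- Lp_class _]sub0r.
  rewrite -(Lp_classB 0) -[X in Lp_disjoint X _](Lp_classK v.2) Lp_disjoint_class.
  apply: filterS => t []//; rewrite LpCfunB LpCfun0 sub0r => /eqP.
  by rewrite oppr_eq0 => /eqP.
have hj k : k != j -> v.1 0 k = 0 /\ w.1 0 k = 0.
  move=> kj; have : v.1 0 k + w.1 0 k = 0.
    by have := delta_atom j k; rewrite e mxE (negbTE kj).
  by case: (h1 k) => ->; rewrite ?add0r ?addr0.
case: (h1 j) => hz; [left|right]; apply: LpSum_eq => //;
  apply/rowP => k; rewrite mxE; have [->//|/hj[]//] := eqVneq k j.
Qed.

(** A nonzero function part could be split further because Lebesgue measure has no atoms. So it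
    vanishes, and a nonzero coordinate split off from the rest must be everything. *)
Lemma LpSum_indecomposable v : v <> 0 ->
  (forall y z, v = y + z -> LpSum_disjoint y z -> y = 0 \/ z = 0) ->
  exists j, v = v.1 0 j *: LpSum_atom j.
Proof.
move=> v0 ind.
have dis0 (x : LpSpace p1) : Lp_disjoint x 0 /\ Lp_disjoint 0 x.
  have a0 : {ae unit_measure R, forall t, (repr (0 : LpSpace p1) : LpCfun p1) t = 0}.
    exact: repr_Lp_class.
  by split; apply: filterS a0 => t h; [right|left].
have f0 : v.2 = 0.
  have [//|/eqP v20] := eqVneq v.2 0.
  have [y [z [y0 z0 yz dyz]]] := Lp_split v20.
  have [|||] := ind (v.1, y) (0, z).
  - by rewrite [LHS]surjective_pairing yz; congr pair; rewrite /= addr0.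
  - by split => // j; right; rewrite mxE.
  - by case=> _ /y0.
  - by case=> /z0.
have [j vj] : exists j, v.1 0 j != 0.
  apply: contrapT => /forallNP h; apply: v0; apply: LpSum_eq => //.
  by apply/rowP => j; rewrite mxE; apply/eqP/negPn/negP/h.
exists j; have [||h|h] := ind (v.1 0 j *: LpSum_atom j) (v - v.1 0 j *: LpSum_atom j).
- by rewrite addrC subrK.
- split => [k|] /=; last by rewrite scaler0; have [] := dis0 (v.2 - 0).
  have [->|kj] := eqVneq k j; last by left; rewrite !mxE eqxx (negbTE kj) mulr0.
  by right; rewrite !mxE !eqxx mulr1 subrr.
- have : (v.1 0 j *: LpSum_atom j).1 0 j = 0 by rewrite h mxE.
  by rewrite !mxE !eqxx mulr1 => /eqP; rewrite (negbTE vj).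
- by apply/eqP; rewrite -subr_eq0 h.
Qed.

(** The preimage of the atom [j0] inherits its indecomposability, since [T] is injective and
    preserves disjointness. It is therefore a scalar multiple of an atom, and the scalar has modulus
    1 by comparison of norms. *)
Lemma isometric_isomorphism_atom (T : W -> W) j0 :
  isometric_isomorphism (@LpSum_norm R n p p1) (@LpSum_norm R n p p1) T ->
  exists j u, Normc.normc u = 1 /\ T (LpSum_atom j) = u *: LpSum_atom j0.
Proof.
move=> [Tlin Tiso Tonto].
have TM v : sum_modular (T v) = sum_modular v by rewrite !sum_modularE Tiso.
have TD v w : T (v + w) = T v + T w by have := Tlin 1 v w; rewrite !scale1r.
have T0 : T 0 = 0 by apply: (addrI (T 0)); rewrite -TD !addr0.
have TZ a v : T (a *: v) = a *: T v by have := Tlin a v 0; rewrite T0 !addr0.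
have TB v w : T (v - w) = T v - T w by rewrite TD -scaleN1r TZ scaleN1r.
have Tinj v : T v = 0 -> v = 0.
  by move=> h; apply: sum_modular_eq0; rewrite -TM h -T0 TM -(scale0r 0) sum_modularZ
    Normc.normc0 powR0 ?mul0r// gt_eqF.
have [x xE] := Tonto (LpSum_atom j0).
have x1 : sum_modular x = 1 by rewrite -TM xE sum_modular_atom.
have [||j xj] := @LpSum_indecomposable x.
- move=> x0; have := x1; rewrite x0 -(scale0r 0) sum_modularZ Normc.normc0 powR0 ?gt_eqF//.
  by rewrite mul0r => /eqP; rewrite eq_sym oner_eq0.
- move=> y z xyz /LpSum_disjointP dis.
  have [||h|h] := @atom_indecomposable j0 (T y) (T z).
  + by rewrite -TD -xyz xE.
  + by apply/LpSum_disjointP; rewrite -TD -TB !TM.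
  + by left; exact: Tinj.
  + by right; exact: Tinj.
set c := x.1 0 j in xj.
have nc : Normc.normc c = 1.
  have := x1; rewrite xj sum_modularZ sum_modular_atom mulr1 => h.
  by rewrite -[LHS]powRr1 ?normc_ge0// -[X in _ `^ X](mulfV (lt0r_neq0 p0)) powRrM h powR1.
have c0 : c != 0.
  apply/eqP => c0; have := nc; rewrite c0 Normc.normc0 => /eqP.
  by rewrite eq_sym oner_eq0.
exists j, c^-1; split; first by rewrite Normc.normcV nc invr1.
by rewrite -xE xj TZ scalerA mulVf// scale1r.
Qed.

End LpSumModular.

(** * The closed span and the limit real *)

Section ClosedSpan.
Variables (R : realType) (n : nat) (p : R) (p1 : 1 <= p).
Local Notation W := (LpSum n p1).
Variable r : nat -> W.
Implicit Types (x y : W) (s t : seq R[i]).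

Let p0 : 0 < p := p_gt0 p1.

Definition lincomb s : W := \sum_(j < size s) s`_j *: r j.

Definition closed_span x : Prop :=
  forall eps : R, 0 < eps -> exists s, sum_modular (x - lincomb s) < eps.

Lemma closed_span_presentation :
  (forall x, closed_span x) -> is_presentation (@LpSum_norm R n p p1) r.
Proof.
move=> h x eps eps0; have [s hs] := h x (eps `^ p) (powR_gt0 _ eps0).
by exists s; rewrite LpSum_norm_lt.
Qed.

Lemma lincomb_widen s m : (size s <= m)%N -> lincomb s = \sum_(0 <= j < m) s`_j *: r j.
Proof.
move=> sm; rewrite (big_cat_nat (n := size s))//= [X in _ + X]big1_seq ?addr0.
  by rewrite big_mkord.
by move=> j /=; rewrite mem_index_iota => /andP[h _]; rewrite nth_default// scale0r.
Qed.

Lemma closed_spanD x y : closed_span x -> closed_span y -> closed_span (x + y).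
Proof.
move=> hx hy eps eps0.
have P0 : 0 < 2 `^ p :> R by exact: powR_gt0.
have e0 : 0 < eps / 2 `^ p / 2 by rewrite !divr_gt0.
have [s hs] := hx _ e0; have [t ht] := hy _ e0.
pose m := maxn (size s) (size t).
pose u := mkseq (fun j => s`_j + t`_j) m.
exists u; have -> : lincomb u = lincomb s + lincomb t.
  rewrite (@lincomb_widen u m) ?size_mkseq// (@lincomb_widen s m) ?leq_maxl//.
  rewrite (@lincomb_widen t m) ?leq_maxr// -big_split/= !big_nat.
  by apply: eq_bigr => j /andP[_ jm]; rewrite nth_mkseq// scalerDl.
rewrite opprD addrACA; apply: (le_lt_trans (sum_modularD_le _ _)).
rewrite mulrC -ltr_pdivlMr//; lra.
Qed.

Lemma closed_spanZ a x : closed_span x -> closed_span (a *: x).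
Proof.
move=> hx eps eps0.
have a1 : 0 < Normc.normc a `^ p + 1 by rewrite ltr_wpDl// powR_ge0.
have [s hs] := hx (eps / (Normc.normc a `^ p + 1)) (divr_gt0 eps0 a1).
exists (map (fun c => a * c) s).
have -> : lincomb (map (fun c => a * c) s) = a *: lincomb s.
  rewrite (@lincomb_widen _ (size s)) ?size_map// scaler_sumr big_mkord.
  by apply: eq_bigr => j _; rewrite (nth_map 0)// scalerA.
rewrite -scalerBr sum_modularZ.
move: hs; rewrite ltr_pdivlMr// mulrDr mulr1 mulrC; apply: le_lt_trans.
by rewrite lerDl sum_modular_ge0.
Qed.

Lemma closed_span_lim x :
  (forall eps : R, 0 < eps -> exists2 y, closed_span y & sum_modular (x - y) < eps) ->
  closed_span x.
Proof.
move=> h eps eps0.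
have P0 : 0 < 2 `^ p :> R by exact: powR_gt0.
have e0 : 0 < eps / 2 `^ p / 2 by rewrite !divr_gt0.
have [y hy xy] := h _ e0; have [s ys] := hy _ e0; exists s.
rewrite -(subrK y x) -addrA; apply: (le_lt_trans (sum_modularD_le _ _)).
rewrite mulrC -ltr_pdivlMr//; lra.
Qed.

Lemma sum_modular0 : sum_modular (0 : W) = 0.
Proof. by rewrite -(scale0r 0) sum_modularZ Normc.normc0 powR0 ?mul0r// gt_eqF. Qed.

Lemma lincomb_delta k : lincomb (rcons (nseq k 0) 1) = r k.
Proof.
rewrite (@lincomb_widen _ k.+1) ?size_rcons ?size_nseq//.
rewrite big_nat_recr//= nth_rcons size_nseq ltnn eqxx scale1r big_nat big1 ?add0r//.
by move=> j /andP[_ jk]; rewrite nth_rcons size_nseq jk nth_nseq jk scale0r.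
Qed.

Lemma closed_span_generator k : closed_span (r k).
Proof.
move=> eps eps0; exists (rcons (nseq k 0) 1).
by rewrite lincomb_delta subrr sum_modular0.
Qed.

End ClosedSpan.

(** * Stages of gamma and certified dyadic nodes *)

Section StageReals.
Variables (R : realType) (n : nat) (E : nat -> nat -> bool).
Hypothesis Erec : rec2 no_oracle (fun k s => E k s).
Hypothesis Emono : forall k s t, (s <= t)%N -> E k s -> E k t.

(** Thus [gam s] is 1/4 plus the sum of 2^-(k + 2) over the [k < s] enumerated by stage [s]. The sum
    is at most 1/2, so gamma stays in [1/4, 3/4] and both masses, gamma and 1 - gamma, are
    positive. *)
Definition gam_num s : nat := (2 ^ s + \sum_(0 <= k < s) E k s * 2 ^ (s - k))%N.
Definition gam s : R := (gam_num s)%:R / 2 ^+ s.+2.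

(** The range of summation may be enlarged freely, so that two stages can be compared term by
    term. *)
Lemma gamE s m : (s <= m)%N ->
  gam s = 1 / 4 + \sum_(0 <= k < m) ((k < s)%N && E k s)%:R * 2^-1 ^+ k.+2.
Proof.
move=> sm; rewrite /gam /gam_num natrD natrX mulrDl; congr (_ + _).
  by rewrite !exprS; field; rewrite expf_neq0.
rewrite [RHS](big_cat_nat (n := s))//= [X in _ + X]big1_seq ?addr0; last first.
  move=> k /=; rewrite mem_index_iota => /andP[sk _].
  by rewrite ltnNge sk mul0r.
rewrite natr_sum mulr_suml !big_nat; apply: eq_bigr => k /andP[_ ks].
rewrite ks natrM natrX -mulrA; congr (_ * _).
rewrite -[in X in _ / X](subnK (ltnW ks)) -!addnS exprD invfM mulrA divff ?expf_neq0//.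
by rewrite mul1r exprVn.
Qed.

Lemma gam_mono s t : (s <= t)%N -> gam s <= gam t.
Proof.
move=> st; rewrite (gamE st) (gamE (leqnn t)) lerD2l.
apply: ler_sum => k _; rewrite ler_wpM2r ?exprn_ge0// ler_nat.
case: andP => [[ks Ek]|]//=.
by rewrite (leq_trans ks st) (Emono st Ek).
Qed.

Lemma gam_jump k s t : (s <= t)%N -> (k < t)%N -> E k t -> ~~ ((k < s)%N && E k s) ->
  gam s + 2^-1 ^+ k.+2 <= gam t.
Proof.
move=> st kt Ekt nE; rewrite (gamE st) (gamE (leqnn t)) -addrA lerD2l.
rewrite !big_mkord (bigD1 (Ordinal kt))//= (negbTE nE) mul0r add0r.
rewrite [leRHS](bigD1 (Ordinal kt))//= kt Ekt mul1r addrC lerD2l.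
apply: ler_sum => i _; rewrite ler_wpM2r ?exprn_ge0// ler_nat.
case: andP => [[ks Ek]|]//=.
by rewrite ltn_ord (Emono st Ek).
Qed.

Lemma gam_le34 s : gam s <= 3 / 4.
Proof.
rewrite (gamE (leqnn s)).
suff : \sum_(0 <= k < s) 2^-1 ^+ k.+2 <= 1 / 2 :> R.
  move=> h; apply: (@le_trans _ _ (1 / 4 + \sum_(0 <= k < s) 2^-1 ^+ k.+2)); last by lra.
  rewrite lerD2l; apply: ler_sum => k _; rewrite -[leRHS]mul1r ler_wpM2r ?exprn_ge0//.
  by case: (_ && _).
suff -> : \sum_(0 <= k < s) 2^-1 ^+ k.+2 = 1 / 2 - 2^-1 ^+ s.+1 :> R.
  by rewrite gerBl exprn_ge0.
elim: s => [|s IH]; first by rewrite big_geq// expr1; lra.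
by rewrite big_nat_recr//= IH !exprS; lra.
Qed.

Lemma gam_ge14 s : 1 / 4 <= gam s.
Proof.
rewrite (gamE (leqnn s)) lerDl; apply: sumr_ge0 => k _.
by rewrite mulr_ge0// exprn_ge0.
Qed.

Definition gamma : R := sup (range gam).

Let has_sup_gam : has_sup (range gam).
Proof.
split; first by exists (gam 0%N); exists 0%N.
by exists (3 / 4) => _ [s _ <-]; exact: gam_le34.
Qed.

Lemma gam_le_gamma s : gam s <= gamma.
Proof. by apply: ub_le_sup; [have [] := has_sup_gam|exists s]. Qed.

Lemma gamma_le34 : gamma <= 3 / 4.
Proof. by apply: ge_sup; [have [] := has_sup_gam|move=> _ [s _ <-]; exact: gam_le34]. Qed.

Lemma gamma_ge14 : 1 / 4 <= gamma.
Proof. exact: le_trans (gam_ge14 0) (gam_le_gamma 0). Qed.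

Lemma lt_gamma y : y < gamma -> exists s, y < gam s.
Proof.
move=> yg; have e0 : 0 < gamma - y by rewrite subr_gt0.
have [_ [s _ <-]] := sup_adherent e0 has_sup_gam.
by rewrite -/gamma opprB addrC subrK; exists s.
Qed.

(** Index [k] with [decode k = [:: m; i; s & _]] stands for the dyadic number
    [i / 2 ^ m], provided that it is certified at stage [s] to be below
    [gamma], and for [0] otherwise. *)
Definition node_exp k := cnth k 0.
Definition node_num k : nat :=
  if (cnth k 1 * 2 ^ (cnth k 2).+2 <= gam_num (cnth k 2) * 2 ^ cnth k 0)%N
  then cnth k 1 else 0.
Definition node k : R := (node_num k)%:R / 2 ^+ node_exp k.

Lemma node_ge0 k : 0 <= node k.
Proof. by rewrite divr_ge0// exprn_ge0. Qed.

Lemma cnth_le k i : (cnth k i <= k)%N.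
Proof.
rewrite cnthE; have [h|h] := ltnP i (size (CodeSeq.decode k)).
  by apply: ltnW; have /allP := CodeSeq.gtn_decode k; apply; exact: mem_nth.
by rewrite nth_default.
Qed.

(** The certifying stage is an entry of the list coded by [k], hence at most [k]. This is what makes
    the index of a distinguished vector bound a stage of the enumeration. *)
Lemma node_le k : node k <= gam k.
Proof.
apply: le_trans (gam_mono (cnth_le k 2)).
rewrite /node /node_num; case: ifP => [h|_]; last first.
  by rewrite mul0r (le_trans _ (gam_ge14 _)).
rewrite /gam ler_pdivrMr ?exprn_gt0// mulrAC ler_pdivlMr ?exprn_gt0//.
by rewrite -!natrX -!natrM ler_nat.
Qed.

Lemma node_dense y eps : 0 <= y <= gamma -> 0 < eps ->
  exists k, [/\ (n <= k)%N, node k <= y & y - node k < eps].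
Proof.
move=> /andP[y0 yg] eps0.
have g0 : 0 < gamma by apply: lt_le_trans gamma_ge14; lra.
(* Moving slightly below [y] guarantees [t < gamma] even for [y = gamma], so that a certifying stage
   exists. *)
pose t := Num.max (y - eps / 2) 0.
have t0 : 0 <= t by rewrite le_max lexx orbT.
have ty : t <= y by rewrite ge_max y0 andbT; lra.
have tg : t < gamma by rewrite gt_max g0 andbT; lra.
have yt : y - t <= eps / 2 by have : y - eps / 2 <= t by [rewrite le_max lexx]; lra.
have [s ts] := lt_gamma tg.
have e20 : 0 < eps / 2 by rewrite divr_gt0.
have [m hm] := exists_expr2V_lt e20.
have K0 : 0 < 2 ^+ m :> R by rewrite exprn_gt0.
pose i := Num.truncn (t * 2 ^+ m).
have /andP[it ti] : i%:R <= t * 2 ^+ m < i.+1%:R.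
  by apply: truncn_itv; rewrite mulr_ge0// ltW.
(* The fourth entry [n] has no meaning for the node; it pushes the index up to at least [n], as
   smaller positive indices are reserved for atoms. *)
pose k := CodeSeq.code [:: m; i; s; n].
have kE : node k = i%:R / 2 ^+ m.
  have [c0 c1 c2] : [/\ cnth k 0 = m, cnth k 1 = i & cnth k 2 = s].
    by rewrite !cnthE CodeSeq.codeK.
  rewrite /node /node_num /node_exp c0 c1 c2 ifT//.
  have : i%:R / 2 ^+ m <= gam s by rewrite (le_trans _ (ltW ts))// ler_pdivrMr.
  rewrite /gam ler_pdivrMr ?exprn_gt0// mulrAC ler_pdivlMr ?exprn_gt0//.
  by rewrite -!natrX -!natrM ler_nat.
have it' : i%:R / 2 ^+ m <= t by rewrite ler_pdivrMr.
have ti' : t < i%:R / 2 ^+ m + 2^-1 ^+ m.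
  by rewrite exprVn -[X in _ + X]mul1r -mulrDl natr1 ltr_pdivlMr.
exists k; split.
- have /allP := CodeSeq.ltn_code [:: m; i; s; n]; rewrite -/k => h.
  by apply/ltnW/h; rewrite !inE eqxx !orbT.
- by rewrite kE (le_trans it').
- by rewrite kE; lra.
Qed.

Lemma rec1_gam_num : rec1 no_oracle gam_num.
Proof. have h := Erec; rewrite /rec1 /gam_num; rec. Qed.

Lemma rec1_node_exp : rec1 no_oracle node_exp.
Proof. have h := rec2_cnth no_oracle; rewrite /rec1 /node_exp; rec. Qed.

Lemma rec1_node_num : rec1 no_oracle node_num.
Proof.
have h := rec2_cnth no_oracle; have h' := rec1_gam_num.
rewrite /rec1 /node_num; rec.
Qed.

End StageReals.

(** * The presentation *)

Section Presentation.
Variables (R : realType) (n : nat) (p : R) (p1 : 1 <= p) (hn : (1 <= n)%N).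
Variable E : nat -> nat -> bool.
Hypothesis Erec : rec2 no_oracle (fun k s => E k s).
Hypothesis Emono : forall k s t, (s <= t)%N -> E k s -> E k t.
Local Notation W := (LpSum n p1).
Local Notation mu := (unit_measure R).

Let p0 : 0 < p := p_gt0 p1.
Let G : R := gamma R E.
Let node_ k : R := node R E k.

Let G0 : 0 < G. Proof. by apply: lt_le_trans (gamma_ge14 R E); lra. Qed.
Let G1 : 0 < 1 - G. Proof. by have := gamma_le34 R E; rewrite -/G; lra. Qed.

Definition atom0 : 'I_n := Ordinal hn.
Definition atom_weight : R := (1 - G) `^ p^-1.
Definition tail_weight : R := G `^ p^-1.

Lemma atom_weight_powR : atom_weight `^ p = 1 - G.
Proof. by rewrite -powRrM mulVf ?gt_eqF// powRr1// ltW. Qed.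
Lemma tail_weight_powR : tail_weight `^ p = G.
Proof. by rewrite -powRrM mulVf ?gt_eqF// powRr1// ltW. Qed.
Lemma atom_weight_gt0 : 0 < atom_weight. Proof. exact: powR_gt0. Qed.
Lemma tail_weight_gt0 : 0 < tail_weight. Proof. exact: powR_gt0. Qed.

Lemma atom_weight_le1 : atom_weight <= 1.
Proof.
apply: (@le_trans _ _ (1 `^ p^-1)); last by rewrite powR1.
rewrite ge0_ler_powR ?nnegrE ?invr_ge0 ?(ltW p0) ?(ltW G1)//.
by have := G0; lra.
Qed.

Lemma normc_weight (w : R) (z : R[i]) : 0 <= w ->
  Normc.normc (w%:C%C * z) `^ p = w `^ p * Normc.normc z `^ p.
Proof. by move=> w0; rewrite Normc.normcM normc_real ger0_norm// powRM// normc_ge0. Qed.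

Definition tail (t : R) : LpCfun p1 :=
  set_indicator p1 (measurable_itv (`[t, 1]%R : interval R)).

(** The copy of the indicator of [[y, 1]]: the part up to [G] is stretched onto [0, 1], the part
    beyond [G] collapses to the special atom, and the weights are the p-th roots of the masses. For
    [0 <= y <= G] the modular is [(1 - G) + (G - y) = 1 - y]. *)
Definition tail_vector (y : R) : W :=
  (atom_weight%:C%C *: delta_mx 0 atom0, tail_weight%:C%C *: Lp_class (tail (y / G))).

(** Index 0 is a tail instead of the special atom, which must not be listed; the indices from 1 to
    [n - 1] keep their atoms. *)
Definition is_node k : bool := (k == 0%N) || (n <= k)%N.

Definition pres (k : nat) : W :=
  match insub k : option 'I_n with
  | Some j => if k == 0%N then tail_vector (node_ k) else LpSum_atom p1 j
  | None => tail_vector (node_ k)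
  end.

Lemma presE k : pres k = if is_node k then tail_vector (node_ k) else pres k.
Proof.
rewrite /pres /is_node; case: insubP => [j jn jk|]; last first.
  by rewrite -leqNgt => ->; rewrite orbT.
by rewrite leqNgt jn orbF; case: ifP.
Qed.

Lemma pres_atom (j : 'I_n) : (0 < j)%N -> pres j = LpSum_atom p1 j.
Proof. by move=> j0; rewrite /pres valK gtn_eqF. Qed.

Lemma pres_fst k (i : 'I_n) : (pres k).1 0 i =
  if is_node k then (if i == atom0 then atom_weight%:C%C else 0) else (k == i)%:R.
Proof.
rewrite presE; case: ifP => h.
  by rewrite /tail_vector /= !mxE eqxx /=; case: (i == atom0); rewrite ?mulr1 ?mulr0.
move: h; rewrite /pres /is_node; case: insubP => [j jn jk|]; last first.
  by rewrite -leqNgt => ->; rewrite orbT.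
rewrite leqNgt jn orbF => ->.
by rewrite delta_atom -jk eq_sym.
Qed.

Lemma pres_snd k : (pres k).2 =
  if is_node k then tail_weight%:C%C *: Lp_class (tail (node_ k / G)) else 0.
Proof.
rewrite presE; case: ifP => // h.
move: h; rewrite /pres /is_node; case: insubP => [j jn jk|]; last first.
  by rewrite -leqNgt => ->; rewrite orbT.
by rewrite leqNgt jn orbF => ->.
Qed.

Lemma LpSum_fst_sum I (r : seq I) (P : pred I) (F : I -> W) i :
  (\sum_(j <- r | P j) F j).1 0 i = \sum_(j <- r | P j) (F j).1 0 i.
Proof. by elim/big_rec2: _ => [|j y z _ <-]; rewrite mxE. Qed.

Lemma LpSum_snd_sum I (r : seq I) (P : pred I) (F : I -> W) :
  (\sum_(j <- r | P j) F j).2 = \sum_(j <- r | P j) (F j).2.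
Proof. by elim/big_rec2: _ => [|j y z _ <-]. Qed.

Lemma rational_vectorE (r : nat -> W) c : rational_vector r c =
  \sum_(0 <= j < csize c) crat_of_code R (cnth c j) *: r j.
Proof.
rewrite /rational_vector csizeE big_mkord; apply: eq_bigr => j _.
by rewrite cnthE.
Qed.

Lemma rational_vector_fst c (i : 'I_n) : (rational_vector pres c).1 0 i =
  if i == atom0 then atom_weight%:C%C * csum R c is_node else csum R c (fun j => j == i).
Proof.
rewrite rational_vectorE LpSum_fst_sum /csum.
have -> : \sum_(0 <= j < csize c) (crat_of_code R (cnth c j) *: pres j).1 0 i =
  \sum_(0 <= j < csize c) crat_of_code R (cnth c j) * (pres j).1 0 i.
  by apply: eq_bigr => j _; rewrite mxE.
case: eqP => [i0|/eqP i0].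
  rewrite mulr_sumr [RHS]big_mkcond; apply: eq_bigr => j _; rewrite pres_fst i0 eqxx.
  case: ifP; first by rewrite mulrC.
  by rewrite /is_node => /negbT; rewrite negb_or => /andP[/negbTE -> _]; rewrite mulr0.
rewrite [RHS]big_mkcond; apply: eq_bigr => j _; rewrite pres_fst (negbTE i0).
have [->|ji] := eqVneq j i.
  have -> : is_node i = false.
    apply/negP => /orP[/eqP ii|]; last by rewrite leqNgt ltn_ord.
    by move/eqP: i0; apply; exact: val_inj.
  by rewrite mulr1.
by case: ifP => _; rewrite mulr0.
Qed.

Definition rational_fun c : LpCfun p1 :=
  \sum_(0 <= j < csize c | is_node j)
    (crat_of_code R (cnth c j) * tail_weight%:C%C) *: tail (node_ j / G).

Lemma rational_vector_snd c : (rational_vector pres c).2 = Lp_class (rational_fun c).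
Proof.
rewrite rational_vectorE LpSum_snd_sum /rational_fun Lp_class_sum [RHS]big_mkcond.
apply: eq_bigr => j _.
have -> : (crat_of_code R (cnth c j) *: pres j).2 = crat_of_code R (cnth c j) *: (pres j).2.
  by [].
by rewrite pres_snd; case: ifP => _; rewrite ?scaler0// Lp_classZ scalerA.
Qed.

Lemma tailE t y : y < 1 -> tail t y = (t <= y)%R%:R.
Proof.
move=> y1; rewrite /tail /= indicE.
have -> : (y \in `[t, 1]%classic) = (t <= y).
  by apply/idP/idP; rewrite inE /= in_itv/= (ltW y1) andbT.
by case: (t <= y).
Qed.

Lemma rational_funE c y : y < 1 -> rational_fun c y =
  tail_weight%:C%C * csum R c (fun j => is_node j && (node_ j <= G * y)).
Proof.
move=> y1; rewrite /rational_fun LpCfun_sum /csum mulr_sumr [RHS]big_mkcondr.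
apply: eq_bigr => j _; rewrite LpCfunZ tailE// ler_pdivrMr// (mulrC y).
case: (_ <= _); last by rewrite mulr0.
by rewrite mulr1 mulrC.
Qed.

(** An integer test for the tail of index [j] to cover the [i]-th cell of the grid of mesh 2^-L. *)
Definition cell L i j : bool :=
  is_node j && (node_num E j * 2 ^ L <= i * 2 ^ node_exp j)%N.

Lemma cellE L i j : cell L i j = is_node j && (node_ j <= i%:R / 2 ^+ L).
Proof.
rewrite /cell /node_ /node ler_pdivrMr ?exprn_gt0// mulrAC ler_pdivlMr ?exprn_gt0//.
by rewrite -!natrX -!natrM ler_nat.
Qed.

(** The exponent of a node is at most its index, so every node of index below [L] lies on the grid
    of mesh 2^-L and none falls inside a cell. *)
Lemma node_grid L i j (y : R) : (j < L)%N ->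
  i%:R / 2 ^+ L <= y -> y < i.+1%:R / 2 ^+ L -> (node_ j <= y) = (node_ j <= i%:R / 2 ^+ L).
Proof.
move=> jL iy yi; apply/idP/idP => [jy|h]; last exact: le_trans iy.
have := le_lt_trans jy yi; rewrite /node_ /node.
have mL : (node_exp j <= L)%N by exact: leq_trans (cnth_le _ _) (ltnW jL).
have -> : (node_num E j)%:R / 2 ^+ node_exp j =
    (node_num E j * 2 ^ (L - node_exp j))%N%:R / 2 ^+ L :> R.
  rewrite natrM natrX -[in X in _ = _ / 2 ^+ X](subnK mL) exprD invfM mulrA.
  by rewrite mulfK// expf_neq0.
by rewrite ltr_pM2r ?invr_gt0 ?exprn_gt0// ltr_nat ltnS ler_pM2r ?invr_gt0 ?exprn_gt0// ler_nat.
Qed.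

Lemma csum_eq c (w w' : nat -> bool) :
  (forall j, (j < csize c)%N -> w j = w' j) -> csum R c w = csum R c w'.
Proof.
move=> h; rewrite /csum big_nat_cond [RHS]big_nat_cond; apply: eq_bigl => j.
by case: (boolP (0 <= j < csize c)%N) => //= jc; rewrite h.
Qed.

Lemma rational_fun_modular c : let L := csize c in
  Lp_modular (Lp_class (rational_fun c)) =
  \sum_(0 <= i < 2 ^ L) Normc.normc (csum R c (cell L i)) `^ p *
     (Num.min (i.+1%:R / 2 ^+ L) G - Num.min (i%:R / 2 ^+ L) G).
Proof.
move=> L; have K0 : 0 < 2 ^+ L :> R by rewrite exprn_gt0.
pose z i : R := Num.min (i%:R / 2 ^+ L) G / G.
rewrite (@Lp_modular_step _ _ _ _ (2 ^ L) z
    (fun i => tail_weight%:C%C * csum R c (cell L i))).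
- apply: eq_bigr => i _; rewrite normc_weight ?(ltW tail_weight_gt0)// tail_weight_powR.
  by rewrite -[LHS]mulrA mulrCA; congr (_ * _); rewrite /z -mulrBl mulrC divfK// gt_eqF.
- by rewrite /z mul0r (min_idPl (ltW G0)) mul0r.
- rewrite /z natrX divff ?gt_eqF// (min_idPr _) ?divff ?gt_eqF//.
  by have := G1; lra.
- move=> i; rewrite /z ler_pM2r ?invr_gt0//.
  rewrite le_min ge_min ler_pM2r ?invr_gt0// ler_nat leqnSn /=.
  by rewrite ge_min lexx orbT.
- move=> i y iL /andP[ziy yzi].
  have y1 : y < 1.
    by apply: (lt_le_trans yzi); rewrite /z ler_pdivrMr// mul1r ge_min lexx orbT.
  rewrite rational_funE//; congr (_ * _); apply: csum_eq => j jL.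
  rewrite cellE; congr andb; apply: node_grid => //.
    move: ziy; rewrite /z ler_pdivrMr// (mulrC y) ge_min => /orP[//|].
    by rewrite -[X in X <= _]mulr1 ler_pM2l// leNgt y1.
  by move: yzi; rewrite /z ltr_pdivlMr// (mulrC y) lt_min => /andP[].
Qed.

(** The right-hand side does not mention [G]. The first sum collects the ordinary atoms, its term
    for the special index 0 being empty; the second treats the special atom and the function part as
    one step function on [0, 1]. *)
Lemma rational_vector_modular c : let L := csize c in
  sum_modular (rational_vector pres c) =
  \sum_(0 <= i < n) Normc.normc (csum R c (fun j => (j == i) && (0 < i)%N)) `^ p +
  (\sum_(0 <= i < 2 ^ L) Normc.normc (csum R c (cell L i)) `^ p) / (2 ^ L)%N%:R.
Proof.
move=> L; have K0 : 0 < 2 ^+ L :> R by rewrite exprn_gt0.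
set b := Normc.normc (csum R c is_node) `^ p.
rewrite /sum_modular rational_vector_snd rational_fun_modular -/L.
have -> : \sum_(i < n) Normc.normc ((rational_vector pres c).1 0 i) `^ p =
    (1 - G) * b +
    \sum_(0 <= i < n) Normc.normc (csum R c (fun j => (j == i) && (0 < i)%N)) `^ p.
  rewrite big_mkord (bigD1 atom0)//= [in RHS](bigD1 atom0)//=.
  rewrite rational_vector_fst eqxx normc_weight ?(ltW atom_weight_gt0)// atom_weight_powR -/b.
  have -> : csum R c (fun j => (j == 0%N) && (0 < 0)%N) = 0.
    by rewrite /csum big1// => j; rewrite andbF.
  rewrite Normc.normc0 powR0 ?gt_eqF// add0r; congr (_ + _).
  apply: eq_bigr => i i0; rewrite rational_vector_fst (negbTE i0).
  congr (Normc.normc _ `^ _); apply: csum_eq => j _.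
  by rewrite lt0n (_ : nat_of_ord i != 0%N) ?andbT.
rewrite [_ * b + _]addrC -addrA; congr (_ + _).
(* The mass of the special atom is distributed over the grid cells, each receiving the length of its
   part beyond [G]. *)
have -> : 1 - G = \sum_(0 <= i < 2 ^ L)
    (1 / 2 ^+ L - (Num.min (i.+1%:R / 2 ^+ L) G - Num.min (i%:R / 2 ^+ L) G)).
  rewrite sumrB telescope_sumr// sumr_const_nat subn0 mul0r (min_idPl (ltW G0)) subr0.
  rewrite natrX divff ?gt_eqF// (min_idPr _); last by have := G1; lra.
  by rewrite -(mulr_natr (1 / 2 ^+ L)) natrX mul1r mulVf// gt_eqF.
rewrite mulr_suml -big_split/= mulr_suml; apply: eq_bigr => i _.
rewrite natrX -[X in _ = _ * X]mul1r.
have e1 : i.+1%:R / 2 ^+ L = i%:R / 2 ^+ L + 1 / 2 ^+ L :> R by rewrite -natr1 mulrDl.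
set d := Num.min _ _ - Num.min _ _; have [d0|d0] := eqVneq (1 / 2 ^+ L - d) 0.
  by rewrite d0 mul0r add0r; congr (_ * _); apply/esym/eqP; rewrite -subr_eq0 d0.
have Gi : G < i.+1%:R / 2 ^+ L.
  rewrite ltNge; apply: contra_neqN d0 => h; rewrite /d (min_idPl h).
  rewrite (min_idPl _); last by apply: le_trans h; rewrite e1 lerDl divr_ge0// ltW.
  by rewrite e1; lra.
(* A cell reaching beyond [G] is covered by all tails in use, since their nodes are at most [G] and
   lie on the grid. Its coefficient is thus that of the special atom, and the two contributions
   merge. *)
have -> : csum R c (cell L i) = csum R c is_node.
  apply: csum_eq => j jL; rewrite cellE; case: (is_node j) => //=.
  have jG : node_ j <= G by exact: le_trans (node_le R Emono j) (gam_le_gamma _ _ _).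
  have [h|h] := leP (i%:R / 2 ^+ L) G; first by rewrite -(node_grid jL h Gi).
  by rewrite (le_trans jG)// ltW.
by rewrite -/b; ring.
Qed.

Hypothesis hp : computable_real p.

Lemma pres_norm_computable :
  exists e, forall c k, exists2 q, oeval no_oracle e [:: c; k] q &
    `|ratr (rat_of_code q) - LpSum_norm (rational_vector pres c)| < 2^-1 ^+ k.
Proof.
have pf := computable_real_family (ltW p0) hp.
have hsz := rec1_csize no_oracle.
have : computable_family (fun x : unit * nat => LpSum_norm (rational_vector pres x.2)).
  apply: (@computable_family_ext _ _ _ (fun x : unit * nat =>
    (\sum_(0 <= i < n) Normc.normc (csum R x.2 (fun j => (j == i) && (0 < i)%N)) `^ p +
     (\sum_(0 <= i < 2 ^ csize x.2) Normc.normc (csum R x.2 (cell (csize x.2) i)) `^ p)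
       / (2 ^ csize x.2)%N%:R) `^ p^-1)).
    by move=> x; rewrite LpSum_normE rational_vector_modular.
  apply: computable_family_powR1.
  - by rewrite invr_gt0.
  - by rewrite invf_le1.
  - exact: computable_family_inv.
  - move=> x; rewrite addr_ge0 ?divr_ge0//; apply: sumr_ge0 => i _; exact: powR_ge0.
  apply: computable_family_add.
    apply: computable_family_sum; first by rec.
    by apply: computable_family_normc_csum => //; rec.
  apply: computable_family_div.
  - apply: computable_family_sum; first by rec.
    have h2 := rec1_node_num Erec; have h3 := rec1_node_exp.
    by apply: computable_family_normc_csum => //; rewrite /cell /is_node; rec.
  - by rec.
  - by move=> x; rewrite expn_gt0.
move=> [f hf Ff].
have hc := rec2_ccons no_oracle.
(* The dyadic [f / 2 ^ k] is coded with last entry [2 ^ k - 1], because decoding adds 1 to the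
   denominator. *)
have [e he] : recursive no_oracle (fun x : unit * nat * nat =>
    ccons (f (tt, x.2) x.1.2) (ccons 0 (ccons (2 ^ x.1.2 - 1) 0))).
  have hf' : recursive no_oracle (fun x : unit * nat * nat => f (tt, x.2) x.1.2).
    move: hf; move/(recursive_subst (h := fun x : unit * nat * nat => ((tt, x.2), x.1.2))); apply.
    by case=> [_|[_|i _]] /=; rec.
  rec.
exists e => c k; exists (ccons (f (tt, c) k) (ccons 0 (ccons (2 ^ k - 1) 0))).
  exact: (he (tt, k, c)).
rewrite ratr_rat_of_code code3 !cnthE CodeSeq.codeK /= subr0.
by rewrite subn1 prednK ?expn_gt0// natrX; exact: (Ff (tt, c)).
Qed.

Let V := closed_span pres.

Lemma LpSum_closed_span x : V x.
Proof.
have VD y z : V y -> V z -> V (y + z) by exact: closed_spanD.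
have VZ a y : V y -> V (a *: y) by exact: closed_spanZ.
have VB y z : V y -> V z -> V (y - z).
  by move=> Vy Vz; apply: VD => //; rewrite -scaleN1r; exact: VZ.
have Vnode k : is_node k -> V (tail_vector (node_ k)).
  by move=> nk; have := closed_span_generator pres k; rewrite presE nk.
(* Close starting points give close tails, the difference being supported between them. Hence tails
   with arbitrary starting points up to [G] are limits of tails at nodes. *)
have tdist y z : 0 <= z -> z <= y -> y <= G ->
    sum_modular (tail_vector y - tail_vector z) = y - z.
  move=> z0 zy yG.
  have -> : tail_vector y - tail_vector z = (0, (- tail_weight%:C%C) *:
      Lp_class (set_indicator p1 (measurable_itv (`[z / G, y / G[%R : interval R)))).
    apply: LpSum_eq; first by rewrite /= subrr.
    rewrite /= -scalerBr -Lp_classB -!Lp_classZ; apply: eq_Lp_class => t /andP[t0 t1].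
    rewrite !LpCfunZ LpCfunB !tailE//= indicE mulNr -mulrN; congr (_ * _).
    have -> : (t \in `[(z / G), (y / G)[%classic) = (z / G <= t) && ~~ (y / G <= t).
      by rewrite -ltNge; apply/idP/idP; rewrite inE/= in_itv/=.
    case: (leP (y / G) t) => h; last by rewrite andbT sub0r; case: (_ <= _).
    rewrite (le_trans _ h) ?andbF ?subrr ?oppr0//.
    by rewrite ler_pM2r ?invr_gt0.
  rewrite /sum_modular /= big1 ?add0r; last first.
    by move=> j _; rewrite mxE Normc.normc0 powR0// gt_eqF.
  rewrite Lp_modularZ normcN normc_real ger0_norm ?(ltW tail_weight_gt0)// tail_weight_powR.
  rewrite Lp_modular_set_indicator unit_measure_itv.
  - by rewrite /= -mulrBl mulrC divfK// gt_eqF.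
  - by rewrite divr_ge0// ltW.
  - by rewrite ler_pM2r ?invr_gt0.
  - by rewrite ler_pdivrMr// mul1r.
have Vtail y : 0 <= y <= G -> V (tail_vector y).
  move=> yG; apply: closed_span_lim => eps eps0.
  have [k [nk ky yk]] := node_dense n yG eps0.
  exists (tail_vector (node_ k)); first by apply: Vnode; rewrite /is_node nk orbT.
  by rewrite tdist ?node_ge0//; case/andP: yG.
have GG : 0 <= G <= G by rewrite lexx ltW.
(* At [G] the function part is supported at the single point 1 and vanishes, which isolates the
   special atom. *)
have tG : tail_vector G = (atom_weight%:C%C *: delta_mx 0 atom0, 0).
  apply: LpSum_eq => //=; rewrite divff ?gt_eqF//.
  have -> : Lp_class (tail 1) = Lp_class 0; last exact: scaler0.
  by apply: eq_Lp_class => t /andP[_ t1]; rewrite tailE// leNgt t1.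
have aw0 : atom_weight%:C%C != 0 :> R[i].
  by rewrite eq_complex /= eqxx andbT gt_eqF// atom_weight_gt0.
have tw0 : tail_weight%:C%C != 0 :> R[i].
  by rewrite eq_complex /= eqxx andbT gt_eqF// tail_weight_gt0.
have Vatom j : V (LpSum_atom p1 j).
  have [->|j0] := eqVneq j atom0.
    have := VZ (atom_weight%:C%C)^-1 _ (Vtail G GG); rewrite tG; congr V.
    by apply: LpSum_eq => /=; rewrite ?scaler0// scalerA mulVf// scale1r.
  rewrite -pres_atom; first exact: closed_span_generator.
  by rewrite lt0n; apply: contra_neqN j0 => /eqP h; exact: val_inj.
have Vfun (f : LpSpace p1) : V (0, f).
  apply: (@Lp_dense _ _ _ (fun f => V (0, f))) => [g h Vg Vh|a g Vg|g Vg|t /andP[t0 t1]].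
  - by have := VD _ _ Vg Vh; congr V; apply: LpSum_eq => //=; rewrite addr0.
  - by have := VZ a _ Vg; congr V; apply: LpSum_eq => //=; rewrite scaler0.
  - apply: closed_span_lim => eps eps0; have [h Vh hg] := Vg _ eps0.
    exists (0, h) => //; rewrite /sum_modular /= subrr big1 ?add0r// => j _.
    by rewrite mxE Normc.normc0 powR0// gt_eqF.
  have tGG : 0 <= G * t <= G.
    by rewrite mulr_ge0 ?(ltW G0)//= -[leRHS]mulr1 ler_pM2l.
  (* The difference of the tails at [G * t] and [G] is a multiple of the indicator of [[t, 1]]. *)
  have := VZ (tail_weight%:C%C)^-1 _ (VB _ _ (Vtail _ tGG) (Vtail _ GG)); congr V.
  rewrite tG; apply: LpSum_eq => /=; first by rewrite subrr scaler0.
  by rewrite subr0 scalerA mulVf// scale1r mulrC mulKf ?gt_eqF// indicatorE.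
have -> : x = \sum_(j < n) x.1 0 j *: LpSum_atom p1 j + (0, x.2).
  apply: LpSum_eq; last first.
    rewrite /= LpSum_snd_sum big1 ?add0r// => j _ /=; exact: scaler0.
  rewrite /= addr0; apply/rowP => i; rewrite LpSum_fst_sum (bigD1 i)//= big1 ?addr0.
    by rewrite !mxE !eqxx mulr1.
  by move=> j ji; rewrite !mxE eqxx eq_sym (negbTE ji) mulr0.
apply: (VD) => //; elim/big_ind: _ => [||j _]; [|exact: VD|exact: VZ].
by rewrite -(scale0r (tail_vector G)); apply/VZ/Vtail.
Qed.

Lemma pres_computable : computable_presentation (@LpSum_norm R n p p1) pres.
Proof.
split; last exact: pres_norm_computable.
by apply: closed_span_presentation; exact: LpSum_closed_span.
Qed.

(* Beyond all the nodes mentioned by [c] the vector has the same coefficient as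
   on the special atom, where it is nearly unimodular. *)
Lemma rational_vector_near_atom c (u : R[i]) (k : nat) : Normc.normc u = 1 ->
  LpSum_norm (rational_vector pres c - u *: LpSum_atom p1 atom0) < 2^-1 ^+ k.+1 ->
  G - gam R E c < 2^-1 ^+ k.
Proof.
move=> nu; rewrite LpSum_norm_lt ?exprn_gt0// => hw.
set w := rational_vector pres c in hw; set v := w - _ in hw.
set beta := csum R c is_node.
have e0 : 0 < 2^-1 ^+ k.+1 :> R by rewrite exprn_gt0.
have sum0 : 0 <= \sum_(j < n) Normc.normc (v.1 0 j) `^ p.
  by apply: sumr_ge0 => j _; exact: powR_ge0.
have h1 : Normc.normc (atom_weight%:C%C * beta - u) < 2^-1 ^+ k.+1.
  have vE : v.1 0 atom0 = atom_weight%:C%C * beta - u.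
    rewrite /v -[(w - _).1]/(w.1 - u *: (LpSum_atom p1 atom0).1) !mxE /w.
    by rewrite rational_vector_fst !eqxx mulr1.
  rewrite -vE ltNge; apply: contraTN hw => h; rewrite -leNgt.
  apply: (@le_trans _ _ (Normc.normc (v.1 0 atom0) `^ p)).
    by rewrite ge0_ler_powR ?nnegrE ?normc_ge0 ?(ltW p0) ?(ltW e0).
  rewrite /sum_modular (bigD1 atom0)//= -addrA lerDl addr_ge0 ?Lp_modular_ge0//.
  by apply: sumr_ge0 => j _; exact: powR_ge0.
have e2 : 2^-1 ^+ k.+1 <= 1 / 2 :> R.
  by rewrite exprS mul1r ler_piMr// exprn_ile1// invf_le1 ?ler1n.
(* [u] has modulus 1, the error is at most 1/2, and the weight of the atom is at most 1. *)
have hb : 1 / 2 <= Normc.normc beta.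
  have : Normc.normc u <= Normc.normc (atom_weight%:C%C * beta) + 2^-1 ^+ k.+1.
    rewrite -[in leLHS](subKr (atom_weight%:C%C * beta) u).
    by apply: (le_trans (le_normcD _ _)); rewrite normcN lerD2l ltW.
  rewrite nu Normc.normcM normc_real ger0_norm ?(ltW atom_weight_gt0)//.
  have : atom_weight * Normc.normc beta <= Normc.normc beta.
    by rewrite -[leRHS]mul1r ler_wpM2r ?normc_ge0// atom_weight_le1.
  lra.
have gG : gam R E c <= G by exact: gam_le_gamma.
have g0 : 0 <= gam R E c by rewrite (le_trans _ (gam_ge14 R E c)).
(* Every node in use has index [j < csize c <= c] and so is at most [gam c]. Between [gam c] and [G]
   the function therefore has the constant coefficient [beta], although its target there is 0; this
   stretch alone contributes [|beta|^p (G - gam c)] to the error. *)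
have h2 : Normc.normc beta `^ p * (G - gam R E c) < (2^-1 ^+ k.+1) `^ p.
  apply: le_lt_trans hw; rewrite /sum_modular -[leLHS]add0r lerD//.
  have -> : v.2 = Lp_class (rational_fun c).
    by rewrite /v /= scaler0 subr0 rational_vector_snd.
  pose A := measurable_itv (`[gam R E c / G, 1[%R : interval R).
  pose g := (tail_weight%:C%C * beta) *: set_indicator p1 A.
  have -> : Normc.normc beta `^ p * (G - gam R E c) = Lp_modular (Lp_class g).
    rewrite Lp_classZ Lp_modularZ Lp_modular_set_indicator unit_measure_itv//.
    - rewrite normc_weight ?(ltW tail_weight_gt0)// tail_weight_powR /= mulrAC mulrC.
      by congr (_ * _); rewrite mulrBr mulr1 mulrC divfK// gt_eqF.
    - by rewrite divr_ge0// ltW.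
    - by rewrite ler_pdivrMr// mul1r.
  rewrite !Lp_modular_Rintegral; apply: le_Rintegral => //; try exact: integrable_normc.
  move=> y _; rewrite ge0_ler_powR ?nnegrE ?normc_ge0 ?(ltW p0)//.
  rewrite /g LpCfunZ Normc.normcM normc_real indicE.
  case: (boolP (y \in _)) => [|_]; last by rewrite normr0 mulr0 normc_ge0.
  rewrite inE /= in_itv/= normr1 mulr1 => /andP[cy y1].
  rewrite rational_funE// (@csum_eq c _ is_node)// => j jc.
  case: (is_node j) => //=; apply: (le_trans (node_le R Emono j)).
  apply: (@le_trans _ _ (gam R E c)); last by rewrite mulrC -ler_pdivrMr.
  apply: gam_mono => //; apply: leq_trans (ltnW jc) _.
  by rewrite csizeE size_decode.
(* The bound 1/2 for [beta] costs a factor (1/2)^p, recovered by asking for accuracy 2^-(k + 1);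
   finally [p >= 1] makes the p-th power of 2^-k at most 2^-k. *)
have h3 : (1 / 2) `^ p * (G - gam R E c) < (1 / 2) `^ p * (2^-1 ^+ k) `^ p.
  rewrite -powRM ?exprn_ge0// mul1r -exprS; apply: le_lt_trans h2.
  rewrite ler_wpM2r ?subr_ge0// ge0_ler_powR ?nnegrE ?normc_ge0 ?(ltW p0)//.
  by rewrite -[2^-1]mul1r.
rewrite ltr_pM2l ?powR_gt0// in h3.
by apply: (lt_le_trans h3); rewrite ge1r_powR// exprn_gt0//= exprn_ile1// invf_le1 ?ler1n.
Qed.

End Presentation.

(** * The reduction *)

Section Reduction.
Variables (R : realType) (n : nat) (p : R) (p1 : 1 <= p) (hn : (1 <= n)%N).
Local Notation W := (LpSum n p1).

Lemma standard_presentation_atom (j : 'I_n) :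
  standard_presentation n p1 j = LpSum_atom p1 j.
Proof. by rewrite /standard_presentation valK. Qed.

Lemma crat_of_code0 : crat_of_code R 0 = 0.
Proof.
by rewrite /crat_of_code !ratr_rat_of_code !cnthE /= subrr mul0r.
Qed.

(** Missing entries decode to 0: the inner code [[:: 1]] is (1 - 0) / (0 + 1), and the absent
    imaginary part is 0. *)
Definition code_one : nat := CodeSeq.code [:: CodeSeq.code [:: 1%N]].

Lemma crat_of_code1 : crat_of_code R code_one = 1.
Proof.
rewrite /crat_of_code /code_one CodeSeq.codeK; set c := CodeSeq.code [:: 1%N].
have cE : CodeSeq.decode c = [:: 1%N] by exact: CodeSeq.codeK.
rewrite [nth _ _ 0]/= [nth _ _ 1]/= !ratr_rat_of_code !cnthE cE /=.
by rewrite !subr0 mul0r divr1.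
Qed.

Definition atom_code (j : nat) : nat := CodeSeq.code (rcons (nseq j 0%N) code_one).

Lemma rational_vector_atom_code (r : nat -> W) j : rational_vector r (atom_code j) = r j.
Proof.
rewrite rational_vectorE csizeE /atom_code CodeSeq.codeK size_rcons size_nseq.
rewrite big_nat_recr//= cnthE CodeSeq.codeK nth_rcons size_nseq ltnn eqxx.
rewrite crat_of_code1 scale1r big_nat big1 ?add0r// => i /andP[_ ij].
rewrite cnthE CodeSeq.codeK nth_rcons size_nseq ij nth_nseq ij.
by rewrite crat_of_code0 scale0r.
Qed.

Lemma rec1_oracle_join o f : rec1 o f -> rec1 o (oracle_join o f).
Proof.
move=> hf.
have ho : rec1 o o by exists OAsk => x; exact: oeval_ask.
apply: (@recursive_ext _ _ _ (fun x : unit * nat =>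
  if (x.2 %/ 2 * 2 == x.2)%N then o (x.2 %/ 2)%N else f (x.2 %/ 2)%N)).
  by move=> x; rewrite /oracle_join -divn2 -dvdn_eq dvdn2; case: (odd x.2).
rec.
Qed.

Hypothesis p2 : p <> 2.
Variables (E : nat -> nat -> bool) (A : set nat).
Hypothesis Erec : rec2 no_oracle (fun k s => E k s).
Hypothesis Emono : forall k s t, (s <= t)%N -> E k s -> E k t.
Hypothesis AE : forall k, A k <-> exists s, E k s.

Lemma isometric_isomorphism_computes (X : set nat) (T : W -> W) :
  isometric_isomorphism (@LpSum_norm R n p p1) (@LpSum_norm R n p p1) T ->
  computable_map X (@LpSum_norm R n p p1) (@standard_presentation R n p p1)
    (@LpSum_norm R n p p1) (pres p1 hn E) T ->
  Turing_le A X.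
Proof.
move=> Tiso [e he].
have [j [u [nu Tj]]] := isometric_isomorphism_atom p2 (atom0 hn) Tiso.
(* The atom is itself a rational vector, so a constant sequence names it and the joined oracle
   reduces to [X]. *)
pose f : nat -> nat := fun=> atom_code j.
have [|g gname hg] := he (LpSum_atom p1 j) f.
  move=> k; rewrite rational_vector_atom_code standard_presentation_atom subrr.
  by rewrite LpSum_norm_lt ?exprn_gt0// sum_modular0 powR_gt0 ?exprn_gt0.
have hf : rec1 (char_fun X) f by exact: recursive_const.
have hgX : rec1 (char_fun X) g.
  have [q hq] := rec1_oracle_join hf; exists (osubst q e) => -[[] k].
  by apply: (oeval_osubst _ (hg k)) => i; exact: (hq (tt, i)).
have hE := rec2_oracle (char_fun X) Erec.
(* Membership of [k] is read off at stage [s = g (k + 4)]. Accuracy 2^-(k + 4) gives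
   [gamma - gam s < 2^-(k + 3)], less than the jump 2^-(k + 2) that a later arrival of [k] would
   cause. The condition [k < s] appears because [gam s] counts only indices below [s]. *)
apply/Turing_leP; apply: (@recursive_ext _ _ _ (fun x : unit * nat =>
  ((x.2 < g (x.2 + 4)) && E x.2 (g (x.2 + 4)) : bool) : nat)%N); last first.
  apply: recursive_and; first by rec.
  by apply: (recursive_app2 (g := fun k s => E k s : nat) hE); rec.
move=> [[] k]; rewrite [_.2]/= addn4; set s := g k.+4.
rewrite /char_fun; congr nat_of_bool; apply/idP/asboolP => [/andP[_ Eks]|].
  by apply/AE; exists s.
move=> /AE[t Ekt]; apply/negPn/negP => nE.
have near : gamma R E - gam R E s < 2^-1 ^+ k.+3.
  apply: (rational_vector_near_atom Emono nu (p1 := p1) (hn := hn)).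
  by have := gname k.+4; rewrite Tj.
pose m := maxn s (maxn t k.+1).
have Ekm : E k m by apply: Emono Ekt; rewrite !leq_max leqnn orbT.
have sm : (s <= m)%N by exact: leq_maxl.
have km : (k < m)%N by rewrite !leq_max ltnSn !orbT.
have h := gam_jump R Emono sm km Ekm nE.
have := gam_le_gamma R E m.
have : 2^-1 ^+ k.+3 <= 2^-1 ^+ k.+2 :> R.
  by rewrite [leLHS]exprS ler_piMl ?exprn_ge0// invf_le1 ?ler1n.
by move: near h; rewrite -/m; lra.
Qed.

End Reduction.

Theorem theorem6p1 (R : realType) (p : R) (p1 : 1 <= p)
    (hp : computable_real p) (p2 : p <> 2) (n : nat) (hn : (1 <= n)%N)
    (d : Turing_degree) (hd : ce_degree d) :
  exists r : nat -> LpSum n p1,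
    computable_presentation (@LpSum_norm R n p p1) r /\
    forall x : Turing_degree,
      degree_computes_isometric_isomorphism x
        (@LpSum_norm R n p p1) (@standard_presentation R n p p1)
        (@LpSum_norm R n p p1) r ->
      degree_le d x.
Proof.
have [A dA /ce_set_stages[E [Erec Emono AE]]] := hd.
exists (pres p1 hn E); split; first exact: pres_computable.
move=> x [T [Tiso [X xX compT]]] B Y dB xY.
have AX := isometric_isomorphism_computes p2 Erec Emono AE Tiso compT.
(* Members of one degree are reducible to each other, so the reduction between the chosen
   representatives extends to all of them. *)
have equiv (c : Turing_degree) C D : c C -> c D -> Turing_le C D.
  have [C0 ->] := degreeP c => -[_ C0C] [DC0 _].
  exact: Turing_le_trans C0C DC0.
apply: Turing_le_trans (equiv _ _ _ dB dA) _.
exact: Turing_le_trans AX (equiv _ _ _ xX xY).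
Qed.
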